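(* Let $d \ge 1$, $1<p<2$, $s \in (0,1)$ and let $k \in \mathbb{N}$ with $1 \le k \le d$. Let $\alpha,\beta\in\mathbb{R}$ satisfy $\alpha,\ \beta,\ \alpha+\beta \in (-k, sp)$. Then, for all $u \in C^1_c(\mathbb{R}^d)$ when $sp < k+\alpha+\beta$, and for all $u \in C^1_c(\mathbb{R}^d\setminus K)$ when $sp > k+\alpha+\beta$, the following inequality holds: $$\int_{\mathbb{R}^d}\int_{\mathbb{R}^d} \frac{|u(x)-u(y)|^p}{|x-y|^{d+sp}}|x_k|^\alpha |y_k|^\beta\,dx\,dy - \mathcal{C}\int_{\mathbb{R}^d}\frac{|u(x)|^p}{|x_k|^{sp-\alpha-\beta}}\,dx$$ $$\ge\ C_p\int_{\mathbb{R}^d}\int_{\mathbb{R}^d}\frac{\left(v(x)^{\langle p/2\rangle}-v(y)^{\langle p/2\rangle}\right)^2}{|x-y|^{d+sp}}\,W(x,y)\,|x_k|^{\alpha}|y_k|^{\beta}\,dx\,dy,$$ where $v(x)=|x_k|^{(k+\alpha+\beta-sp)/p}u(x)$, $$W(x,y)=\min\left\{|x_k|^{-\frac{k+\alpha+\beta-sp}{p}},|y_k|^{-\frac{k+\alpha+\beta-sp}{p}}\right\}\ \max\left\{|x_k|^{-\frac{k+\alpha+\beta-sp}{p}},|y_k|^{-\frac{k+\alpha+\beta-sp}{p}}\right\}^{p-1},$$ the constant $\mathcal{C}=\mathcal{C}(d,s,p,k,\alpha,\beta)>0$ is the one defined in the context, and $$C_p=\max\left\{\frac{p-1}{p},\frac{p(p-1)}{2}\right\}.$$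 When $u$ is nonnegative, the constant $C_p$ can be taken to be $p-1$.
   Context: Functions are real-valued. For $a\in\mathbb{R}$ and $t>0$, $a^{\langle t\rangle}:=|a|^t\operatorname{sgn}(a)$. For $x\in\mathbb{R}^d$ write $x=(x_k,x_{d-k})$ with $x_k\in\mathbb{R}^k$, $x_{d-k}\in\mathbb{R}^{d-k}$ (for $k=d$, $x_k=x$). $K=\{x=(x_k,x_{d-k})\in\mathbb{R}^k\times\mathbb{R}^{d-k}: x_k=0\}$ for $k<d$, and $K=\{0\}$ for $k=d$. $C^1_c(\Omega)$ denotes the $C^1$ functions with compact support in the open set $\Omega$. For an integer $n\ge 1$ and $r\in(0,1)$ define $$\Phi_{n,s,p}(r)=|\mathbb{S}^{n-2}|\int_{-1}^1\frac{(1-t^2)^{\frac{n-3}{2}}}{(1-2tr+r^2)^{\frac{n+sp}{2}}}\,dt\quad (n\ge2),\qquad \Phi_{1,s,p}(r)=(1-r)^{-1-sp}+(1+r)^{-1-sp},$$ where $|\mathbb{S}^{n-2}|$ is the surface measure of the unit sphere in $\mathbb{R}^{n-1}$ ($|\mathbb{S}^0|=2$), and $$\mathcal{C}_1(n,s,p,\alpha,\beta)=\int_0^1 r^{sp-1}\left(r^{-\alpha}+r^{-\beta}\right)\left|1-r^{(n+\alpha+\beta-sp)/p}\right|^p\Phi_{n,s,p}(r)\,dr.$$ With $\Gamma$ the Gamma function, set $$\mathcal{C}(d,s,p,k,\alpha,\beta)=\frac{\pi^{(d-k)/2}\,\Gamma\!\left(\frac{k+sp}{2}\right)}{\Gamma\!\left(\frac{d+sp}{2}\right)}\,\mathcal{C}_1(k,s,p,\alpha,\beta).$$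 *)

(* Defs.v *)
From HB Require Import structures.
From mathcomp Require Import all_boot all_order all_algebra.
From mathcomp Require Import all_classical all_reals all_analysis.

Set Implicit Arguments.
Unset Strict Implicit.
Unset Printing Implicit Defensive.
Import Order.TTheory GRing.Theory Num.Theory.
Import numFieldNormedType.Exports.

Local Open Scope classical_set_scope.
Local Open Scope ring_scope.

(* The product sigma-algebra on row vectors, as the library does for tuples. *)
Definition measure_rV_display : measure_display -> measure_display.
Proof. exact. Qed.

Section measurable_rV.
Context {d : measure_display} {T : measurableType d} (n : nat).

Let coors : 'I_n -> 'rV[T]_n -> T := fun i x => x ord0 i.

Let rV_set0 : g_sigma_preimage coors set0.
Proof. exact: sigma_algebra0. Qed.

Let rV_setC A : g_sigma_preimage coors A -> g_sigma_preimage coors (~` A).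
Proof. exact: sigma_algebraC. Qed.

Let rV_bigcup (F : _^nat) : (forall i, g_sigma_preimage coors (F i)) ->
  g_sigma_preimage coors (\bigcup_i (F i)).
Proof. exact: sigma_algebra_bigcup. Qed.

HB.instance Definition _ := @isMeasurable.Build (measure_rV_display d)
  'rV[T]_n (g_sigma_preimage coors) rV_set0 rV_setC rV_bigcup.

End measurable_rV.

Lemma measurable_fun_rV d1 d2 (T1 : measurableType d1) (T2 : measurableType d2)
    n (f : T1 -> 'rV[T2]_n) :
  (forall i, measurable_fun [set: T1] (fun x => f x ord0 i)) ->
  measurable_fun [set: T1] f.
Proof.
move=> mf; suff sub : g_sigma_preimage (fun i x => f x ord0 i) `<=` measurable.
  move=> _ A mA; apply: sub.
  by rewrite (@g_sigma_preimage_comp _ _ _ _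
    (fun i (x : 'rV[T2]_n) => x ord0 i) _ f); exists A.
apply: smallest_sub; first exact: sigma_algebra_measurable.
case: n => [|n] in f mf *; first by rewrite big_ord0.
rewrite -bigcup_mkord_ord; apply: bigcup_sub => i Ii.
by move=> A [B mB <-]; exact: mf.
Qed.

Lemma measurable_coord_rV d (T : measurableType d) n (i : 'I_n) :
  measurable_fun [set: 'rV[T]_n] (fun x => x ord0 i).
Proof.
move=> _ Y mY; rewrite setTI; apply: sub_sigma_algebra => /=.
rewrite -bigcup_seq/=; exists i => /=; first by rewrite mem_index_enum.
by exists Y => //; rewrite setTI.
Qed.

Section lebesgue_measure_rV.
Context {R : realType}.

Definition cons_rV n (p : 'rV[R]_n * R) : 'rV[R]_n.+1 :=
  \row_(i < n.+1) oapp (p.1 ord0) p.2 (unlift ord0 i).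

Lemma measurable_cons_rV n : measurable_fun setT (@cons_rV n).
Proof.
apply: measurable_fun_rV => i; rewrite /cons_rV.
under eq_fun do rewrite mxE.
case: (unlift ord0 i) => [j|] /=; last exact: measurable_snd.
exact: (measurableT_comp (measurable_coord_rV j) measurable_fst).
Qed.

Section cons_measure.
Context n (m : {measure set 'rV[R]_n -> \bar R}).

Definition cons_measure : set 'rV[R]_n.+1 -> \bar R :=
  pushforward (m \x (@lebesgue_measure R))%E (@cons_rV n).

Let mcons := @measurable_cons_rV n.

Let cons_measure0 : cons_measure set0 = 0%E.
Proof. exact: measure0. Qed.

Let cons_measure_ge0 A : (0 <= cons_measure A)%E.
Proof. exact: measure_ge0. Qed.

Let cons_measure_sigma_additive : semi_sigma_additive cons_measure.
Proof. exact: measure_semi_sigma_additive. Qed.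

HB.instance Definition _ := isMeasure.Build _ _ _ cons_measure
  cons_measure0 cons_measure_ge0 cons_measure_sigma_additive.

End cons_measure.

Fixpoint lebesgue_measure_rV n : {measure set 'rV[R]_n -> \bar R} :=
  match n with
  | 0%N => \d_(0 : 'rV[R]_0)
  | n'.+1 => cons_measure (lebesgue_measure_rV n')
  end.

End lebesgue_measure_rV.

Section definitions.
Context {R : realType}.

(* The library norm on 'rV[R]_d is the sup norm, so the Euclidean one is
   defined here; [pnorm k x] is the Euclidean norm |x_k| of the projection of
   x to its first k coordinates. *)
Definition enorm d (x : 'rV[R]_d) : R := Num.sqrt (\sum_i x ord0 i ^+ 2).

Definition pnorm (k d : nat) (x : 'rV[R]_d) : R :=
  Num.sqrt (\sum_(i < d | (i < k)%N) x ord0 i ^+ 2).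

Definition singular_set (k d : nat) : set 'rV[R]_d :=
  [set x | forall i : 'I_d, (i < k)%N -> x ord0 i = 0].

Definition spow (a t : R) : R := `|a| `^ t * Num.sg a.

Definition C1 d (u : 'rV[R]_d -> R) : Prop :=
  (forall x, differentiable u x) /\
  (forall v : 'rV[R]_d, continuous (fun x => 'D_v u x)).

(* A function of C^1_c(Omega) is identified with its extension by zero. *)
Definition C1c d (Omega : set 'rV[R]_d) (u : 'rV[R]_d -> R) : Prop :=
  let supp := closure [set x | u x != 0] in
  [/\ C1 u, compact supp & supp `<=` Omega].

(* Total surface measure of the unit sphere of R^m, the surface measure of a
   Borel set A of the sphere being m times the Lebesgue measure of the cone
   {r w : 0 < r <= 1, w in A}. *)
Definition sphere_area (m : nat) : R :=
  m%:R * fine (@lebesgue_measure_rV R m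
    [set r *: w | r in `]0, 1] & w in [set w : 'rV[R]_m | enorm w = 1]]).

(* Only meaningful for a > 0. *)
Definition Gamma (a : R) : R :=
  \int[@lebesgue_measure R]_(t in `]0, +oo[) (t `^ (a - 1) * expR (- t)).

Definition Phi (n : nat) (s p r : R) : R :=
  if n == 1%N then (1 - r) `^ (- 1 - s * p) + (1 + r) `^ (- 1 - s * p)
  else sphere_area n.-1 *
    \int[@lebesgue_measure R]_(t in `[-1, 1])
      ((1 - t ^+ 2) `^ ((n%:R - 3) / 2) /
       (1 - 2 * t * r + r ^+ 2) `^ ((n%:R + s * p) / 2)).

Definition hardy_const1 (n : nat) (s p alpha beta : R) : R :=
  \int[@lebesgue_measure R]_(r in `]0, 1[)
    (r `^ (s * p - 1) * (r `^ (- alpha) + r `^ (- beta)) *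
     `|1 - r `^ ((n%:R + alpha + beta - s * p) / p)| `^ p * Phi n s p r).

Definition hardy_const (d : nat) (s p : R) (k : nat) (alpha beta : R) : R :=
  pi `^ ((d%:R - k%:R) / 2) * Gamma ((k%:R + s * p) / 2)
    / Gamma ((d%:R + s * p) / 2) * hardy_const1 k s p alpha beta.

Section forms.
Context (d k : nat) (s p alpha beta : R).
Local Notation mu := (@lebesgue_measure_rV R d).
Local Notation expo := ((k%:R + alpha + beta - s * p) / p).

Definition energy (u : 'rV[R]_d -> R) : \bar R :=
  (\int[mu]_y \int[mu]_x
    (`|u x - u y| `^ p / enorm (x - y) `^ (d%:R + s * p) *
     pnorm k x `^ alpha * pnorm k y `^ beta)%:E)%E.

Definition hardy_term (u : 'rV[R]_d -> R) : \bar R :=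
  (\int[mu]_x (`|u x| `^ p / pnorm k x `^ (s * p - alpha - beta))%:E)%E.

Definition ground_state (u : 'rV[R]_d -> R) (x : 'rV[R]_d) : R :=
  pnorm k x `^ expo * u x.

Definition W (x y : 'rV[R]_d) : R :=
  let a := pnorm k x `^ (- expo) in
  let b := pnorm k y `^ (- expo) in
  Num.min a b * Num.max a b `^ (p - 1).

Definition remainder (u : 'rV[R]_d -> R) : \bar R :=
  let v := ground_state u in
  (\int[mu]_y \int[mu]_x
    ((spow (v x) (p / 2) - spow (v y) (p / 2)) ^+ 2 /
     enorm (x - y) `^ (d%:R + s * p) * W x y *
     pnorm k x `^ alpha * pnorm k y `^ beta)%:E)%E.

(* Every term is finite for the functions u considered in the theorem; should
   both terms on the left be +oo, their difference would be -oo. *)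
Definition hardy_remainder_ineq (c : R) (u : 'rV[R]_d -> R) : Prop :=
  (energy u - (hardy_const d s p k alpha beta)%:E * hardy_term u
     >= c%:E * remainder u)%E.

End forms.
End definitions.

Arguments singular_set {R} k d _.

(* Main.v *)
Require Import Defs.
From HB Require Import structures.
From mathcomp Require Import all_boot all_order all_algebra.
From mathcomp Require Import all_classical all_reals all_analysis.
From mathcomp Require Import measurable_realfun ring lra.

Set Implicit Arguments.
Unset Strict Implicit.
Unset Printing Implicit Defensive.
Import Order.TTheory GRing.Theory Num.Theory.
Import numFieldNormedType.Exports.

Local Open Scope classical_set_scope.
Local Open Scope ring_scope.

(* Write u = w v with w(x) = |x_k|^(-gam), gam = (k + alpha + beta - sp) / p.
   A Picone inequality with remainder bounds |u(x) - u(y)|^p from below by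

     (w(x) - w(y))^(p-1) (w(x) |v(x)|^p - w(y) |v(y)|^p) + C_p W(x,y) (...)^2

   when w(y) <= w(x). The first term depends on y only through |x_k|, |y_k| and
   |x - y|, so its integral against the kernel reduces, by Tonelli, a Gaussian
   integration over x_{d-k} and polar coordinates in R^k, to the Hardy term
   times a one-dimensional integral in r = |y_k| / |x_k|. The two halves of that
   integral diverge separately at r = 1, so it is first restricted to
   min(|x_k|, |y_k|) < delta max(|x_k|, |y_k|), where their difference is the
   part over r < delta of the integral defining the Hardy constant; then
   delta tends to 1 by monotone convergence. *)

(** * Picone's inequality with remainder *)

(** Scaling Picone's inequality leaves t = w(y) / w(x) in (0, 1] and two real values. For values of
    one sign the constant p - 1 comes from monotonicity in t. For opposite signs the inequality
    reduces to (a + 1)^p - (2 - p) a^p >= c (a^(p/2) + 1)^2, and the two entries of C_p are two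
    values of c for which this holds, by superadditivity and by concavity of powers; the second is
    at least the first exactly when p^2 >= 2. The truncation uses the ratio of |x_k| and |y_k|
    because it is invariant under dilations: for fixed x the inner integral is still a power of
    |x_k| times a number, so each half is a multiple of the Hardy term. For delta < 1 the half to be
    subtracted has a finite number and the Hardy term is finite, so it can be cancelled; until then
    both sides are integrals of nonnegative functions, possibly infinite. The sign of gam decides
    which of the two halves is subtracted, and gam = 0 is excluded by the alternative on s p. *)

Section powR_inequalities.
Context {R : realType}.
Implicit Types x y a b t e p l : R.

Lemma ler_powR2r e x y : 0 <= e -> 0 <= x -> x <= y -> x `^ e <= y `^ e.
Proof.
by move=> e0 x0 xy; apply: ge0_ler_powR => //; rewrite nnegrE// (le_trans x0).
Qed.

Lemma powR_le1_ge1 x e : 0 < x <= 1 -> e <= 0 -> 1 <= x `^ e.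
Proof. by move=> x01 e0; rewrite -[leLHS](powRr0 x); exact: ger_powR. Qed.

Lemma powR_ge1_ge1 x e : 1 <= x -> 0 <= e -> 1 <= x `^ e.
Proof. by move=> x01 e0; rewrite -[leLHS](powRr0 x); exact: ler_powR. Qed.

Lemma powR_le1_le1 x e : 0 <= x <= 1 -> 0 <= e -> x `^ e <= 1.
Proof.
move=> /andP[x0 x1] e0; have -> : 1 = 1 `^ e :> R by rewrite powR1.
by apply: ge0_ler_powR; rewrite ?nnegrE.
Qed.

Lemma powRK e x : e != 0 -> 0 <= x -> (x `^ e) `^ e^-1 = x.
Proof. by move=> e0 x0; rewrite -powRrM divff// powRr1. Qed.

Lemma powRVK e x : e != 0 -> 0 <= x -> (x `^ e^-1) `^ e = x.
Proof. by move=> e0 x0; rewrite -powRrM mulVf// powRr1. Qed.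

Lemma powR_half_sqr a p : 0 <= a -> (a `^ (p / 2)) ^+ 2 = a `^ p.
Proof.
by move=> a0; rewrite -powR_mulrn ?powR_ge0// -powRrM divfK// pnatr_eq0.
Qed.

Lemma convex_powR_le p l x y : 1 <= p -> 0 <= l <= 1 -> 0 <= x -> 0 <= y ->
  (l * x + (1 - l) * y) `^ p <= l * x `^ p + (1 - l) * y `^ p.
Proof.
move=> p1 l01 x0 y0.
have hx : x \in (`[0, +oo[%classic : set R) by rewrite inE/= in_itv/= andbT.
have hy : y \in (`[0, +oo[%classic : set R) by rewrite inE/= in_itv/= andbT.
have := @convex_powR R p p1 (Itv01 (andP l01).1 (andP l01).2) x y hx hy.
by rewrite !convRE/= /unstable.onem.
Qed.

(** Convexity of the power 1/e, applied to x^e and y^e. *)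
Lemma concave_powR_le e l x y : 0 < e <= 1 -> 0 <= l <= 1 -> 0 <= x -> 0 <= y ->
  l * x `^ e + (1 - l) * y `^ e <= (l * x + (1 - l) * y) `^ e.
Proof.
move=> /andP[e0 e1] l01 x0 y0.
have ie1 : 1 <= e^-1 by rewrite invf_ge1.
have e0' : e != 0 by rewrite gt_eqF.
have := convex_powR_le ie1 l01 (powR_ge0 x e) (powR_ge0 y e).
rewrite !powRK// => h.
have z0 : 0 <= l * x `^ e + (1 - l) * y `^ e.
  by have := powR_ge0 x e; have := powR_ge0 y e; nra.
have := ler_powR2r (ltW e0) (powR_ge0 _ _) h.
by rewrite powRVK.
Qed.

(** The ratios x / (x + y) and y / (x + y) add up to 1, and each, being at most 1, is at most its
    own power e. *)
Lemma powR_subadd e x y : 0 <= e <= 1 -> 0 <= x -> 0 <= y ->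
  (x + y) `^ e <= x `^ e + y `^ e.
Proof.
move=> /andP[e0 e1]; rewrite le_eqVlt => /predU1P[<- y0|x0].
  by rewrite add0r lerDr powR_ge0.
rewrite le_eqVlt => /predU1P[<-|y0]; first by rewrite addr0 lerDl powR_ge0.
have xy0 : 0 < x + y by rewrite addr_gt0.
have h z : 0 < z <= x + y -> z / (x + y) * (x + y) `^ e <= z `^ e.
  move=> /andP[z0 zxy].
  have -> : z `^ e = (z / (x + y)) `^ e * (x + y) `^ e.
    by rewrite -powRM ?ltW ?divr_gt0// divfK ?gt_eqF.
  apply: ler_wpM2r; first exact: powR_ge0.
  by apply: ger1_powR => //; rewrite divr_gt0//= ler_pdivrMr// mul1r.
have hx := h x; have hy := h y.
have -> : (x + y) `^ e = x / (x + y) * (x + y) `^ e + y / (x + y) * (x + y) `^ e.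
  by rewrite -mulrDl -mulrDl divff ?mul1r ?gt_eqF.
by apply: lerD; [apply: hx|apply: hy]; rewrite ?x0 ?y0/= ?lerDl ?lerDr ltW.
Qed.

Lemma powR_superadd p x y : 1 <= p -> 0 <= x -> 0 <= y ->
  x `^ p + y `^ p <= (x + y) `^ p.
Proof.
move=> p1 x0 y0; have p0 : 0 < p by lra.
have e01 : 0 <= p^-1 <= 1 by rewrite invr_ge0 ltW//= invf_le1.
have := powR_subadd e01 (powR_ge0 x p) (powR_ge0 y p).
rewrite !powRK ?gt_eqF// => h.
have := ler_powR2r (ltW p0) (powR_ge0 _ _) h.
by rewrite powRVK ?gt_eqF// addr_ge0 ?powR_ge0.
Qed.

(** Young's inequality for the product of x^e and 1, with conjugate exponents 1/e and 1/(1 - e). *)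
Lemma powR_bernoulli_le e x : 0 < e <= 1 -> 0 <= x -> x `^ e <= 1 + e * (x - 1).
Proof.
move=> e01 x0; move: (e01) => /andP[e0 e1].
move: e1; rewrite le_eqVlt => /predU1P[->|e1].
  by rewrite powRr1//; lra.
have := @conjugate_powR R (x `^ e) 1 e^-1 (1 - e)^-1 (powR_ge0 _ _) ler01.
rewrite !invr_gt0 e0 subr_gt0 e1 !invrK addrC subrK => /(_ isT isT erefl).
rewrite powRK ?gt_eqF// powR1 mulr1 mul1r; lra.
Qed.

Lemma powR_bernoulli_ge p x : 1 <= p -> 0 <= x -> 1 + p * (x - 1) <= x `^ p.
Proof.
move=> p1 x0; have p0 : 0 < p by lra.
have e01 : 0 < p^-1 <= 1 by rewrite invr_gt0 p0/= invf_le1.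
have := powR_bernoulli_le e01 (powR_ge0 x p).
rewrite powRK ?gt_eqF// => h.
have : p * x <= p * (1 + p^-1 * (x `^ p - 1)) by rewrite ler_pM2l.
by rewrite mulrDr mulrA divff ?gt_eqF//; lra.
Qed.

End powR_inequalities.

(** * Values of the same sign *)

Section pointwise.
Context {R : realType}.
Implicit Types x y a b t e p l c X : R.

(* After division by a^p, with x = t b / a and X = x^(p/2), Picone's inequality
   for nonnegative a, b reads F p X t <= |1 - x|^p. For x < 1, F is maximal
   at t = x as a function of t, and there is equality there. *)
Let F p X t := (1 - t) `^ (p - 1) * (1 - t `^ (1 - p) * X ^+ 2) +
  (p - 1) * (t + t `^ (1 - p) * X ^+ 2 - 2 * t `^ (1 - p / 2) * X).

(** The factored form shows the sign. The last factor is nonnegative because (1 - t)^(p - 2) >= 1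
    and p - 1 <= 1, so [F] increases in t while t^(p/2) <= X and decreases afterwards. A coefficient
    of the square larger than p - 1 would make the last factor negative for small q and t. *)
Lemma is_deriveF p X t : 0 < t < 1 ->
  let q := t `^ (- (p / 2)) * X in
  is_derive t 1 (F p X)
   ((p - 1) * (q - 1) * ((1 - t) `^ (p - 2) * (q + 1) - (1 + (p - 1) * q))).
Proof.
move=> /andP[t0 t1] q.
have t1' : 0 < 1 - t by rewrite subr_gt0.
have d1 : is_derive t 1 (fun t => (1 - t) `^ (p - 1)) (- ((p - 1) * (1 - t) `^ (p - 1 - 1))).
  have h : is_derive t 1 (fun t => 1 - t) (-1 : R).
    by apply: is_derive_eq; ring.
  have := @is_derive1_comp R (fun y => y `^ (p - 1)) (fun t => 1 - t) t _ _
    (is_derive1_powR (p - 1) t1') h.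
  by rewrite mulrN1.
have d2 := is_derive1_powR (1 - p) t0.
have d3 := is_derive1_powR (1 - p / 2) t0.
rewrite /F; apply: is_derive_eq.
rewrite /GRing.scale/=.
have -> : (1 - t) `^ (p - 1) = (1 - t) * (1 - t) `^ (p - 2).
  rewrite -{2}(powRr1 (ltW t1')) -powRD; first by congr (_ `^ _); ring.
  by rewrite (gt_eqF t1') implybT.
have -> : p - 1 - 1 = p - 2 by ring.
have -> : t `^ (1 - p - 1) = (t `^ (- (p / 2))) ^+ 2.
  by rewrite expr2 -powRD ?(gt_eqF t0) ?implybT//; congr (_ `^ _); field.
have -> : t `^ (1 - p) = t * (t `^ (- (p / 2))) ^+ 2.
  rewrite expr2 -powRD ?(gt_eqF t0) ?implybT// -{2}(powRr1 (ltW t0)).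
  by rewrite -powRD ?(gt_eqF t0) ?implybT//; congr (_ `^ _); field.
have -> : t `^ (1 - p / 2 - 1) = t `^ (- (p / 2)) by congr (_ `^ _); ring.
rewrite /q.
move: (t `^ _) ((1 - t) `^ _) => s m.
by field.
Qed.

Lemma F_ndecr p X s t : 1 < p < 2 -> 0 <= X -> 0 < s -> s <= t -> t < 1 ->
  t `^ (p / 2) <= X -> F p X s <= F p X t.
Proof.
move=> /andP[p1 p2] X0 s0 st t1 tX.
have dF z : z \in `]s, t[ -> is_derive z 1 (F p X)
   ((p - 1) * (z `^ (- (p / 2)) * X - 1) * ((1 - z) `^ (p - 2) * (z `^ (- (p / 2)) * X + 1) - (1 + (p - 1) * (z `^ (- (p / 2)) * X)))).
  rewrite in_itv/= => /andP[sz zt].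
  by apply: is_deriveF; rewrite (lt_trans s0 sz) (lt_trans zt t1).
have cF : {within `[s, t], continuous (F p X)}.
  apply: derivable_within_continuous => z; rewrite in_itv/= => /andP[sz zt].
  apply: (@ex_derive _ _ _ _ _ _ _ (is_deriveF _ _ _)).
  by rewrite (lt_le_trans s0 sz) (le_lt_trans zt t1).
have [z] := MVT_segment st dF cF.
rewrite in_itv/= => /andP[sz zt] /eqP; rewrite subr_eq => /eqP ->.
rewrite lerDr mulr_ge0 ?subr_ge0//.
have z0 : 0 < z by lra.
have q1 : 1 <= z `^ (- (p / 2)) * X.
  rewrite powRN mulrC ler_pdivlMr ?powR_gt0// mul1r (le_trans _ tX)//.
  by apply: ler_powR2r => //; [lra|exact: ltW].
have m1 : 1 <= (1 - z) `^ (p - 2).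
  by apply: powR_le1_ge1; lra.
move: ((1 - z) `^ _) (_ * X) q1 m1 => m q q1 m1.
rewrite !mulr_ge0//; [lra|lra|].
by nra.
Qed.

Lemma F_nincr p X s t : 1 < p < 2 -> 0 <= X -> 0 < s -> s <= t -> t < 1 ->
  X <= s `^ (p / 2) -> F p X t <= F p X s.
Proof.
move=> /andP[p1 p2] X0 s0 st t1 tX.
have dF z : z \in `]s, t[ -> is_derive z 1 (F p X)
   ((p - 1) * (z `^ (- (p / 2)) * X - 1) * ((1 - z) `^ (p - 2) * (z `^ (- (p / 2)) * X + 1) - (1 + (p - 1) * (z `^ (- (p / 2)) * X)))).
  rewrite in_itv/= => /andP[sz zt].
  by apply: is_deriveF; rewrite (lt_trans s0 sz) (lt_trans zt t1).
have cF : {within `[s, t], continuous (F p X)}.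
  apply: derivable_within_continuous => z; rewrite in_itv/= => /andP[sz zt].
  apply: (@ex_derive _ _ _ _ _ _ _ (is_deriveF _ _ _)).
  by rewrite (lt_le_trans s0 sz) (le_lt_trans zt t1).
have [z] := MVT_segment st dF cF.
rewrite in_itv/= => /andP[sz zt] /eqP; rewrite subr_eq => /eqP ->.
rewrite gerDr mulr_le0_ge0 ?subr_ge0//.
have z0 : 0 < z by lra.
have q0 : 0 <= z `^ (- (p / 2)) * X by rewrite mulr_ge0// powR_ge0.
have q1 : z `^ (- (p / 2)) * X <= 1.
  rewrite powRN mulrC ler_pdivrMr ?powR_gt0// mul1r (le_trans tX)//.
  by apply: ler_powR2r => //; [lra|exact: ltW].
have m1 : 1 <= (1 - z) `^ (p - 2).
  by apply: powR_le1_ge1; lra.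
move: ((1 - z) `^ _) (_ * X) q0 q1 m1 => m q q0 q1 m1.
rewrite mulr_le0_ge0//; last by nra.
by rewrite mulr_ge0_le0//; lra.
Qed.

Lemma F_diag p x : 0 < x < 1 -> F p (x `^ (p / 2)) x = (1 - x) `^ p.
Proof.
move=> /andP[x0 x1]; rewrite /F powR_half_sqr ?ltW// -mulrA.
rewrite -!powRD ?(gt_eqF x0) ?implybT//.
have -> : 1 - p + p = 1 by ring.
have -> : 1 - p / 2 + p / 2 = 1 by ring.
rewrite powRr1 ?ltW//.
have -> : x + x - 2 * x = 0 by ring.
have x1' : 0 < 1 - x by lra.
rewrite mulr0 addr0 -{2}(powRr1 (ltW x1')) -powRD ?(gt_eqF x1') ?implybT//.
by congr (_ `^ _); ring.
Qed.

(** For x >= 1 the maximizer t = x is out of reach and [F] increases on all of (0, 1). So the value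
    at t is at most the values at s close to 1; these are bounded by [g s], which is continuous at 1
    with g 1 = (x - 1)^p. *)
Lemma F_ge1 p x t : 1 < p < 2 -> 0 < t < 1 -> 1 <= x ->
  F p (x `^ (p / 2)) t <= (x - 1) `^ p.
Proof.
move=> p12 /andP[t0 t1] x1; move: (p12) => /andP[p1 p2].
pose g s : R := s `^ (1 - p) * (s `^ (1 - p) * (x - 1) `^ p + (1 - s)).
have g1 : g s @[s --> 1^'-] --> (x - 1) `^ p.
  have -> : (x - 1) `^ p = g 1 by rewrite /g !powR1 subrr addr0 !mul1r.
  apply: cvg_at_left_filter.
  have d := is_derive1_powR (1 - p) (@ltr01 R).
  apply: differentiable_continuous; apply/derivable1_diffP.
  by apply: ex_derive.
rewrite -(cvg_lim _ g1)//; apply: limr_ge; first by apply/cvg_ex; eexists; exact: g1.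
near=> s.
have s1 : s < 1 by near: s; exact: nbhs_left_lt.
have ts : t <= s by near: s; exact: nbhs_left_ge.
have s0 : 0 < s by lra.
have X0 := powR_ge0 x (p / 2).
have sX : s `^ (p / 2) <= x `^ (p / 2) by apply: ler_powR2r; lra.
apply: (le_trans (F_ndecr p12 X0 t0 ts s1 sX)).
rewrite /F powR_half_sqr; last lra.
have h1 : 1 <= s `^ (1 - p) * x `^ p.
  have h : 1 <= s `^ (1 - p) by apply: powR_le1_ge1; lra.
  have h' : 1 <= x `^ p by apply: powR_ge1_ge1; lra.
  by nra.
have -> : s + s `^ (1 - p) * x `^ p - 2 * s `^ (1 - p / 2) * x `^ (p / 2) =
    s `^ (1 - p) * (x `^ (p / 2) - s `^ (p / 2)) ^+ 2.
  rewrite sqrrB powR_half_sqr ?powR_half_sqr; [|lra|lra].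
  rewrite !mulrDr -powRD ?(gt_eqF s0) ?implybT//.
  have -> : s `^ (1 - p / 2) = s `^ (1 - p) * s `^ (p / 2).
    by rewrite -powRD ?(gt_eqF s0) ?implybT//; congr (_ `^ _); field.
  have -> : 1 - p + p = 1 by ring.
  by rewrite powRr1 ?ltW//; ring.
have h2 : (x `^ (p / 2) - s `^ (p / 2)) ^+ 2 <= (x - s) `^ p.
  rewrite -[leRHS]powR_half_sqr; last lra.
  rewrite ler_sqr ?nnegrE ?powR_ge0 ?subr_ge0//.
  have := @powR_subadd R (p / 2) (x - s) s.
  rewrite subrK lerBlDr; apply; lra.
(* Convexity: x - s is the combination of (x - 1) / s and 1 with weights s and 1 - s. *)
have h3 : (x - s) `^ p <= s `^ (1 - p) * (x - 1) `^ p + (1 - s).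
  have e : s * (s^-1) `^ p = s `^ (1 - p).
    rewrite -[s^-1]powR_inv1 ?(ltW s0)// -powRrM mulN1r.
    by rewrite -{1}(powRr1 (ltW s0)) -powRD ?(gt_eqF s0) ?implybT.
  have := @convex_powR_le R p s ((x - 1) / s) 1 (ltW p1) _ _ ler01.
  rewrite powR1 mulr1 mulrCA divff ?gt_eqF// mulr1 (_ : x - 1 + (1 - s) = x - s); last ring.
  rewrite powRM ?invr_ge0; [|lra|lra].
  rewrite mulrCA e [_ * s `^ _]mulrC ?mulr1.
  apply; first lra.
  by rewrite divr_ge0//; lra.
have c0 := powR_ge0 s (1 - p).
have d0 := powR_ge0 (1 - s) (p - 1).
have sq0 := sqr_ge0 (x `^ (p / 2) - s `^ (p / 2)).
rewrite /g.
apply: (@le_trans _ _ (s `^ (1 - p) * (x `^ (p / 2) - s `^ (p / 2)) ^+ 2)); last first.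
  by apply: ler_wpM2l => //; exact: le_trans h3.
have : 0 <= s `^ (1 - p) * (x `^ (p / 2) - s `^ (p / 2)) ^+ 2 by rewrite mulr_ge0.
have : (1 - s) `^ (p - 1) * (1 - s `^ (1 - p) * x `^ p) <= 0.
  by rewrite mulr_ge0_le0// subr_le0.
by move: (_ * _ ^+ 2) (_ * (1 - _)) => u v; nra.
Unshelve. all: by end_near. Qed.

Lemma F_le p x t : 1 < p < 2 -> 0 < t < 1 -> 0 <= x ->
  F p (x `^ (p / 2)) t <= `|1 - x| `^ p.
Proof.
move=> p12 /andP[t0 t1]; move: (p12) => /andP[p1 p2].
rewrite le_eqVlt => /predU1P[<-|x0].
  rewrite powR0 ?gt_eqF ?divr_gt0//; last lra.
  rewrite /F expr0n/= !mulr0 !subr0 addr0 normr1 powR1 mulr1.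
  have := @powR_bernoulli_le R (p - 1) (1 - t); lra.
have [x1|x1] := leP 1 x.
  rewrite distrC ger0_norm ?subr_ge0//.
  by apply: F_ge1 => //; rewrite t0.
rewrite ger0_norm; last lra.
rewrite -F_diag ?x0//.
have [tx|xt] := leP t x.
  by apply: F_ndecr => //; rewrite powR_ge0.
by apply: F_nincr => //; rewrite ?powR_ge0// ltW.
Qed.

Lemma picone_pos p t a b : 1 < p < 2 -> 0 < t <= 1 -> 0 <= a -> 0 <= b ->
  (1 - t) `^ (p - 1) * (a `^ p - t * b `^ p) +
    (p - 1) * t * (a `^ (p / 2) - b `^ (p / 2)) ^+ 2 <= `|a - t * b| `^ p.
Proof.
move=> p12 /andP[t0 t1] a0 b0; move: (p12) => /andP[p1 p2].
move: t1; rewrite le_eqVlt => /predU1P[->|t1].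
  (* For t = 1 the first term vanishes, and the rest follows from subadditivity of the power p / 2,
     since p - 1 <= 1. *)
  rewrite subrr powR0; last lra.
  rewrite mul0r add0r mulr1 !mul1r.
  have h u v : 0 <= u -> u <= v -> (u `^ (p / 2) - v `^ (p / 2)) ^+ 2 <= `|u - v| `^ p.
    move=> u0 uv; rewrite distrC -sqrrN opprB ger0_norm ?subr_ge0// -[leRHS]powR_half_sqr ?subr_ge0//.
    rewrite ler_sqr ?nnegrE ?powR_ge0 ?subr_ge0 ?ler_powR2r//; last lra.
    have := @powR_subadd R (p / 2) (v - u) u.
    rewrite subrK lerBlDr; apply; lra.
  have {}h : (a `^ (p / 2) - b `^ (p / 2)) ^+ 2 <= `|a - b| `^ p.
    have [ab|/ltW ab] := leP a b; first exact: h.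
    by rewrite -sqrrN opprB distrC; apply: h.
  have := sqr_ge0 (a `^ (p / 2) - b `^ (p / 2)); nra.
move: a0; rewrite le_eqVlt => /predU1P[<-|a0].
  (* Division by a^p is impossible for a = 0. The claim becomes p - 1 <= t^(p - 1) + (1 - t)^(p -
     1), and the right side is at least 1 by subadditivity. *)
  rewrite powR0; last lra.
  rewrite powR0; last lra.
  rewrite !sub0r normrN sqrrN powR_half_sqr// ger0_norm ?mulr_ge0 ?(ltW t0)//.
  rewrite powRM ?(ltW t0)// mulrN mulrA -mulNr -mulrDl.
  apply: ler_wpM2r; first exact: powR_ge0.
  have := powR_ge0 (1 - t) (p - 1).
  have : t <= t `^ (p - 1) by apply: ger1_powR; lra.
  have -> : t `^ p = t * t `^ (p - 1) by rewrite mulr_powRB1//; lra.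
  have : 1 <= t `^ (p - 1) + (1 - t) `^ (p - 1).
    have := @powR_subadd R (p - 1) t (1 - t).
    rewrite subrKC powR1; apply; lra.
  by move: (t `^ _) ((1 - t) `^ _) => u v; nra.
have ia0 : 0 < a^-1 by rewrite invr_gt0.
have x0 : 0 <= t * b / a by rewrite divr_ge0// ?mulr_ge0// ltW.
have := F_le p12 _ x0; move=> /(_ t); rewrite t0 t1 => /(_ isT).
rewrite /F powR_half_sqr// => h.
have := ler_wpM2l (powR_ge0 a p) h.
have -> : a `^ p * `|1 - t * b / a| `^ p = `|a - t * b| `^ p.
  rewrite -{1}(gtr0_norm a0) -powRM ?normr_ge0// -normrM mulrBr mulr1.
  by rewrite [a * (_ / _)]mulrC divfK// gt_eqF.
apply: le_trans; rewrite le_eqVlt; apply/orP; left; apply/eqP.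
rewrite !powRM ?mulr_ge0 ?(ltW ia0) ?(ltW t0)//.
have e1 : a `^ p * (a^-1) `^ p = 1.
  by rewrite -powRM ?(ltW a0) ?(ltW ia0)// divff ?powR1 ?gt_eqF.
have e2 : a `^ (p / 2) * (a^-1) `^ (p / 2) = 1.
  by rewrite -powRM ?(ltW a0) ?(ltW ia0)// divff ?powR1 ?gt_eqF.
have e3 : t `^ (1 - p) * t `^ p = t.
  by rewrite -powRD ?(gt_eqF t0) ?implybT// subrK powRr1 ?ltW.
have e4 : t `^ (1 - p / 2) * t `^ (p / 2) = t.
  by rewrite -powRD ?(gt_eqF t0) ?implybT// subrK powRr1 ?ltW.
rewrite [RHS]mulrDr; congr (_ + _).
  rewrite [RHS]mulrCA; congr (_ * _).
  transitivity (a `^ p - t `^ (1 - p) * t `^ p * b `^ p * (a `^ p * a^-1 `^ p)).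
    by rewrite e1 e3 mulr1.
  by ring.
rewrite -mulrA [RHS]mulrCA; congr (_ * _).
rewrite -(powR_half_sqr p (ltW a0)) -(powR_half_sqr p b0).
rewrite -(powR_half_sqr p (ltW a0)) in e1.
move: e2 e3 e4 e1; rewrite -(powR_half_sqr p (ltW ia0)) -(powR_half_sqr p (ltW t0)).
move: (a `^ _) (b `^ _) (a^-1 `^ _) (t `^ (p / 2)) (t `^ (1 - p)) (t `^ (1 - p / 2)) => A B C T U V e2 e3 e4 _.
transitivity (t * A ^+ 2 - 2 * (V * T) * A * (A * C) * B + U * T ^+ 2 * (A * C) ^+ 2 * B ^+ 2).
  by rewrite e2 e3 e4; ring.
by ring.
Qed.

End pointwise.

(** * Values of opposite signs *)

Section pointwise_opposite.
Context {R : realType}.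
Implicit Types x y a b t e p l c q : R.

(* The weights for which concavity of the power p / 2, q = 2 - p, gives the
   constant p (p - 1) / 2 when a and b have opposite signs; the witnesses are
   explicit rational approximations of the admissible square roots of l, 1 - l. *)
Lemma powR_weights q : 0 < q <= 3 / 5 ->
  exists l, [/\ 0 < l < 1, 1 - q * (1 - q) / 2 <= l `^ q
              & (2 - q) * (1 - q) / 2 <= (1 - l) `^ q].
Proof.
move=> /andP[q0 q1].
(* m and n stand for the square roots of l and 1 - l. Asking only for m^2 + n^2 <= 1 leaves room for
   witnesses that are affine in q. *)
suff [m [n [m0 n0 mn hm hn]]] : exists m n, [/\ 0 < m, 0 < n, m ^+ 2 + n ^+ 2 <= 1,
    1 - q * (1 - q) / 2 <= m `^ (2 * q) & (2 - q) * (1 - q) / 2 <= n `^ (2 * q)].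
  exists (m ^+ 2); split.
  - rewrite exprn_gt0//=; have := exprn_gt0 2 n0; lra.
  - by rewrite -powR_mulrn ?(ltW m0)// -powRrM.
  - apply: (le_trans hn); rewrite powRrM powR_mulrn; last exact: ltW.
    by apply: ler_powR2r; [exact: ltW|exact: sqr_ge0|lra].
have [q2|q2] := leP q (1 / 2).
  (* Here 2 q <= 1, so Bernoulli's inequality bounds powers from above; applied to 1/x it gives the
     required lower bound. On the other branch 2 q >= 1 and it applies directly. *)
  have inv_bound x : 0 < x -> (1 + 2 * q * (x^-1 - 1))^-1 <= x `^ (2 * q).
    move=> x0; have h : x^-1 `^ (2 * q) <= 1 + 2 * q * (x^-1 - 1).
      by apply: powR_bernoulli_le; [lra|rewrite invr_ge0 ltW].
    have e : x `^ (2 * q) = (x^-1 `^ (2 * q))^-1.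
      by rewrite -[x^-1]powR_inv1 ?(ltW x0)// -powRrM mulN1r powRN invrK.
    have g : 0 < x^-1 `^ (2 * q) by rewrite powR_gt0 ?invr_gt0.
    by rewrite e lef_pV2 ?posrE// (lt_le_trans g).
  exists (4 / 5 + 3 * q / 20), (4 / 7 - q / 4); split; [lra|lra|nra| |].
  - apply: le_trans (inv_bound _ _); last lra.
    set m := 4 / 5 + _; have m0 : 0 < m by rewrite /m; lra.
    have -> : 1 + 2 * q * (m^-1 - 1) = (m + 2 * q * (1 - m)) / m by field; rewrite gt_eqF.
    rewrite invf_div ler_pdivlMr; last by rewrite /m; nra.
    have : 0 <= q ^+ 2 * ((1 / 2 - q) * (7 - 3 * q)).
      by rewrite mulr_ge0 ?sqr_ge0//; nra.
    by rewrite /m; lra.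
  - apply: le_trans (inv_bound _ _); last lra.
    set m := 4 / 7 - _; have m0 : 0 < m by rewrite /m; lra.
    have -> : 1 + 2 * q * (m^-1 - 1) = (m + 2 * q * (1 - m)) / m by field; rewrite gt_eqF.
    rewrite invf_div ler_pdivlMr; last by rewrite /m; nra.
    have : 0 <= q ^+ 2 * (1 / 8 + q * (25 / 56 - q / 4)).
      by rewrite mulr_ge0 ?sqr_ge0//; nra.
    by rewrite /m; lra.
exists ((3 + q) / 4), ((1 + q) / 4); split; [lra|lra|nra| |].
- apply: le_trans (powR_bernoulli_ge _ _); [|lra|lra]; nra.
- apply: le_trans (powR_bernoulli_ge _ _); [|lra|lra]; nra.
Qed.

(** With A = a^(p/2), superadditivity bounds the right side below by 1 + (p - 1) A^2, and p (1 + (p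
    - 1) A^2) - (p - 1) (A + 1)^2 is the square of (p - 1) A - 1. *)
Lemma opp_const1 p a : 1 < p < 2 -> 0 <= a ->
  (p - 1) / p * (a `^ (p / 2) + 1) ^+ 2 <= (a + 1) `^ p - (2 - p) * a `^ p.
Proof.
move=> /andP[p1 p2] a0; have p0 : 0 < p by lra.
have := @powR_superadd R p a 1 (ltW p1) a0 ler01; rewrite powR1 => h.
apply: (@le_trans _ _ (1 + (p - 1) * a `^ p)); last lra.
rewrite mulrAC ler_pdivrMr// -(powR_half_sqr p a0).
have := sqr_ge0 ((p - 1) * a `^ (p / 2) - 1); move: (a `^ _) => A; nra.
Qed.

(** With A = a^(p/2), concavity at weights l and 1 - l gives (a + 1)^(p/2) >= x A + y, where x^2 =
    l^(2-p) and y^2 = (1-l)^(2-p). After squaring, it is enough to compare coefficients: for c = p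
    (p - 1) / 2 one needs x^2 >= c + 2 - p, y^2 >= c and x y >= c. The first two are the bounds of
    [powR_weights] at q = 2 - p, and they imply the third. *)
Lemma opp_const2 p a : 7 / 5 <= p < 2 -> 0 <= a ->
  p * (p - 1) / 2 * (a `^ (p / 2) + 1) ^+ 2 <= (a + 1) `^ p - (2 - p) * a `^ p.
Proof.
move=> /andP[p1 p2] a0.
have [|l [/andP[l0 l1] hl hl']] := @powR_weights (2 - p); first lra.
have l1' : 0 < 1 - l by lra.
have := @concave_powR_le R (p / 2) l (a / l) (1 / (1 - l)).
rewrite mulrCA divff ?gt_eqF// mulr1 mulrCA divff ?gt_eqF// mulr1.
have e z y : 0 < z -> 0 <= y -> z * (y / z) `^ (p / 2) = z `^ ((2 - p) / 2) * y `^ (p / 2).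
  move=> z0 y0; rewrite powRM ?invr_ge0 ?(ltW z0)// -[z^-1]powR_inv1 ?(ltW z0)// -powRrM.
  rewrite mulrCA mulrC; congr (_ * _); rewrite -{1}(powRr1 (ltW z0)).
  by rewrite -powRD ?(gt_eqF z0) ?implybT//; congr (_ `^ _); field.
rewrite !e// powR1 mulr1 => h.
have {}h : l `^ ((2 - p) / 2) * a `^ (p / 2) + (1 - l) `^ ((2 - p) / 2) <= (a + 1) `^ (p / 2).
  by apply: h; rewrite ?divr_ge0 ?(ltW l0) ?(ltW l1')//; lra.
rewrite -(powR_half_sqr _ (ltW l0)) in hl.
rewrite -(powR_half_sqr _ (ltW l1')) in hl'.
rewrite -(powR_half_sqr p a0) -(@powR_half_sqr _ (a + 1)); last lra.
have A0 := powR_ge0 a (p / 2).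
have x0 := powR_ge0 l ((2 - p) / 2).
have y0 := powR_ge0 (1 - l) ((2 - p) / 2).
move: (l `^ _) ((1 - l) `^ _) (a `^ _) ((a + 1) `^ _) A0 x0 y0 h hl hl' => x y A B.
move=> A0 x0 y0 h hl hl'.
have xy : p * (p - 1) / 2 <= x * y.
  have C0 : 0 <= p * (p - 1) / 2 by rewrite divr_ge0// mulr_ge0; lra.
  have xy0 : 0 <= x * y by rewrite mulr_ge0.
  rewrite -ler_sqr ?nnegrE// [leLHS]expr2 [leRHS]exprMn.
  by apply: ler_pM => //; nra.
have : (x * A + y) ^+ 2 <= B ^+ 2 by rewrite ler_sqr ?nnegrE// ?addr_ge0 ?mulr_ge0// (le_trans _ h)// addr_ge0 ?mulr_ge0.
have hx : p * (p - 1) / 2 + (2 - p) <= x ^+ 2 by nra.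
have hy : p * (p - 1) / 2 <= y ^+ 2 by nra.
have : 0 <= (x ^+ 2 - (p * (p - 1) / 2 + (2 - p))) * A ^+ 2 by rewrite mulr_ge0 ?sqr_ge0 ?subr_ge0.
have : 0 <= (x * y - p * (p - 1) / 2) * A by rewrite mulr_ge0 ?subr_ge0.
by nra.
Qed.

(** The second constant is the larger one only if p^2 >= 2, and 7/5 lies below the square root of
    2. *)
Lemma opp_const p a : 1 < p < 2 -> 0 <= a ->
  Num.max ((p - 1) / p) (p * (p - 1) / 2) * (a `^ (p / 2) + 1) ^+ 2 <=
    (a + 1) `^ p - (2 - p) * a `^ p.
Proof.
move=> p12 a0; case: (leP ((p - 1) / p) (p * (p - 1) / 2)) => [h|_]; last exact: opp_const1.
apply: opp_const2 => //; move: p12 h => /andP[p1 ->].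
rewrite andbT ler_pdivrMr; last lra.
move=> h; rewrite leNgt; apply/negP => p75.
have : 0 < (p - 1) * (2 - p * p) by rewrite mulr_gt0//; nra.
by lra.
Qed.

Lemma max_const_le p : 1 < p < 2 ->
  0 <= Num.max ((p - 1) / p) (p * (p - 1) / 2) <= p - 1.
Proof.
move=> /andP[p1 p2]; rewrite le_max ge_max ler_pdivrMr; last lra.
by rewrite divr_ge0; [|lra..]; rewrite /=; nra.
Qed.

(** Removes t: after the estimates [K] and [m1], which are exact to first order in t at the terms in
    a^p, every surviving term carries a factor t, and what remains is the hypothesis on c. *)
Lemma picone_opp1 p c t a : 1 < p < 2 -> 0 < t <= 1 -> 0 <= a ->
  c * (a `^ (p / 2) + 1) ^+ 2 <= (a + 1) `^ p - (2 - p) * a `^ p ->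
  (1 - t) `^ (p - 1) * (a `^ p - t) + c * t * (a `^ (p / 2) + 1) ^+ 2
    <= (a + t) `^ p.
Proof.
move=> /andP[p1 p2] /andP[t0 t1] a0 hc.
have m1 : (1 - t) `^ (p - 1) <= 1 - (p - 1) * t.
  by have := @powR_bernoulli_le R (p - 1) (1 - t); lra.
have m2 : 1 - t <= (1 - t) `^ (p - 1).
  have [->|t1'] := eqVneq t 1; first by rewrite subrr powR_ge0.
  by apply: ger1_powR; lra.
(* (a + t)^p is written as (a + t) (a + t)^(p - 1). Since 0 < p - 1 < 1, the last factor is concave
   between a and a + 1; the defect is t (1 - t) (a^(p-1) + 1 - (a + 1)^(p-1)), nonnegative by
   subadditivity. *)
have K : a `^ p + t * ((a + 1) `^ p - a `^ p - (1 - t)) <= (a + t) `^ p.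
  have := @concave_powR_le R (p - 1) t (a + 1) a.
  rewrite (_ : t * (a + 1) + (1 - t) * a = a + t); last ring.
  have := @powR_subadd R (p - 1) a 1; rewrite powR1 => h h'.
  have {}h : (a + 1) `^ (p - 1) <= a `^ (p - 1) + 1 by apply: h; lra.
  have {}h' : t * (a + 1) `^ (p - 1) + (1 - t) * a `^ (p - 1) <= (a + t) `^ (p - 1) by apply: h'; lra.
  rewrite -(@mulr_powRB1 _ (a + t)); [|lra|lra].
  rewrite -(@mulr_powRB1 _ (a + 1)); [|lra|lra].
  rewrite -(@mulr_powRB1 _ a); [|lra|lra].
  have {}h' : (a + t) * (t * (a + 1) `^ (p - 1) + (1 - t) * a `^ (p - 1)) <= (a + t) * (a + t) `^ (p - 1).
    by apply: ler_wpM2l => //; lra.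
  apply: le_trans h'.
  have : 0 <= t * (1 - t) * (a `^ (p - 1) + 1 - (a + 1) `^ (p - 1)).
    by rewrite !mulr_ge0//; lra.
  by move: (a `^ _) ((a + 1) `^ _) => u v; nra.
apply: le_trans K.
have Ap := powR_ge0 a p.
have : t * (c * (a `^ (p / 2) + 1) ^+ 2) <= t * ((a + 1) `^ p - (2 - p) * a `^ p).
  by apply: ler_wpM2l => //; exact: ltW.
have : ((1 - t) `^ (p - 1)) * a `^ p <= (1 - (p - 1) * t) * a `^ p by apply: ler_wpM2r.
have : (1 - t) * t <= ((1 - t) `^ (p - 1)) * t by apply: ler_wpM2r => //; exact: ltW.
move: (_ `^ (p - 1)) (a `^ p) ((_ ^+ 2)) ((a + 1) `^ p) => m A B D; nra.
Qed.

Lemma picone_opp p t a b : 1 < p < 2 -> 0 < t <= 1 -> 0 <= a -> 0 <= b ->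
  (1 - t) `^ (p - 1) * (a `^ p - t * b `^ p) +
    Num.max ((p - 1) / p) (p * (p - 1) / 2) * t * (a `^ (p / 2) + b `^ (p / 2)) ^+ 2
  <= (a + t * b) `^ p.
Proof.
move=> p12 t01 a0; move: (p12) (t01) => /andP[p1 p2] /andP[t0 t1].
have /andP[c0 c1] := max_const_le p12; set c := Num.max _ _.
rewrite -/c in c0 c1.
rewrite le_eqVlt => /predU1P[<-|b0].
  rewrite !powR0; [|lra..].
  rewrite !mulr0 !addr0 subr0 powR_half_sqr// -mulrDl ler_piMl ?powR_ge0//.
  by have := @powR_bernoulli_le R (p - 1) (1 - t); nra.
have x0 : 0 <= a / b by rewrite divr_ge0// ltW.
have := picone_opp1 p12 t01 x0 (opp_const p12 x0); rewrite -/c => h.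
have := ler_wpM2l (powR_ge0 b p) h.
have ib0 : 0 <= b^-1 by rewrite invr_ge0 ltW.
have -> : b `^ p * (a / b + t) `^ p = (a + t * b) `^ p.
  rewrite -powRM ?(ltW b0)//; last by rewrite addr_ge0// ltW.
  by congr (_ `^ _); field; rewrite gt_eqF.
apply: le_trans; rewrite le_eqVlt; apply/orP; left; apply/eqP.
rewrite !powRM//.
have e2 : b `^ (p / 2) * (b^-1) `^ (p / 2) = 1.
  by rewrite -powRM ?(ltW b0)// divff ?powR1 ?gt_eqF.
rewrite -(powR_half_sqr p (ltW b0)) -(powR_half_sqr p a0) -(powR_half_sqr p ib0).
move: e2; move: (a `^ _) (b `^ _) (b^-1 `^ _) ((1 - t) `^ _) => A B I m e.
transitivity (m * (A ^+ 2 * (B * I) ^+ 2 - t * B ^+ 2) + c * t * (A * (B * I) + B) ^+ 2).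
  by rewrite e; ring.
by ring.
Qed.

End pointwise_opposite.

Section picone.
Context {R : realType}.
Implicit Types p t a b c w : R.

(** The class [P] of admissible values lets a single integral argument serve both constants:
    [xpredT] for general u, nonnegative values for u >= 0. *)
Definition picone_const p c (P : R -> bool) := forall t a b,
  0 < t <= 1 -> P a -> P b ->
  (1 - t) `^ (p - 1) * (`|a| `^ p - t * `|b| `^ p) +
    c * t * (spow a (p / 2) - spow b (p / 2)) ^+ 2 <= `|a - t * b| `^ p.

Lemma spow_ge0 a t : t != 0 -> 0 <= a -> spow a t = `|a| `^ t.
Proof.
move=> t0; rewrite /spow le_eqVlt => /predU1P[<-|a0].
  by rewrite normr0 sgr0 mulr0 powR0.
by rewrite gtr0_sg// mulr1.
Qed.

Lemma spow_le0 a t : t != 0 -> a <= 0 -> spow a t = - `|a| `^ t.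
Proof.
move=> t0; rewrite /spow le_eqVlt => /predU1P[->|a0].
  by rewrite normr0 sgr0 mulr0 powR0// oppr0.
by rewrite ltr0_sg// mulrN1.
Qed.

Lemma picone_const_nneg p : 1 < p < 2 -> picone_const p (p - 1) (fun a => 0 <= a).
Proof.
move=> p12 t a b t01 a0 b0; have p0 : p / 2 != 0 by move: p12; lra.
by rewrite !spow_ge0// (ger0_norm a0) (ger0_norm b0); exact: picone_pos.
Qed.

Lemma picone_const_all p : 1 < p < 2 ->
  picone_const p (Num.max ((p - 1) / p) (p * (p - 1) / 2)) xpredT.
Proof.
move=> p12 t a b t01 _ _; have p0 : p / 2 != 0 by move: p12; lra.
have /andP[c0 c1] := max_const_le p12; set c := Num.max _ _ in c0 c1 *.
have t0 : 0 < t by case/andP: t01.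
have same u v : 0 <= u -> 0 <= v -> (1 - t) `^ (p - 1) * (u `^ p - t * v `^ p) +
    c * t * (u `^ (p / 2) - v `^ (p / 2)) ^+ 2 <= `|u - t * v| `^ p.
  move=> u0 v0; apply: le_trans _ (picone_pos p12 t01 u0 v0).
  by rewrite lerD2l ler_wpM2r ?sqr_ge0// ler_wpM2r// ltW.
have opp u v : 0 <= u -> 0 <= v -> (1 - t) `^ (p - 1) * (u `^ p - t * v `^ p) +
    c * t * (u `^ (p / 2) + v `^ (p / 2)) ^+ 2 <= `|u + t * v| `^ p.
  move=> u0 v0; apply: le_trans (picone_opp p12 t01 u0 v0) _.
  by rewrite ger0_norm// addr_ge0// mulr_ge0// ltW.
have [a0|/ltW a0] := leP 0 a; have [b0|/ltW b0] := leP 0 b.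
- by rewrite !spow_ge0// (ger0_norm a0) (ger0_norm b0); exact: same.
- rewrite spow_ge0// spow_le0// opprK (ger0_norm a0) (ler0_norm b0).
  by have := @opp a (- b) a0; rewrite oppr_ge0 mulrN; exact.
- rewrite spow_le0// spow_ge0// -opprD sqrrN (ler0_norm a0) (ger0_norm b0).
  have := @opp (- a) b; rewrite oppr_ge0 -[X in _ <= `|X| `^ _]opprK normrN.
  by rewrite opprD opprK; exact.
- rewrite !spow_le0// -opprD sqrrN (ler0_norm a0) (ler0_norm b0).
  have := @same (- a) (- b); rewrite !oppr_ge0 mulrN -opprD normrN; exact.
Qed.

(* Scaling by [w1 ^ p], with [t = w2 / w1]. *)
Lemma picone_weighted p c P w1 w2 a b : 1 < p -> picone_const p c P ->
  0 < w2 <= w1 -> P a -> P b ->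
  (w1 - w2) `^ (p - 1) * (w1 * `|a| `^ p - w2 * `|b| `^ p) +
    c * (w2 * w1 `^ (p - 1) * (spow a (p / 2) - spow b (p / 2)) ^+ 2)
  <= `|w1 * a - w2 * b| `^ p.
Proof.
move=> p1 hP /andP[w20 w21] Pa Pb.
have w10 : 0 < w1 by exact: lt_le_trans w21.
have := hP (w2 / w1) a b; rewrite divr_gt0// ler_pdivrMr// mul1r => /(_ w21 Pa Pb) h.
have := ler_wpM2l (powR_ge0 w1 p) h.
have -> : w1 `^ p * `|a - w2 / w1 * b| `^ p = `|w1 * a - w2 * b| `^ p.
  rewrite -{1}(gtr0_norm w10) -powRM// -normrM; congr (`|_| `^ _).
  by field; rewrite gt_eqF.
apply: le_trans; rewrite le_eqVlt; apply/orP; left; apply/eqP.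
have p0 : 0 < p by lra.
rewrite -(mulr_powRB1 (ltW w10) p0).
have -> : (w1 - w2) `^ (p - 1) = w1 `^ (p - 1) * (1 - w2 / w1) `^ (p - 1).
  rewrite -powRM ?(ltW w10)//; last by rewrite subr_ge0 ler_pdivrMr// mul1r.
  by congr (_ `^ _); field; rewrite gt_eqF.
by field; rewrite gt_eqF.
Qed.

End picone.

(** * Lebesgue measure and polar coordinates *)

Section density_measure.
Local Open Scope ereal_scope.
Context d (T : measurableType d) (R : realType) (mu : {measure set T -> \bar R}).
Variable h : T -> R.
Hypothesis mh : measurable_fun [set: T] h.
Hypothesis h0 : forall x, (0 <= h x)%R.

(** The two proofs are arguments so that the measure structure can be inferred from the term. *)
Definition mdensity (_ : measurable_fun [set: T] h) (_ : forall x, (0 <= h x)%R) :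
  set T -> \bar R := fun A => \int[mu]_(x in A) (h x)%:E.

Let mdensity0 : mdensity mh h0 set0 = 0.
Proof. by rewrite /mdensity integral_set0. Qed.

Let mdensity_ge0 A : 0 <= mdensity mh h0 A.
Proof. by apply: integral_ge0 => x _; rewrite lee_fin. Qed.

Let mdensity_sigma_additive : semi_sigma_additive (mdensity mh h0).
Proof.
move=> F mF tF mUF; rewrite /mdensity ge0_integral_bigcup//; last 2 first.
- exact/measurable_EFinP/measurable_funTS.
- by move=> x _; rewrite lee_fin.
apply: is_cvg_ereal_nneg_natsum_cond => n _ _.
by apply: integral_ge0 => x _; rewrite lee_fin.
Qed.

HB.instance Definition _ := isMeasure.Build _ _ _ (mdensity mh h0)
  mdensity0 mdensity_ge0 mdensity_sigma_additive.

Import HBNNSimple.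

Let integral_mdensity_nnsfun (f : {nnsfun T >-> R}) :
  \int[mdensity mh h0]_x (f x)%:E = \int[mu]_x ((h x)%:E * (f x)%:E).
Proof.
under [LHS]eq_integral do rewrite fimfunE -fsumEFin//.
rewrite [LHS]ge0_integral_fsum//; last 2 first.
  - by move=> r; exact/measurable_EFinP/measurableT_comp.
  - by move=> n x _; rewrite EFinM nnfun_muleindic_ge0.
under [RHS]eq_integral.
  move=> x xD; rewrite fimfunE -fsumEFin// ge0_mule_fsumr; last first.
    by move=> r; rewrite EFinM nnfun_muleindic_ge0.
  over.
rewrite [RHS]ge0_integral_fsum//; last 2 first.
  - move=> r; apply: emeasurable_funM; first exact/measurable_EFinP.
    exact/measurable_EFinP/measurableT_comp.
  - by move=> n x _; apply: mule_ge0; [rewrite lee_fin|rewrite EFinM nnfun_muleindic_ge0].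
apply: eq_fsbigr => r _; rewrite integralZl_indic_nnsfun//= integral_indic// setIT.
transitivity (r%:E * \int[mu]_(x in f @^-1` [set r]) (h x)%:E) => //.
rewrite [in LHS]integral_mkcond.
have mA : measurable (f @^-1` [set r]) by [].
have [r0|r0] := ltP r 0%R.
  rewrite [LHS](_ : _ = 0); last first.
    by rewrite -integral_mkcond preimage_nnfun0// integral_set0 mule0.
  rewrite integral0_eq// => x _.
  by rewrite preimage_nnfun0// indic0 /= mulr0 ?mulr0 ?mule0.
rewrite -ge0_integralZl_EFin//.
- apply: eq_integral => x _; rewrite patchE indicE.
  by case: ifPn => _; rewrite /= ?mulr1 ?mulr0 ?mule0// muleC.
- by move=> x _; rewrite patchE; case: ifPn => _; rewrite ?lee_fin.
- apply/measurable_restrict => //.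
  by apply: measurable_funTS; exact/measurable_EFinP.
Qed.

Lemma integral_mdensity (f : T -> \bar R) : measurable_fun setT f ->
  (forall x, 0 <= f x) ->
  \int[mdensity mh h0]_x f x = \int[mu]_x ((h x)%:E * f x).
Proof.
move=> mf f0; pose f_ := nnsfun_approx measurableT mf.
transitivity (lim (\int[mdensity mh h0]_x (f_ n x)%:E @[n --> \oo])).
  rewrite -monotone_convergence//=.
  - apply: eq_integral => x _; apply/esym/cvg_lim => //=.
    exact: cvg_nnsfun_approx.
  - by move=> n; exact/measurable_EFinP/measurable_funTS.
  - by move=> n x _; rewrite lee_fin.
  - by move=> x _ m n mn; rewrite lee_fin; exact/lefP/nd_nnsfun_approx.
under eq_fun do rewrite integral_mdensity_nnsfun.
rewrite -monotone_convergence//=.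
- apply: eq_integral => x _; rewrite limeMl//.
    congr (_ * _); apply/cvg_lim => //; exact: cvg_nnsfun_approx.
  by apply: ereal_nondecreasing_is_cvgn => m n mn; rewrite lee_fin; exact/lefP/nd_nnsfun_approx.
- move=> n; apply: emeasurable_funM; first exact/measurable_EFinP.
  exact/measurable_EFinP/measurable_funTS.
- by move=> n x _; rewrite mule_ge0 ?lee_fin.
- move=> x _ m n mn; rewrite lee_wpmul2l ?lee_fin//; exact/lefP/nd_nnsfun_approx.
Qed.

End density_measure.

(* [pushforward] with the measurability proof as an argument, so that the
   measure structure can be inferred. *)
Section mpush.
Local Open Scope ereal_scope.
Context d d' (T1 : measurableType d) (T2 : measurableType d') (R : realType).
Variables (m : {measure set T1 -> \bar R}) (f : T1 -> T2).
Hypothesis mf : measurable_fun [set: T1] f.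

Definition mpush (_ : measurable_fun [set: T1] f) : set T2 -> \bar R :=
  pushforward m f.

Let mpush0 : mpush mf set0 = 0.
Proof. exact: measure0. Qed.

Let mpush_ge0 A : 0 <= mpush mf A.
Proof. exact: measure_ge0. Qed.

Let mpush_sigma_additive : semi_sigma_additive (mpush mf).
Proof. exact: measure_semi_sigma_additive. Qed.

HB.instance Definition _ := isMeasure.Build _ _ _ (mpush mf)
  mpush0 mpush_ge0 mpush_sigma_additive.

Lemma ge0_integral_mpush (g : T2 -> \bar R) :
  measurable_fun [set: T2] g -> (forall y, 0 <= g y) ->
  \int[mpush mf]_y g y = \int[m]_x g (f x).
Proof. by move=> mg g0; rewrite ge0_integral_pushforward. Qed.

End mpush.

(** * Change of variables on the positive half-line *)

Section substitution.
Context {R : realType}.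
Local Notation leb := (@lebesgue_measure R).
Local Notation pos := (`]0, +oo[%classic : set R).

Let mem_pos x : (x \in pos) = (0 < x).
Proof. by apply/idP/idP; rewrite inE/= in_itv/= andbT. Qed.

Section pushforward_lebesgue.
Variables phi dphi : R -> R.
Hypothesis phi_pos : forall x : R, 0 < x -> 0 < phi x.
Hypothesis phi_cont : forall x : R, 0 < x -> {for x, continuous phi}.
Hypothesis dphi_cont : forall x : R, 0 < x -> {for x, continuous dphi}.
Hypothesis dphi_ge0 : forall x : R, 0 < x -> 0 <= dphi x.
Hypothesis phi_oc : forall a b : R, 0 < a -> a < b ->
  (\int[leb]_(x in pos) ((dphi x)%:E * (\1_(`]a, b]%classic : set R) (phi x))%:E))%E = (b - a)%:E.

Let h := dphi \_ pos.
Let Phi := phi \_ pos.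

Let mh : measurable_fun [set: R] h.
Proof.
apply/(measurable_restrictT dphi) => //; apply: open_continuous_measurable_fun.
  exact: interval_open.
by move=> x; rewrite mem_pos; exact: dphi_cont.
Qed.

Let mPhi : measurable_fun [set: R] Phi.
Proof.
apply/(measurable_restrictT phi) => //; apply: open_continuous_measurable_fun.
  exact: interval_open.
by move=> x; rewrite mem_pos; exact: phi_cont.
Qed.

Let h0 x : 0 <= h x.
Proof. by rewrite /h patchE mem_pos; case: ifPn => // /dphi_ge0. Qed.

Let nu := mpush (T2 := measurableTypeR R) (mdensity leb mh h0) mPhi.

Let nuE A : measurable A -> nu A = (\int[leb]_x ((h x)%:E * (\1_A (Phi x))%:E))%E.
Proof.
move=> mA; rewrite /nu /mpush /pushforward/= /mdensity integral_mkcond.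
apply: eq_integral => x _; rewrite patchE indicE.
have -> : (x \in Phi @^-1` A) = (Phi x \in A) by apply/idP/idP; rewrite !inE.
by case: ifPn; rewrite ?mule1 ?mule0.
Qed.

Let eq_nu A B : measurable A -> measurable B -> A `&` pos = B `&` pos ->
  nu A = nu B.
Proof.
move=> mA mB AB; rewrite !nuE//; apply: eq_integral => x _.
rewrite /h /Phi !patchE mem_pos; case: ifPn => [x0|_]; last by rewrite !mul0e.
rewrite !indicE; suff -> : (phi x \in A) = (phi x \in B) by [].
have px : pos (phi x) by rewrite /= in_itv/= andbT; exact: phi_pos.
apply/idP/idP; rewrite !inE => H.
  by have : (A `&` pos) (phi x) by []; rewrite AB => -[].
by have : (B `&` pos) (phi x) by []; rewrite -AB => -[].
Qed.

Let nu_oc a b : 0 < a -> a < b -> nu `]a, b]%classic = (b - a)%:E.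
Proof.
move=> a0 ab; rewrite -(phi_oc a0 ab) nuE// [RHS]integral_mkcond.
apply: eq_integral => x _; rewrite /h /Phi !patchE mem_pos.
by case: ifPn; rewrite ?mul0e.
Qed.

Let nu_oc0 b : 0 < b -> nu `]0, b]%classic = b%:E.
Proof.
(* The divisor n + 2 keeps the left end strictly below b already for n = 0, as [nu_oc] requires. *)
move=> b0; pose F n : set R := `]b / n.+2%:R, b]%classic.
have F_pos n : 0 < b / n.+2%:R by rewrite divr_gt0.
have F_lt n : b / n.+2%:R < b by rewrite ltr_pdivrMr// ltr_pMr// ltr1n.
have UF : \bigcup_n F n = `]0, b]%classic.
  apply/seteqP; split=> [x [n _]|x]; rewrite /F/= !in_itv/=.
    by move=> /andP[x0 ->]; rewrite andbT (lt_trans (F_pos n)).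
  move=> /andP[x0 xb]; exists (Num.bound (b / x)) => //=.
  rewrite in_itv/= xb andbT ltr_pdivrMr// mulrC -ltr_pdivrMr//.
  apply: lt_le_trans (archi_boundP _) _; first exact: ltW (divr_gt0 b0 x0).
  by rewrite ler_nat (leq_trans (leqnSn _) (leqnSn _)).
have : nu \o F @ \oo --> nu (\bigcup_n F n).
  apply: nondecreasing_cvg_mu.
  - by move=> n; exact: measurable_itv.
  - by rewrite UF; exact: measurable_itv.
  - move=> n m nm; apply/subsetPset => x; rewrite /F/= !in_itv/= => /andP[x0 ->].
    rewrite andbT (le_lt_trans _ x0)// ler_pM2l// lef_pV2 ?posrE//.
    by rewrite ler_nat !ltnS.
have -> : nu \o F = fun n => (b - b * harmonic n.+1)%:E.
  by apply/funext => n; rewrite /= nu_oc.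
rewrite UF => /cvg_lim <- //; apply/cvg_lim => //.
apply: cvg_EFin; first exact: nearW.
rewrite -[X in _ --> X]subr0 -[X in _ - X](mulr0 b).
apply: cvgB; first exact: cvg_cst.
by apply: cvgMr; have := @cvg_harmonic R; rewrite -cvg_shiftS.
Qed.

Lemma ge0_integral_pushforward_lebesgue (f : R -> \bar R) :
  measurable_fun [set: R] f -> (forall y, 0 <= f y)%E ->
  (\int[leb]_(y in `]0%R, +oo[) f y =
   \int[leb]_(x in `]0%R, +oo[) ((dphi x)%:E * f (phi x)))%E.
Proof.
move=> mf f0.
have mR : measurable (`]-oo, 0]%classic : set R) by exact: measurable_itv.
(* Uniqueness characterizes Lebesgue measure on the whole line, while [nu] only accounts for the
   positive half-line; Lebesgue measure on the other half is added to it. *)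
pose neg : R -> R := \1_(`]-oo, 0]).
have mneg : measurable_fun [set: R] neg by exact: measurable_indic.
have neg0 x : 0 <= neg x by rewrite /neg indicE.
pose nu2 := measure_add nu (mdensity leb mneg neg0).
have nu2E A : measurable A -> nu2 A = (nu A + leb (A `&` `]-oo, 0%R]%classic))%E.
  move=> mA; rewrite /nu2 measure_addE; congr (_ + _)%E.
  by rewrite /= /mdensity /neg integral_indic// setIC.
have leb_nu2 A : measurable A -> leb A = nu2 A.
  move=> mA; apply: (@lebesgue_measure_unique R nu2) => // _ [[a b] _ <-] /=.
  transitivity (nu `]a, b]%classic + leb (`]a, b]%classic `&` `]-oo, 0%R]%classic))%E; last first.
    by symmetry; apply: nu2E; exact: measurable_itv.
  have [ba|ab] := leP b a.
    rewrite set_itv_ge ?bnd_simp -?leNgt// set0I measure0 adde0.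
    by symmetry; exact: measure0.
  have mI c e : measurable (`]c, e]%classic : set R) by exact: measurable_itv.
  have [b0|b0] := leP b 0.
    rewrite (@eq_nu _ set0)//; last first.
      rewrite set0I; apply/seteqP; split => // x []; rewrite /= !in_itv/= andbT.
      by move=> /andP[_ /le_trans /(_ b0)]; rewrite leNgt => /negP.
    have -> : nu set0 = 0%E by exact: measure0.
    rewrite add0e; congr (leb _); apply/seteqP; split => x /=; last by case.
    by rewrite !in_itv/= => /andP[-> xb]; rewrite xb (le_trans xb).
  rewrite lebesgue_measure_itv/= lte_fin ab.
  have [a0|a0] := leP 0 a.
    have -> : (`]a, b]%classic `&` `]-oo, 0]%classic = set0 :> set R).
      apply/seteqP; split => // x []; rewrite /= !in_itv/= => /andP[/(le_lt_trans a0)].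
      by rewrite ltNge => /negP.
    rewrite measure0 adde0; move: a0; rewrite le_eqVlt => /predU1P[<-|a0].
      by rewrite nu_oc0// sube0.
    by rewrite nu_oc// EFinB.
  rewrite (@eq_nu _ `]0, b]%classic)//; last first.
    apply/seteqP; split => x []; rewrite /= !in_itv/= !andbT => /andP[xa xb] x0; split=> //.
      by rewrite x0 xb.
    by rewrite xb (lt_trans a0 x0).
  have -> : (`]a, b]%classic `&` `]-oo, 0]%classic = `]a, 0]%classic :> set R).
    apply/seteqP; split => x /=; rewrite !in_itv/=.
      by move=> [/andP[-> _] ->].
    by move=> /andP[-> x0]; rewrite x0 (le_trans x0)// ltW.
  rewrite nu_oc0// lebesgue_measure_itv/= lte_fin a0.
  by rewrite -!EFinB sub0r EFinD.
rewrite (@eq_measure_integral _ _ _ _ nu); last first.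
  move=> A mA Apos; apply: etrans (leb_nu2 _ mA) _.
  transitivity (nu A + leb (A `&` `]-oo, 0%R]%classic))%E; first exact: nu2E.
  rewrite (_ : A `&` _ = set0) ?measure0 ?adde0//.
  apply/seteqP; split => // x [/Apos]; rewrite /= !in_itv/= andbT ltNge.
  by move=> /negP.
have mfp : measurable_fun [set: R] (f \_ pos).
  by apply/(measurable_restrictT f) => //; exact: measurable_funTS.
have fp0 y : (0 <= (f \_ pos) y)%E by apply: erestrict_ge0.
rewrite integral_mkcond ge0_integral_mpush// integral_mdensity//; last first.
  exact: measurableT_comp.
rewrite [RHS]integral_mkcond; apply: eq_integral => x _.
rewrite /h /Phi !patchE mem_pos; case: ifPn => [x0|_]; last by rewrite mul0e.
by rewrite mem_pos phi_pos.
Qed.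

End pushforward_lebesgue.

Section increasing_bijection.
Variables phi psi dphi : R -> R.
Hypothesis phi_pos : forall x : R, 0 < x -> 0 < phi x.
Hypothesis psi_pos : forall y : R, 0 < y -> 0 < psi y.
Hypothesis psiK : forall y : R, 0 < y -> phi (psi y) = y.
Hypothesis phi_incr : forall x y : R, 0 < x -> x < y -> phi x < phi y.
Hypothesis phi_derive : forall x : R, 0 < x -> is_derive x 1 phi (dphi x).
Hypothesis dphi_cont : forall x : R, 0 < x -> {for x, continuous dphi}.
Hypothesis dphi_ge0 : forall x : R, 0 < x -> 0 <= dphi x.

Let phi_cont x : 0 < x -> {for x, continuous phi}.
Proof.
move=> x0; apply: differentiable_continuous; apply/derivable1_diffP.
by have := phi_derive x0; case.
Qed.

Let phi_ltr x y : 0 < x -> 0 < y -> (phi x < phi y) = (x < y).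
Proof.
move=> x0 y0; have [xy|yx|->] := ltgtP x y; last by rewrite ltxx.
  exact: phi_incr.
by apply/negbTE; rewrite -leNgt ltW// phi_incr.
Qed.

Let phi_oc a b : 0 < a -> a < b ->
  (\int[leb]_(x in pos) ((dphi x)%:E * (\1_(`]a, b]%classic : set R) (phi x))%:E))%E = (b - a)%:E.
Proof.
move=> a0 ab; have b0 : 0 < b by exact: lt_trans ab.
have sab : psi a < psi b by rewrite -phi_ltr ?psi_pos// !psiK.
have d x : x \in `[psi a, psi b] -> 0 < x.
  by rewrite in_itv/= => /andP[+ _]; apply: lt_le_trans; exact: psi_pos.
have <- : (\int[leb]_(x in `[psi a, psi b]) (dphi x)%:E = (b - a)%:E)%E.
  rewrite (@continuous_FTC2 _ dphi phi)//.
  - by rewrite !psiK// EFinB.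
  - apply: continuous_in_subspaceT => x; rewrite inE => /d; exact: dphi_cont.
  - split.
    + move=> x /subset_itv_oo_cc /d x0; have := phi_derive x0; by case.
    + by apply: cvg_at_right_filter; apply: phi_cont; exact: psi_pos.
    + by apply: cvg_at_left_filter; apply: phi_cont; exact: psi_pos.
  - move=> x /subset_itv_oo_cc /d x0; rewrite derive1E.
    by have := phi_derive x0; case.
have mdphi : measurable_fun (`[psi a, psi b]%classic : set R) (EFin \o dphi).
  apply/measurable_EFinP; apply: subspace_continuous_measurable_fun => //.
  by apply: continuous_in_subspaceT => x; rewrite inE => /d; exact: dphi_cont.
rewrite -[RHS]integral_itv_obnd_cbnd; last first.
  by apply: measurable_funS mdphi => //; exact: subset_itv_oc_cc.
rewrite integral_mkcond [RHS]integral_mkcond; apply: eq_integral => x _.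
rewrite !patchE indicE mem_pos.
have [x0|x0] := ltP 0 x; last first.
  case: ifPn => //.
  by rewrite inE/= in_itv/= => /andP[/(lt_trans (psi_pos a0))]; rewrite ltNge x0.
have -> : (phi x \in `]a, b]%classic) = (x \in `]psi a, psi b]%classic).
  have -> : (x \in `]psi a, psi b]%classic) = (phi (psi a) < phi x <= phi (psi b)).
    rewrite phi_ltr ?psi_pos// [phi x <= _]leNgt phi_ltr ?psi_pos// -leNgt.
    by apply/idP/idP; rewrite inE/= in_itv.
  by rewrite !psiK//; apply/idP/idP; rewrite inE/= in_itv.
by case: ifPn; rewrite ?mule1 ?mule0.
Qed.

Lemma ge0_integral_substitution (f : R -> \bar R) :
  measurable_fun [set: R] f -> (forall y, 0 <= f y)%E ->
  (\int[leb]_(y in `]0%R, +oo[) f y =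
   \int[leb]_(x in `]0%R, +oo[) ((dphi x)%:E * f (phi x)))%E.
Proof. exact: ge0_integral_pushforward_lebesgue. Qed.

End increasing_bijection.

Let inv_cont (x : R) : 0 < x -> {for x, continuous (fun x : R => x^-1)}.
Proof. by move=> x0; apply: inv_continuous; rewrite gt_eqF. Qed.

Let inv2_cont (x : R) : 0 < x -> {for x, continuous (fun x : R => x^-1 ^+ 2)}.
Proof.
move=> x0; apply: (@continuous_comp _ _ _ (fun x : R => x^-1) (fun y => y ^+ 2)).
  exact: inv_cont.
exact: exprn_continuous.
Qed.

(** The inversion is decreasing, so [ge0_integral_substitution] does not cover it. The density 1/x^2
    is the derivative of -1/x, which the fundamental theorem integrates between 1/b and 1/a. *)
Lemma ge0_integral_inversion (f : R -> \bar R) :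
  measurable_fun [set: R] f -> (forall y, 0 <= f y)%E ->
  (\int[leb]_(y in `]0%R, +oo[) f y =
   \int[leb]_(x in `]0%R, +oo[) ((x^-1 ^+ 2)%:E * f (x^-1)%R))%E.
Proof.
apply: (@ge0_integral_pushforward_lebesgue (fun x => x^-1) (fun x => x^-1 ^+ 2)).
- by move=> x x0; rewrite invr_gt0.
- exact: inv_cont.
- exact: inv2_cont.
- by move=> x _; exact: sqr_ge0.
move=> a b a0 ab; have b0 : 0 < b by exact: lt_trans ab.
have sab : b^-1 < a^-1 by rewrite ltf_pV2.
have d x : x \in `[b^-1, a^-1] -> 0 < x.
  by rewrite in_itv/= => /andP[+ _]; apply: lt_le_trans; rewrite invr_gt0.
have dI (x : R) : 0 < x -> is_derive x 1 (fun x : R => - x^-1) (x^-1 ^+ 2).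
  move=> x0; have xn0 : x != 0 by rewrite gt_eqF.
  have := is_deriveN (@is_deriveV R id x 1 1 xn0 (is_derive_id _ _)).
  rewrite /GRing.scale/= mulr1 opprK -exprVn; exact.
have cI (x : R) : 0 < x -> {for x, continuous (fun x : R => - x^-1)}.
  move=> x0; apply: differentiable_continuous; apply/derivable1_diffP.
  by have := dI x x0; case.
have <- : (\int[leb]_(x in `[(b^-1)%R, (a^-1)%R]) (x^-1 ^+ 2)%:E = (b - a)%:E)%E.
  rewrite (@continuous_FTC2 _ _ (fun x => - x^-1))//.
  - by rewrite !invrK -EFinB opprK addrC.
  - apply: continuous_in_subspaceT => x; rewrite inE => /d; exact: inv2_cont.
  - split.
    + move=> x /subset_itv_oo_cc /d x0; have := dI x x0; by case.
    + by apply: cvg_at_right_filter; apply: cI; rewrite invr_gt0.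
    + by apply: cvg_at_left_filter; apply: cI; rewrite invr_gt0.
  - move=> x /subset_itv_oo_cc /d x0; rewrite derive1E.
    by have := dI x x0; case.
have mf : measurable_fun (`[b^-1, a^-1]%classic : set R) (EFin \o (fun x => x^-1 ^+ 2)).
  apply/measurable_EFinP; apply: subspace_continuous_measurable_fun => //.
  by apply: continuous_in_subspaceT => x; rewrite inE => /d; exact: inv2_cont.
rewrite -[RHS]integral_itv_bndo_bndc; last first.
  by apply: measurable_funS mf => //; exact: subset_itv_co_cc.
rewrite integral_mkcond [RHS]integral_mkcond; apply: eq_integral => x _.
rewrite !patchE indicE mem_pos.
have [x0|x0] := ltP 0 x; last first.
  case: ifPn => //; rewrite inE/= in_itv/= => /andP[bx _].
  by have := le_trans bx x0; rewrite leNgt invr_gt0 b0.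
have -> : (x \in `[b^-1, a^-1[%classic) = (x^-1 \in `]a, b]%classic).
  have -> : (x \in `[b^-1, a^-1[%classic) = (b^-1 <= x < a^-1).
    by apply/idP/idP; rewrite inE/= in_itv.
  have -> : (x^-1 \in `]a, b]%classic) = (a < x^-1 <= b).
    by apply/idP/idP; rewrite inE/= in_itv.
  rewrite andbC -{1}(invrK x) ltf_pV2 ?posrE ?invr_gt0//.
  by rewrite -{2}(invrK x) lef_pV2 ?posrE ?invr_gt0.
by case: ifPn; rewrite ?mule1 ?mule0.
Qed.

End substitution.

Section affine.
Context {R : realType}.
Local Notation leb := (@lebesgue_measure R).
Implicit Types f : R -> \bar R.

Lemma ge0_integral_opp f : measurable_fun [set: R] f -> (forall x, 0 <= f x)%E ->
  (\int[leb]_x f x = \int[leb]_x f (- x)%R)%E.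
Proof.
move=> mf f0; have mN : measurable_fun [set: R] (-%R : R -> measurableTypeR R).
  exact: measurable_funN.
transitivity (\int[mpush leb mN]_x f x)%E; last exact: ge0_integral_mpush.
apply: eq_measure_integral => A mA _.
by symmetry; exact: lebesgue_measureN.
Qed.

Let ge0_integral_affine_pos f c e : 0 < c -> measurable_fun [set: R] f ->
  (forall x, 0 <= f x)%E ->
  (\int[leb]_x f x = c%:E * \int[leb]_x f (c * x + e)%R)%E.
Proof.
move=> c0 mf f0.
have mA : measurable_fun [set: R] ((fun x => c * x + e) : R -> measurableTypeR R).
  by apply: measurable_funD => //; apply: measurable_funM.
transitivity ((NngNum (ltW c0))%:num%:E * \int[mpush leb mA]_x f x)%E; last first.
  by congr (_ * _)%E; exact: ge0_integral_mpush.
rewrite -ge0_integral_mscale//.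
apply: eq_measure_integral => A mA' _.
apply: (@lebesgue_measure_unique R (mscale (NngNum (ltW c0)) (mpush leb mA))) => // _ [[a b] _ <-] /=.
rewrite /mscale/= /mpush /pushforward.
rewrite (_ : _ @^-1` _ = `](a - e) / c, (b - e) / c]%classic); last first.
  apply/seteqP; split=> x; rewrite /= !in_itv/= ltr_pdivrMr// ler_pdivlMr//.
    by rewrite ltrBlDr lerBrDr [x * c]mulrC.
  by rewrite ltrBlDr lerBrDr [x * c]mulrC.
rewrite !lebesgue_measure_itv/= !lte_fin ltr_pM2r ?invr_gt0// ltrD2r.
case: ifPn => ab; last by rewrite mule0.
by rewrite -!EFinB -EFinM; congr (_%:E); field; rewrite gt_eqF.
Qed.

Lemma ge0_integral_affine f c e : c != 0 -> measurable_fun [set: R] f ->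
  (forall x, 0 <= f x)%E ->
  (\int[leb]_x f x = `|c|%:E * \int[leb]_x f (c * x + e)%R)%E.
Proof.
move=> + mf f0; rewrite neq_lt => /orP[c0|c0]; last first.
  by rewrite gtr0_norm//; exact: ge0_integral_affine_pos.
rewrite ltr0_norm// (@ge0_integral_affine_pos _ (- c) e)// ?oppr_gt0//.
congr (_ * _)%E; rewrite [RHS]ge0_integral_opp//.
  by under eq_integral do rewrite mulNr -mulrN.
apply: measurableT_comp => //.
by apply: measurable_funD => //; apply: measurable_funM.
Qed.

Lemma ge0_integral_shift f e : measurable_fun [set: R] f ->
  (forall x, 0 <= f x)%E -> (\int[leb]_x f x = \int[leb]_x f (x + e)%R)%E.
Proof.
move=> mf f0; rewrite (@ge0_integral_affine f 1 e) ?oner_eq0// normr1 mul1e.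
by under eq_integral do rewrite mul1r.
Qed.

End affine.

(** * Lebesgue measure on row vectors: Tonelli, translations, splitting of coordinates *)

Section lebesgue_rV.
Context {R : realType}.
Local Notation leb := (@lebesgue_measure R).

(** An alias of [lebesgue_measure_rV n] that carries the sigma-finite structure Tonelli's theorem
    asks for. *)
Definition lebn n : set 'rV[R]_n -> \bar R := lebesgue_measure_rV n.

HB.instance Definition _ n := Measure.copy (@lebn n) (lebesgue_measure_rV n).

Lemma cons_rV0 n (x : 'rV[R]_n) (t : R) : cons_rV (x, t) ord0 ord0 = t.
Proof. by rewrite mxE unlift_none. Qed.

Lemma cons_rV_lift n (x : 'rV[R]_n) (t : R) i :
  cons_rV (x, t) ord0 (lift ord0 i) = x ord0 i.
Proof. by rewrite mxE liftK. Qed.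

Lemma lebnS n (A : set 'rV[R]_n.+1) :
  lebn A = (@lebn n \x leb)%E (@cons_rV R n @^-1` A).
Proof. by []. Qed.

Definition cube n (r : R) : set 'rV[R]_n := [set x | forall i, `|x ord0 i| <= r].

Lemma measurable_cube n r : measurable (@cube n r).
Proof.
have -> : @cube n r = \bigcap_(i in [set: 'I_n]) ((fun x : 'rV[R]_n => x ord0 i) @^-1` `[-r, r]%classic).
  apply/seteqP; split => x /= h i; first by move=> _; rewrite /= in_itv/= -ler_norml.
  by have := h i Logic.I; rewrite /= in_itv/= -ler_norml.
apply: fin_bigcap_measurable => // i _.
by rewrite -[X in measurable X]setTI; exact: measurable_coord_rV.
Qed.

Lemma lebn_cube n r : 0 <= r -> lebn (@cube n r) = ((2 * r) ^+ n)%:E.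
Proof.
move=> r0; elim: n => [|n IH].
  by rewrite /lebn/= diracE mem_set// => -[].
rewrite lebnS (_ : _ @^-1` _ = @cube n r `*` `[-r, r]%classic); last first.
  apply/seteqP; split => -[x t] /=.
    move=> h; split => [i|]; first by have := h (lift ord0 i); rewrite cons_rV_lift.
    by have := h ord0; rewrite cons_rV0 in_itv/= -ler_norml.
  rewrite in_itv/= -ler_norml => -[hx ht] i.
  by case: (unliftP ord0 i) => [j ->|->]; rewrite ?cons_rV_lift ?cons_rV0.
transitivity (lebn (@cube n r) * leb `[(-r)%R, r]%classic)%E.
  by apply: product_measure1E => //; exact: measurable_cube.
rewrite IH lebesgue_measure_itv/= lte_fin.
have -> : (if (- r < r)%R then r%:E - (- r)%:E else 0)%E = (2 * r)%:E.
  move: r0; rewrite le_eqVlt => /predU1P[<-|r0].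
    by rewrite oppr0 ltxx mulr0.
  by rewrite ifT ?gt0_cp// -EFinB opprK mulr_natl.
by rewrite -EFinM exprSr.
Qed.

Lemma sigma_finite_lebn n : sigma_finite setT (@lebn n).
Proof.
exists (fun N => @cube n N%:R).
  apply/seteqP; split => // x _; exists (Num.bound (\sum_i `|x ord0 i|)) => // i.
  apply: le_trans (ltW (archi_boundP _)); last exact: sumr_ge0.
  by rewrite (bigD1 i)//= lerDl sumr_ge0.
move=> N; split; first exact: measurable_cube.
by rewrite lebn_cube// ltry.
Qed.

HB.instance Definition _ n := @Measure_isSigmaFinite.Build _ _ _ (@lebn n) (@sigma_finite_lebn n).

Section tonelli.
Local Open Scope ereal_scope.
Variables (n : nat) (f : 'rV[R]_n.+1 -> \bar R).
Hypothesis mf : measurable_fun [set: 'rV[R]_n.+1] f.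
Hypothesis f0 : forall x, 0 <= f x.

Let mfc : measurable_fun setT (f \o @cons_rV R n).
Proof. by apply: measurableT_comp => //; exact: measurable_cons_rV. Qed.

Let integral_cons : \int[@lebn n.+1]_x f x = \int[@lebn n \x leb]_z f (cons_rV z).
Proof.
by rewrite -(ge0_integral_mpush (@lebn n \x leb)%E (@measurable_cons_rV R n)).
Qed.

Lemma integral_lebnS : \int[@lebn n.+1]_x f x = \int[leb]_t \int[@lebn n]_x f (cons_rV (x, t)).
Proof. by rewrite integral_cons fubini_tonelli2//. Qed.

End tonelli.

End lebesgue_rV.

Arguments lebn {R} n _.

Section lebesgue_rV_lemmas.
Context {R : realType}.
Local Notation leb := (@lebesgue_measure R).

Lemma measurable_cons_rVl n (t : R) :
  measurable_fun [set: 'rV[R]_n] (fun x => cons_rV (x, t)).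
Proof.
by apply: (measurableT_comp (@measurable_cons_rV R n)); exact: measurable_fun_pair.
Qed.

Lemma measurable_addrV n (a : 'rV[R]_n) : measurable_fun setT (fun x : 'rV[R]_n => x + a).
Proof.
apply: measurable_fun_rV => i; under eq_fun do rewrite mxE.
by apply: measurable_funD => //; exact: measurable_coord_rV.
Qed.

Lemma measurable_row_mx d (T : measurableType d) k m (f : T -> 'rV[R]_k) (g : T -> 'rV[R]_m) :
  measurable_fun setT f -> measurable_fun setT g ->
  measurable_fun setT (fun x => row_mx (f x) (g x)).
Proof.
move=> mf mg; apply: measurable_fun_rV => i; case: (split_ordP i) => j ->.
  under eq_fun do rewrite row_mxEl.
  exact: (measurableT_comp (measurable_coord_rV j)).
under eq_fun do rewrite row_mxEr.
exact: (measurableT_comp (measurable_coord_rV j)).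
Qed.

Lemma ge0_integral_lebn_shift n (f : 'rV[R]_n -> \bar R) a :
  measurable_fun setT f -> (forall x, 0 <= f x)%E ->
  (\int[lebn n]_x f x = \int[lebn n]_x f (x + a)%R)%E.
Proof.
elim: n => [|n IH] in f a *.
  by move=> mf f0; apply: eq_integral => x _; congr (f _); apply/rowP => -[].
move=> mf f0.
pose a' : 'rV[R]_n := \row_i a ord0 (lift ord0 i).
have ca (x : 'rV[R]_n) t : cons_rV (x, t) + a = cons_rV (x + a', t + a ord0 ord0).
  apply/rowP => i; rewrite mxE.
  by case: (unliftP ord0 i) => [j ->|->]; rewrite ?cons_rV_lift ?cons_rV0 ?mxE.
have mfa : measurable_fun setT (fun x : 'rV[R]_n.+1 => f (x + a)).
  by apply: measurableT_comp => //; exact: measurable_addrV.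
rewrite (integral_lebnS mf f0) (integral_lebnS mfa (fun x => f0 _)).
transitivity (\int[leb]_t \int[lebn n]_x f (cons_rV ((x + a')%R, t)))%E.
  apply: eq_integral => t _; rewrite (IH _ a')//.
  by apply: measurableT_comp => //; exact: measurable_cons_rVl.
pose g (t : R) := (\int[lebn n]_x f (cons_rV ((x + a')%R, t)))%E.
rewrite -/(g _); transitivity (\int[leb]_t g (t + a ord0 ord0)%R)%E.
  rewrite -ge0_integral_shift//; last by move=> t; exact: integral_ge0.
  apply: (@measurable_fun_fubini_tonelli_G _ _ _ _ _ (lebn n) (fun z : 'rV[R]_n * R => f (cons_rV (z.1 + a', z.2)))) => //.
  apply: measurableT_comp => //; apply: (measurableT_comp (@measurable_cons_rV R n)).
  apply: measurable_fun_pair => //; apply: (measurableT_comp (@measurable_addrV n a')) => //.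
by apply: eq_integral => t _; apply: eq_integral => x _; rewrite ca.
Qed.

Lemma cons_row_mx k m (a : 'rV[R]_k) (b : 'rV[R]_m) (t : R) :
  cons_rV (row_mx a b, t) = row_mx (cons_rV (a, t)) b :> 'rV[R]_(k.+1 + m).
Proof.
apply/rowP => i; case: (unliftP ord0 i) => [j ->|->].
  rewrite cons_rV_lift; case: (split_ordP j) => l ->.
    rewrite row_mxEl (_ : lift ord0 (lshift m l) = lshift m (lift ord0 l)); last exact/val_inj.
    by rewrite row_mxEl cons_rV_lift.
  rewrite row_mxEr (_ : lift ord0 (rshift k l) = rshift k.+1 l); last exact/val_inj.
  by rewrite row_mxEr.
rewrite cons_rV0 (_ : ord0 = lshift m (ord0 : 'I_k.+1)); last exact/val_inj.
by rewrite row_mxEl cons_rV0.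
Qed.

Lemma ge0_integral_lebn_split k m (f : 'rV[R]_(k + m) -> \bar R) :
  measurable_fun setT f -> (forall x, 0 <= f x)%E ->
  (\int[lebn (k + m)]_x f x =
   \int[lebn k]_a \int[lebn m]_b f (row_mx a b))%E.
Proof.
elim: k => [|k IH] in f *.
  move=> mf f0; rewrite [RHS]integral_dirac//; last first.
    apply: (@measurable_fun_fubini_tonelli_F _ _ _ _ _ (lebn m) (fun z => f (row_mx z.1 z.2))) => //.
    by apply: measurableT_comp => //; exact: measurable_row_mx.
  rewrite diracT mul1e; apply: eq_integral => x _; congr (f _).
  apply/rowP => i; case: (split_ordP i) => [[]//|j ->].
  by rewrite row_mxEr; congr (x _ _); exact/val_inj.
move=> mf f0.
have mg : measurable_fun setT (fun z : 'rV[R]_k.+1 * 'rV[R]_m => f (row_mx z.1 z.2)).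
  by apply: measurableT_comp => //; exact: measurable_row_mx.
rewrite [LHS](integral_lebnS mf f0) [RHS]integral_lebnS; last 2 first.
- by apply: (@measurable_fun_fubini_tonelli_F _ _ _ _ _ (lebn m) (fun z => f (row_mx z.1 z.2))).
- by move=> x; exact: integral_ge0.
apply: eq_integral => t _; rewrite IH; last 2 first.
- by apply: measurableT_comp => //; exact: measurable_cons_rVl.
- by move=> x; exact: f0.
apply: eq_integral => a _; apply: eq_integral => b _.
by rewrite cons_row_mx.
Qed.

(** The sigma-algebra is generated by the coordinates rather than by the open sets, so u is
    approximated: [rd N] rounds coordinates down to the grid of mesh 1/(N+1). Then u composed with
    [rd N] is constant on countably many boxes, and it converges to u pointwise. *)
Lemma continuous_measurable_rV n (u : 'rV[R]_n -> R) :
  continuous u -> measurable_fun setT u.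
Proof.
move=> cu.
pose rd N (x : 'rV[R]_n) : 'rV[R]_n := \row_i ((Num.floor (N.+1%:R * x ord0 i))%:~R / N.+1%:R).
apply: (@measurable_fun_cvg _ _ R setT (fun N => u \o rd N)).
  move=> N _ Y mY; rewrite setTI.
  pose z (w : 'rV[int]_n) : 'rV[R]_n := \row_i ((w ord0 i)%:~R / N.+1%:R).
  pose C (w : 'rV[int]_n) := [set x : 'rV[R]_n | forall i, Num.floor (N.+1%:R * x ord0 i) = w ord0 i].
  have -> : (u \o rd N) @^-1` Y = \bigcup_w (if z w \in u @^-1` Y then C w else set0).
    apply/seteqP; split => x /=.
      move=> Yx; exists (\row_i Num.floor (N.+1%:R * x ord0 i)) => //.
      rewrite ifT; first by move=> i; rewrite mxE.
      rewrite inE/=; congr (Y (u _)) : Yx; apply/rowP => i.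
      by rewrite !mxE.
    move=> [w _]; case: ifPn => //; rewrite inE/= => Yz Cx.
    congr (Y (u _)) : Yz; apply/rowP => i; by rewrite !mxE Cx.
  apply: countable_bigcupT_measurable => // w; case: ifPn => // _.
  have -> : C w = \bigcap_(i in [set: 'I_n]) ((fun x : 'rV[R]_n => N.+1%:R * x ord0 i) @^-1`
      `[(w ord0 i)%:~R, (w ord0 i)%:~R + 1[%classic).
    apply/seteqP; split => x /= h i.
      by move=> _; have := lt_succ_floor (N.+1%:R * x ord0 i); rewrite /= in_itv/= -(h i) ge_floor/= intrD.
    apply: floor_def.
    by have := h i Logic.I; rewrite /= in_itv/= intrD.
  apply: fin_bigcap_measurable => // i _.
  rewrite -[X in measurable X]setTI.
  have m : measurable_fun setT (fun x : 'rV[R]_n => N.+1%:R * x ord0 i).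
    by apply: measurable_funM => //; exact: measurable_coord_rV.
  by apply: m => //; exact: measurable_itv.
move=> x _; apply: (@cvg_comp _ _ _ (fun N => rd N x) u _ (nbhs x)) => //; last exact: cu.
apply/cvgrPdist_le => e e0; near=> N.
rewrite /Num.norm/= mx_normrE; apply/bigmax_leP; split; first exact: ltW.
move=> [i j] _ /=; rewrite !mxE (ord1 i).
have N0 : (0 < N.+1%:R :> R) by [].
have -> : x ord0 j - (Num.floor (N.+1%:R * x ord0 j))%:~R / N.+1%:R =
  (N.+1%:R * x ord0 j - (Num.floor (N.+1%:R * x ord0 j))%:~R) / N.+1%:R.
  by field; rewrite gt_eqF.
rewrite ger0_norm; last by rewrite divr_ge0// subr_ge0 ge_floor.
apply: (@le_trans _ _ (N.+1%:R^-1)).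
  rewrite -[leRHS]mul1r ler_wpM2r ?invr_ge0//.
  by have := lt_succ_floor (N.+1%:R * x ord0 j); rewrite intrD => /ltW; rewrite lerBlDl.
apply: ltW; near: N; exact: near_infty_natSinv_lt (PosNum e0).
Unshelve. all: by end_near. Qed.

End lebesgue_rV_lemmas.

(** * Measurability lemmas and the syntax-directed tactic [meas] *)

Section measurability.
Context d (T : measurableType d) {R : realType}.
Implicit Types (f g : T -> R) (F G : T -> \bar R).
Local Notation mf f := (measurable_fun [set: T] f).

Lemma meas_add f g : mf f -> mf g -> mf (fun x => f x + g x).
Proof. exact: measurable_funD. Qed.

Lemma meas_mul f g : mf f -> mf g -> mf (fun x => f x * g x).
Proof. exact: measurable_funM. Qed.

Lemma meas_opp f : mf f -> mf (fun x => - f x).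
Proof. by move=> ?; exact: measurableT_comp. Qed.

Lemma meas_norm f : mf f -> mf (fun x => `|f x|).
Proof. by move=> ?; exact: measurableT_comp. Qed.

Lemma meas_exp f n : mf f -> mf (fun x => f x ^+ n).
Proof. exact: measurable_funX. Qed.

Lemma meas_powR f a : mf f -> mf (fun x => f x `^ a).
Proof. by move=> ?; exact: (measurableT_comp (measurable_powR a)). Qed.

Lemma meas_expR f : mf f -> mf (fun x => expR (f x)).
Proof. by move=> ?; exact: measurableT_comp. Qed.

Lemma meas_lt f g : mf f -> mf g -> mf (fun x => f x < g x).
Proof. exact: measurable_fun_ltr. Qed.

Lemma meas_le f g : mf f -> mf g -> mf (fun x => f x <= g x).
Proof. exact: measurable_fun_ler. Qed.

Lemma meas_eq f g : mf f -> mf g -> mf (fun x => f x == g x).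
Proof.
move=> mf mg; under eq_fun do rewrite eq_le.
by apply: measurable_and; exact: meas_le.
Qed.

Lemma meas_if d' (T' : measurableType d') (b : T -> bool) (f g : T -> T') :
  mf b -> mf f -> mf g -> mf (fun x => if b x then f x else g x).
Proof. exact: measurable_fun_ifT. Qed.

Lemma meas_inv f : mf f -> mf (fun x => (f x)^-1).
Proof.
move=> mf; have -> : (fun x => (f x)^-1) = (fun x => if f x < 0 then - (- f x) `^ (-1) else if 0 < f x then (f x) `^ (-1) else 0).
  apply/funext => x; have [x0|x0|->] := ltgtP (f x) 0.
  - by rewrite powR_inv1 ?invrN ?opprK// oppr_ge0 ltW.
  - by rewrite powR_inv1// ltW.
  - by rewrite invr0.
apply: meas_if; [exact: meas_lt| |].
  by apply: meas_opp; apply: meas_powR; exact: meas_opp.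
by apply: meas_if => //; [exact: meas_lt|exact: meas_powR].
Qed.

Lemma meas_sqrt f : mf f -> mf (fun x => Num.sqrt (f x)).
Proof.
move=> mf; have -> : (fun x => Num.sqrt (f x)) = (fun x => if 0 <= f x then (f x) `^ 2^-1 else 0).
  by apply/funext => x; case: ifPn => [/powR12_sqrt//|]; rewrite -ltNge => /ltW /ler0_sqrtr.
by apply: meas_if => //; [exact: meas_le|exact: meas_powR].
Qed.

Lemma meas_sg f : mf f -> mf (fun x => Num.sg (f x)).
Proof.
move=> mf; rewrite /Num.sg; apply: meas_if => //; first exact: meas_eq.
by apply: meas_if => //; exact: meas_lt.
Qed.

Lemma meas_min f g : mf f -> mf g -> mf (fun x => Num.min (f x) (g x)).
Proof. exact: measurable_minr. Qed.

Lemma meas_max f g : mf f -> mf g -> mf (fun x => Num.max (f x) (g x)).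
Proof. exact: measurable_maxr. Qed.

Lemma meas_EFin f : mf f -> mf (fun x => (f x)%:E).
Proof. by move=> ?; exact/measurable_EFinP. Qed.

Lemma meas_eadd F G : mf F -> mf G -> mf (fun x => F x + G x)%E.
Proof. exact: emeasurable_funD. Qed.

Lemma meas_emul F G : mf F -> mf G -> mf (fun x => F x * G x)%E.
Proof. exact: emeasurable_funM. Qed.

Lemma meas_coord n (f : T -> 'rV[R]_n) i : mf f -> mf (fun x => f x ord0 i).
Proof. by move=> ?; exact: (measurableT_comp (measurable_coord_rV i)). Qed.

Lemma meas_cons n (f : T -> 'rV[R]_n) (g : T -> R) :
  mf f -> mf g -> mf (fun x => cons_rV (f x, g x)).
Proof.
move=> ? ?; apply: (measurableT_comp (@measurable_cons_rV R n)).
exact: measurable_fun_pair.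
Qed.

Lemma meas_sub_rV n (f g : T -> 'rV[R]_n) : mf f -> mf g -> mf (fun x => f x - g x).
Proof.
move=> ? ?; apply: measurable_fun_rV => i; under eq_fun do rewrite !mxE.
by apply: meas_add; [|apply: meas_opp]; exact: meas_coord.
Qed.

Lemma meas_add_rV n (f g : T -> 'rV[R]_n) : mf f -> mf g -> mf (fun x => f x + g x).
Proof.
move=> ? ?; apply: measurable_fun_rV => i; under eq_fun do rewrite !mxE.
by apply: meas_add; exact: meas_coord.
Qed.

Lemma meas_sum (I : Type) (s : seq I) (P : pred I) (h : I -> T -> R) :
  (forall i, mf (h i)) -> mf (fun x => \sum_(i <- s | P i) h i x).
Proof.
move=> mh; under eq_fun do rewrite big_mkcond.
by apply: measurable_sum => i; case: (P i).
Qed.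

Lemma meas_enorm n (f : T -> 'rV[R]_n) : mf f -> mf (fun x => enorm (f x)).
Proof.
move=> ?; apply: meas_sqrt; apply: meas_sum => i.
by apply: meas_exp; exact: meas_coord.
Qed.

Lemma meas_pnorm k n (f : T -> 'rV[R]_n) : mf f -> mf (fun x => pnorm k (f x)).
Proof.
move=> ?; apply: meas_sqrt; apply: meas_sum => i.
by apply: meas_exp; exact: meas_coord.
Qed.

Lemma meas_spow f a : mf f -> mf (fun x => spow (f x) a).
Proof.
move=> ?; apply: meas_mul; last exact: meas_sg.
by apply: meas_powR; exact: meas_norm.
Qed.

Lemma meas_fst d1 d2 (T1 : measurableType d1) (T2 : measurableType d2) (f : T -> T1 * T2) :
  mf f -> mf (fun x => (f x).1).
Proof. by move=> ?; exact: measurableT_comp. Qed.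

Lemma meas_snd d1 d2 (T1 : measurableType d1) (T2 : measurableType d2) (f : T -> T1 * T2) :
  mf f -> mf (fun x => (f x).2).
Proof. by move=> ?; exact: measurableT_comp. Qed.

Lemma meas_pair d1 d2 (T1 : measurableType d1) (T2 : measurableType d2) (f : T -> T1) (g : T -> T2) :
  mf f -> mf g -> mf (fun x => (f x, g x)).
Proof. exact: measurable_fun_pair. Qed.

End measurability.

Ltac meas1 :=
  match goal with
  | |- measurable_fun _ _ => assumption
  | |- measurable_fun _ (fun x => x) => exact: measurable_id
  | |- measurable_fun _ (fun _ => ?c) => exact: measurable_cst
  | |- measurable_fun _ (fun x => @EFin _ (@?f x)) => apply: (@meas_EFin _ _ _ f)
  | |- measurable_fun _ (fun x => adde (@?f x) (@?g x)) => apply: (@meas_eadd _ _ _ f g)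
  | |- measurable_fun _ (fun x => mule (@?f x) (@?g x)) => apply: (@meas_emul _ _ _ f g)
  | |- measurable_fun _ (@GRing.inv _) => apply: (@meas_inv _ _ _ (fun x => x))
  | |- measurable_fun _ (@GRing.opp _) => apply: (@meas_opp _ _ _ (fun x => x))
  | |- measurable_fun _ (@expR _) => apply: (@meas_expR _ _ _ (fun x => x))
  | |- measurable_fun _ (@Num.norm _ _) => apply: (@meas_norm _ _ _ (fun x => x))
  | |- measurable_fun _ (@enorm _ _) => apply: (@meas_enorm _ _ _ _ (fun x => x))
  | |- measurable_fun _ (@pnorm _ ?k _) => apply: (@meas_pnorm _ _ _ k _ (fun x => x))
  | |- measurable_fun _ (@Order.lt _ _ ?a) => apply: (@meas_lt _ _ _ (fun=> a) (fun x => x))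
  | |- measurable_fun _ (@Order.le _ _ ?a) => apply: (@meas_le _ _ _ (fun=> a) (fun x => x))
  | |- measurable_fun _ (@GRing.add _ ?a) => apply: (@meas_add _ _ _ (fun=> a) (fun x => x))
  | |- measurable_fun _ (@GRing.mul _ ?a) => apply: (@meas_mul _ _ _ (fun=> a) (fun x => x))
  | |- measurable_fun _ (fun x => Order.lt (@?f x) (@?g x)) => apply: (@meas_lt _ _ _ f g)
  | |- measurable_fun _ (fun x => Order.le (@?f x) (@?g x)) => apply: (@meas_le _ _ _ f g)
  | |- measurable_fun _ (fun x => @eq_op _ (@?f x) (@?g x)) => apply: (@meas_eq _ _ _ f g)
  | |- measurable_fun _ (fun x => andb (@?f x) (@?g x)) => apply: (@measurable_and _ _ _ f g)
  | |- measurable_fun _ (fun x => orb (@?f x) (@?g x)) => apply: (@measurable_or _ _ _ f g)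
  | |- measurable_fun _ (fun x => powR (@?f x) ?a) => apply: (@meas_powR _ _ _ f a)
  | |- measurable_fun _ (fun x => expR (@?f x)) => apply: (@meas_expR _ _ _ f)
  | |- measurable_fun _ (fun x => Num.sqrt (@?f x)) => apply: (@meas_sqrt _ _ _ f)
  | |- measurable_fun _ (fun x => Num.sg (@?f x)) => apply: (@meas_sg _ _ _ f)
  | |- measurable_fun _ (fun x => Num.norm (@?f x)) => apply: (@meas_norm _ _ _ f)
  | |- measurable_fun _ (fun x => @Order.min _ _ (@?f x) (@?g x)) => apply: (@meas_min _ _ _ f g)
  | |- measurable_fun _ (fun x => @Order.max _ _ (@?f x) (@?g x)) => apply: (@meas_max _ _ _ f g)
  | |- measurable_fun _ (fun x => spow (@?f x) ?a) => apply: (@meas_spow _ _ _ f a)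
  | |- measurable_fun _ (fun x => enorm (@?f x)) => apply: (@meas_enorm _ _ _ _ f)
  | |- measurable_fun _ (fun x => pnorm ?k (@?f x)) => apply: (@meas_pnorm _ _ _ k _ f)
  | |- measurable_fun _ (fun x => cons_rV (@?f x, @?g x)) => apply: (@meas_cons _ _ _ _ f g)
  | |- measurable_fun _ (fun x => row_mx (@?f x) (@?g x)) => apply: (@measurable_row_mx _ _ _ _ _ f g)
  | |- measurable_fun _ (fun x => (@?f x, @?g x)) => apply: (@meas_pair _ _ _ _ _ _ f g)
  | |- measurable_fun _ (fun x => (@?f x).1) => apply: (@meas_fst _ _ _ _ _ _ f)
  | |- measurable_fun _ (fun x => (@?f x).2) => apply: (@meas_snd _ _ _ _ _ _ f)
  | |- measurable_fun _ (fun x => (@?f x) ^+ ?n) => apply: (@meas_exp _ _ _ f n)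
  | |- measurable_fun _ (fun x => (@?f x)^-1) => apply: (@meas_inv _ _ _ f)
  | |- measurable_fun _ (fun x => (@?f x) + - (@?g x)) => apply: (@meas_sub_rV _ _ _ _ f g)
  | |- measurable_fun _ (fun x => (@?f x) + (@?g x)) => apply: (@meas_add _ _ _ f g)
  | |- measurable_fun _ (fun x => (@?f x) + (@?g x)) => apply: (@meas_add_rV _ _ _ _ f g)
  | |- measurable_fun _ (fun x => (@?f x) + (@?g x)) => apply: (@meas_eadd _ _ _ f g)
  | |- measurable_fun _ (fun x => - (@?f x)) => apply: (@meas_opp _ _ _ f)
  | |- measurable_fun _ (fun x => (@?f x) * (@?g x)) => apply: (@meas_mul _ _ _ f g)
  | |- measurable_fun _ (fun x => fun_of_matrix (@?f x) ord0 ?i) => apply: (@meas_coord _ _ _ _ f i)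
  | H : measurable_fun _ ?F |- measurable_fun _ (fun x => ?F (@?g x)) => apply: (measurableT_comp H)
  | |- measurable_fun _ _ => first [apply: meas_if | apply: meas_sum => ? /=]
  end.
Ltac meas := repeat meas1.

Section tonelli.
Local Open Scope ereal_scope.
Context d1 d2 (T1 : measurableType d1) (T2 : measurableType d2) (R : realType).
Variable m1 : {sigma_finite_measure set T1 -> \bar R}.
Variable m2 : {sigma_finite_measure set T2 -> \bar R}.
Variable f : T1 -> T2 -> \bar R.
Hypothesis mf : measurable_fun [set: T1 * T2] (fun z => f z.1 z.2).
Hypothesis f0 : forall x y, 0 <= f x y.

Lemma tonelli_swap : \int[m1]_x \int[m2]_y f x y = \int[m2]_y \int[m1]_x f x y.
Proof.
have f0' (z : T1 * T2) : 0 <= f z.1 z.2 by [].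
have <- := @fubini_tonelli1 _ _ _ _ _ m1 m2 _ mf f0'.
exact: fubini_tonelli2.
Qed.

Lemma meas_integral2 : measurable_fun setT (fun x => \int[m2]_y f x y).
Proof. exact: (@measurable_fun_fubini_tonelli_F _ _ _ _ _ m2 (fun z => f z.1 z.2)). Qed.

End tonelli.

(** * Polar coordinates *)

Section polar2.
Context {R : realType}.
Local Notation leb := (@lebesgue_measure R).
Local Notation pos := (`]0, +oo[%classic : set R).

Lemma in_pos (x : R) : (x \in pos) = (0 < x).
Proof. by apply/idP/idP; rewrite inE/= in_itv/= andbT. Qed.

Lemma integral_posE (f : R -> \bar R) :
  (\int[leb]_(x in `]0%R, +oo[) f x = \int[leb]_x (if (0 < x)%R then f x else 0))%E.
Proof.
rewrite integral_mkcond; apply: eq_integral => x _.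
by rewrite patchE in_pos.
Qed.

Lemma integral_sym1E (f : R -> \bar R) :
  (\int[leb]_(x in `](-1)%R, 1%R[) f x = \int[leb]_x (if (`|x| < 1)%R then f x else 0))%E.
Proof.
rewrite integral_mkcond; apply: eq_integral => x _.
rewrite patchE; congr (if _ then _ else _).
by apply/idP/idP; rewrite inE/= in_itv/= -ltr_norml.
Qed.

(** For fixed y the distance to the origin becomes the variable in place of the second coordinate.
    The substitution is first made in the excess of this distance over |y|, which ranges over the
    whole half-line. *)
Let shift_circle (y : R) (F : R -> \bar R) : measurable_fun setT F ->
  (forall x, 0 <= F x)%E ->
  (\int[leb]_(r in `]0%R, +oo[) F r =
   \int[leb]_r (if (`|y| < r)%R then (r / Num.sqrt (r ^+ 2 - y ^+ 2))%:E * F (Num.sqrt (r ^+ 2 - y ^+ 2)) else 0))%E.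
Proof.
move=> mF F0.
pose phi s := Num.sqrt ((`|y| + s) ^+ 2 - y ^+ 2).
have y0 := normr_ge0 y.
have pos_arg s : 0 < s -> 0 < (`|y| + s) ^+ 2 - y ^+ 2.
  by move=> s0; rewrite -(real_normK (num_real y)) subr_sqr mulr_gt0//; lra.
have d (s : R) : 0 < s -> is_derive s 1 phi ((`|y| + s) / phi s).
  move=> s0; have h : is_derive s 1 (fun s => (`|y| + s) ^+ 2 - y ^+ 2) (2 * (`|y| + s)).
    apply: is_derive_eq; rewrite /GRing.scale/=; ring.
  have p := pos_arg s s0.
  have := @is_derive1_comp R Num.sqrt _ s _ _ (is_derive1_sqrt p) h.
  rewrite -/phi => h'; apply: (is_derive_eq h').
  rewrite -[Num.sqrt _]/(phi s); field.
  by rewrite gt_eqF// sqrtr_gt0.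
pose psi r := Num.sqrt (r ^+ 2 + y ^+ 2) - `|y|.
have psi_pos (r : R) : 0 < r -> 0 < psi r.
  move=> r0; rewrite subr_gt0 -sqrtr_sqr ltr_sqrt ?ltrDr ?exprn_gt0//.
  by rewrite ltr_wpDr ?sqr_ge0// exprn_gt0.
rewrite (@ge0_integral_substitution _ phi psi (fun s => (`|y| + s) / phi s))//.
- rewrite integral_posE [RHS](ge0_integral_shift (`|y|)).
  + by apply: eq_integral => s _; rewrite ltrDr; case: ifPn => // s0; rewrite /phi [(s + _)%R]addrC.
  + by meas.
  + move=> x; case: ifPn => // yx; rewrite mule_ge0// lee_fin divr_ge0 ?sqrtr_ge0//.
    by rewrite ltW// (le_lt_trans y0).
- by move=> x x0; rewrite sqrtr_gt0 pos_arg.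
- move=> r r0; rewrite /phi /psi subrKC sqr_sqrtr ?addr_ge0 ?sqr_ge0// addrK sqrtr_sqr.
  by rewrite gtr0_norm.
- move=> a b a0 ab; rewrite ltr_sqrt ?pos_arg//; last exact: lt_trans ab.
  by rewrite ltrD2r ltr_sqr ?nnegrE ?ltrD2l//; lra.
- move=> x x0; apply: continuousM.
    by apply: continuousD; [exact: cvg_cst|exact: cvg_id].
  apply: continuousV; first by rewrite gt_eqF// sqrtr_gt0 pos_arg.
  apply: differentiable_continuous; apply/derivable1_diffP.
  by have := d x x0; case.
- by move=> x x0; rewrite divr_ge0 ?sqrtr_ge0// addr_ge0// ltW.
Qed.

(** The angular variable is the cosine t = y / r, whence the weight 1 / sqrt(1 - t^2). Introducing
    the radius at fixed y and then y = r t at fixed radius, with Tonelli in between, uses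
    one-dimensional substitutions only. *)
Lemma integral_polar2 (F : R * R -> \bar R) : measurable_fun setT F ->
  (forall z, 0 <= F z)%E ->
  (\int[leb]_y \int[leb]_(r in `]0%R, +oo[) F (y, r) =
   \int[leb]_(r in `]0%R, +oo[) \int[leb]_(t in `](-1)%R, 1%R[)
     ((r / Num.sqrt (1 - t ^+ 2))%:E * F (r * t, r * Num.sqrt (1 - t ^+ 2))%R))%E.
Proof.
move=> mF F0.
pose G (z : R * R) := (if (`|z.1| < z.2)%R then
  (z.2 / Num.sqrt (z.2 ^+ 2 - z.1 ^+ 2))%:E * F (z.1, Num.sqrt (z.2 ^+ 2 - z.1 ^+ 2)%R) else 0)%E.
have mG : measurable_fun setT G by rewrite /G; meas.
have G0 z : (0 <= G z)%E.
  rewrite /G; case: ifPn => // h; rewrite mule_ge0// lee_fin divr_ge0 ?sqrtr_ge0//.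
  by rewrite ltW// (le_lt_trans _ h).
transitivity (\int[leb]_y \int[leb]_r G (y, r))%E.
  apply: eq_integral => y _; rewrite (shift_circle y)//.
  by apply: measurableT_comp => //; meas.
transitivity (\int[leb]_r \int[leb]_y G (y, r))%E.
  by apply: (@tonelli_swap _ _ _ _ _ leb leb (fun y r => G (y, r))) => //; meas.
rewrite integral_posE; apply: eq_integral => r _; case: ifPn => [r0|].
  rewrite integral_sym1E (@ge0_integral_affine _ (fun y => G (y, r)) r 0) ?gt_eqF//; last by meas.
  rewrite gtr0_norm// -ge0_integralZl//; last 2 first.
  - by meas.
  - by rewrite lee_fin ltW.
  apply: eq_integral => t _; rewrite /G/= addr0 normrM gtr0_norm// gtr_pMr//.
  case: ifPn => t1; last by rewrite mule0.
  have e : Num.sqrt (r ^+ 2 - (r * t) ^+ 2) = r * Num.sqrt (1 - t ^+ 2).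
    rewrite exprMn -{1}(mulr1 (r ^+ 2)) -mulrBr sqrtrM ?sqr_ge0// sqrtr_sqr.
    by rewrite gtr0_norm.
  rewrite e muleA -EFinM; congr (_%:E * _)%E.
  rewrite mulrA invfM mulrA -[r * r / r]mulrA divff ?gt_eqF// mulr1//.
rewrite -leNgt => r0; rewrite integral0_eq// => y _.
by rewrite /G/= ltNge (le_trans r0).
Qed.

End polar2.

Section polar.
Context {R : realType}.
Local Notation leb := (@lebesgue_measure R).

Lemma ge0_integral_halves (f : R -> \bar R) : measurable_fun setT f ->
  (forall x, 0 <= f x)%E ->
  (\int[leb]_x f x = \int[leb]_(x in `]0%R, +oo[) (f x + f (- x)%R))%E.
Proof.
move=> mf f0.
have mN : measurable_fun setT (fun x : R => f (- x)) by meas.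
have -> : ([set: R] = `]-oo, 0] `|` `]0, +oo[)%classic.
  apply/seteqP; split => // x _ /=; rewrite !in_itv/= andbT.
  by case: (leP x 0) => h; [left|right].
rewrite ge0_integral_setU//; last 2 first.
- exact: measurable_funTS.
- rewrite disj_set2E; apply/eqP; apply/seteqP; split => // x [] /=.
  by rewrite !in_itv/= andbT => /le_lt_trans h /h; rewrite ltxx.
rewrite ge0_integralD//; [|exact: measurable_funTS|exact: measurable_funTS].
rewrite [RHS]addeC; congr (_ + _)%E.
rewrite integral_itv_obnd_cbnd; last exact: measurable_funTS.
rewrite integral_mkcond ge0_integral_opp; last 2 first.
- by apply/(measurable_restrictT f) => //; exact: measurable_funTS.
- exact: erestrict_ge0.
rewrite [RHS]integral_mkcond; apply: eq_integral => x _; rewrite !patchE.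
congr (if _ then _ else _).
by apply/idP/idP; rewrite !inE/= !in_itv/= andbT oppr_le0.
Qed.

Lemma enorm_cons n (x : 'rV[R]_n) (t : R) :
  enorm (cons_rV (x, t)) = Num.sqrt (t ^+ 2 + enorm x ^+ 2).
Proof.
rewrite /enorm big_ord_recl cons_rV0 sqr_sqrtr; last first.
  by apply: sumr_ge0 => i _; exact: sqr_ge0.
by congr (Num.sqrt (_ + _)); apply: eq_bigr => i _; rewrite cons_rV_lift.
Qed.

Lemma enorm_ge0 n (x : 'rV[R]_n) : 0 <= enorm x.
Proof. exact: sqrtr_ge0. Qed.

Lemma enorm_rV0 (x : 'rV[R]_0) : enorm x = 0.
Proof. by rewrite /enorm big_ord0 sqrtr0. Qed.

Lemma integral_lebn1 (f : 'rV[R]_1 -> \bar R) : measurable_fun setT f ->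
  (forall x, 0 <= f x)%E ->
  (\int[lebn 1]_x f x = \int[leb]_t f (cons_rV (0%R : 'rV[R]_0, t)))%E.
Proof.
move=> mf f0; rewrite integral_lebnS//; apply: eq_integral => t _.
by rewrite [LHS]integral_dirac// ?diracT ?mul1e//; meas.
Qed.

Definition dot n (x y : 'rV[R]_n) : R := \sum_i x ord0 i * y ord0 i.

Lemma dot_cons n (x : 'rV[R]_n.+1) (y : 'rV[R]_n) (t : R) :
  dot x (cons_rV (y, t)) =
  x ord0 ord0 * t + dot (\row_i x ord0 (lift ord0 i)) y.
Proof.
rewrite /dot big_ord_recl cons_rV0; congr (_ + _).
by apply: eq_bigr => i _; rewrite cons_rV_lift mxE.
Qed.

Lemma enorm_row n (x : 'rV[R]_n.+1) :
  enorm x = Num.sqrt (x ord0 ord0 ^+ 2 + enorm (\row_i x ord0 (lift ord0 i)) ^+ 2).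
Proof.
rewrite {1}/enorm big_ord_recl sqr_sqrtr; last first.
  by apply: sumr_ge0 => i _; exact: sqr_ge0.
by congr (Num.sqrt (_ + _)); apply: eq_bigr => i _; rewrite mxE.
Qed.

Lemma meas_dot n d (T : measurableType d) (x : 'rV[R]_n) (f : T -> 'rV[R]_n) :
  measurable_fun setT f -> measurable_fun setT (fun y => dot x (f y)).
Proof. by move=> mf; rewrite /dot; meas. Qed.

(* Completing the square after the substitution [z = (a t + b s) / r],
   [r = sqrt (a ^ 2 + b ^ 2)], done one variable at a time. *)
Lemma integral_rotation2 (G : R * R -> \bar R) (a b : R) :
  measurable_fun setT G -> (forall z, 0 <= G z)%E -> 0 <= b ->
  (\int[leb]_t \int[leb]_s G (t ^+ 2 + s ^+ 2, a * t + b * s)%R =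
   \int[leb]_t \int[leb]_s G (t ^+ 2 + s ^+ 2, Num.sqrt (a ^+ 2 + b ^+ 2) * t)%R)%E.
Proof.
move=> mG G0 b0.
have [->|a0] := eqVneq a 0.
  rewrite expr0n/= add0r sqrtr_sqr (ger0_norm b0).
  rewrite (@tonelli_swap _ _ _ _ _ leb leb (fun t s => G (t ^+ 2 + s ^+ 2, 0 * t + b * s))%R); last 2 first.
  - by meas.
  - by move=> t s; exact: G0.
  apply: eq_integral => t _; apply: eq_integral => s _.
  by rewrite mul0r add0r addrC.
set r := Num.sqrt _.
have r0 : 0 < r by rewrite sqrtr_gt0 ltr_wpDr ?sqr_ge0// exprn_even_gt0.
have r2 : r ^+ 2 = a ^+ 2 + b ^+ 2 by rewrite sqr_sqrtr// addr_ge0 ?sqr_ge0.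
rewrite (@tonelli_swap _ _ _ _ _ leb leb (fun t s => G (t ^+ 2 + s ^+ 2, a * t + b * s))%R); last 2 first.
- by meas.
- by move=> t s; exact: G0.
transitivity (\int[leb]_s \int[leb]_z (`|r / a|%:E * G (((r * z - b * s) / a) ^+ 2 + s ^+ 2, r * z)%R))%E.
  apply: eq_integral => s _.
  rewrite (@ge0_integral_affine _ (fun t => G (t ^+ 2 + s ^+ 2, a * t + b * s))%R (r / a) (- b * s / a))//; last 2 first.
  - by rewrite mulf_neq0 ?invr_neq0// gt_eqF.
  - by meas.
  rewrite -ge0_integralZl; last 4 first.
  - exact: measurableT.
  - by meas.
  - by move=> z _; exact: G0.
  - by rewrite lee_fin.
  apply: eq_integral => z _; congr (_ * G (_, _))%E.
    by congr (_ ^+ 2 + _); field.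
  by field.
rewrite (@tonelli_swap _ _ _ _ _ leb leb (fun s z => `|r / a|%:E * G (((r * z - b * s) / a) ^+ 2 + s ^+ 2, r * z)%R)%E); last 2 first.
- by meas.
- by move=> x y; rewrite mule_ge0// lee_fin.
apply: eq_integral => z _.
rewrite (@ge0_integral_affine _ (fun s => `|r / a|%:E * G (((r * z - b * s) / a) ^+ 2 + s ^+ 2, r * z)%R)%E (a / r) (b * z / r))//; last 3 first.
- by rewrite mulf_neq0 ?invr_neq0// gt_eqF.
- by meas.
- by move=> x; rewrite mule_ge0// lee_fin.
rewrite -ge0_integralZl//; last 2 first.
- by meas.
- by move=> x _; rewrite mule_ge0// lee_fin.
apply: eq_integral => w _; rewrite muleA -EFinM -normrM.
have -> : a / r * (r / a) = 1 by field; rewrite a0 gt_eqF.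
rewrite normr1 mul1e; congr (G (_, _)).
transitivity (((r ^+ 2 - b ^+ 2) * z - a * b * w) ^+ 2 / (a ^+ 2 * r ^+ 2) + (a * w + b * z) ^+ 2 / r ^+ 2).
  by field; rewrite a0 gt_eqF.
rewrite r2 addrK.
have : a ^+ 2 + b ^+ 2 != 0 by rewrite -r2 expf_neq0// gt_eqF.
by move=> h; field; rewrite a0 h.
Qed.

(** The induction rotates the trailing part of x onto one axis, which leaves a rotation in the plane
    of the first two coordinates; [H] integrates out the others, which enter only through their
    norm. *)
Lemma integral_rotation n (x : 'rV[R]_n.+1) (f : R * R -> \bar R) :
  measurable_fun setT f -> (forall z, 0 <= f z)%E ->
  (\int[lebn n.+1]_y f (enorm y, dot x y) =
   \int[lebn n.+1]_y f (enorm y, enorm x * y ord0 ord0)%R)%E.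
Proof.
elim: n => [|n IH] in x f *.
  move=> mf f0; rewrite !integral_lebn1//; last 2 first.
  - by meas.
  - by meas; exact: meas_dot.
  have e t : enorm (cons_rV (0 : 'rV[R]_0, t)) = `|t|.
    by rewrite enorm_cons enorm_rV0 expr0n/= addr0 sqrtr_sqr.
  have ex : enorm x = `|x ord0 ord0|.
    by rewrite enorm_row enorm_rV0 expr0n/= addr0 sqrtr_sqr.
  under eq_integral do rewrite e dot_cons /dot big_ord0 addr0.
  under [RHS]eq_integral do rewrite e ex cons_rV0.
  have [x0|x0] := leP 0 (x ord0 ord0); first by rewrite ger0_norm.
  rewrite ltr0_norm// [LHS]ge0_integral_opp//; last by meas.
  by apply: eq_integral => t _; rewrite normrN mulrN mulNr.
move=> mf f0.
set x' := \row_i x ord0 (lift ord0 i); set x0 := x ord0 ord0.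
have md : measurable_fun setT (fun y : 'rV[R]_n.+2 => dot x y).
  by apply: meas_dot; meas.
pose H (z : R * R) := (\int[lebn n]_w f (Num.sqrt (z.1 + enorm w ^+ 2), z.2))%E.
have H0 z : (0 <= H z)%E by exact: integral_ge0.
have mH : measurable_fun setT H.
  apply: (@meas_integral2 _ _ (R * R)%type _ _ (lebn n) (fun z w => f (Num.sqrt (z.1 + enorm w ^+ 2), z.2))) => //.
  by meas.
have HE (g : R * R -> R) : measurable_fun setT g ->
    (\int[leb]_t \int[lebn n.+1]_y f (Num.sqrt (t ^+ 2 + enorm y ^+ 2), g (t, y ord0 ord0)) =
    \int[leb]_t \int[leb]_s H (t ^+ 2 + s ^+ 2, g (t, s))%R)%E.
  move=> mg; apply: eq_integral => t _; rewrite integral_lebnS; last 2 first.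
  - by meas.
  - by move=> y; exact: f0.
  apply: eq_integral => s _; apply: eq_integral => w _.
  by rewrite enorm_cons cons_rV0 sqr_sqrtr ?addr_ge0 ?sqr_ge0//= addrA.
rewrite !integral_lebnS; [|by meas|by move=> y; exact: f0|by meas|by move=> y; exact: f0].
transitivity (\int[leb]_t \int[lebn n.+1]_y
   f (Num.sqrt (t ^+ 2 + enorm y ^+ 2), x0 * t + enorm x' * y ord0 ord0)%R)%E.
  apply: eq_integral => t _.
  under eq_integral do rewrite enorm_cons dot_cons -/x0 -/x'.
  apply: (IH x' (fun z => f (Num.sqrt (t ^+ 2 + z.1 ^+ 2), x0 * t + z.2)))%R => //.
  by meas.
rewrite (HE (fun z => x0 * z.1 + enorm x' * z.2))%R; last by meas.
rewrite integral_rotation2// ?enorm_ge0// -enorm_row.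
rewrite -(HE (fun z => enorm x * z.1))%R; last by meas.
apply: eq_integral => t _; apply: eq_integral => y _.
by rewrite enorm_cons cons_rV0.
Qed.

End polar.

Section radial.
Context {R : realType}.
Local Notation leb := (@lebesgue_measure R).

(** c is the area of the unit sphere of R^n, characterized by what it does. It is an extended real
    because its finiteness is only known from [sphere_area_radial] on. *)
Definition radial_const n (c : \bar R) := (0 <= c)%E /\
  forall g : R -> \bar R, measurable_fun setT g -> (forall r, 0 <= g r)%E ->
  (\int[lebn n]_x g (enorm x) =
   c * \int[leb]_(r in `]0%R, +oo[) ((r ^+ n.-1)%:E * g r))%E.

(** The coordinates other than the first are integrated radially in R^(n+1); plane polar coordinates
    for the first one and their norm follow. The exponent (n - 1) / 2 is ((n + 2) - 3) / 2, the one
    in [Phi] for dimension n + 2. *)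
Lemma integral_polar_const n (c : \bar R) (f : R * R -> \bar R) :
  radial_const n.+1 c -> measurable_fun setT f -> (forall z, 0 <= f z)%E ->
  (\int[lebn n.+2]_y f (enorm y, y ord0 ord0) =
   c * \int[leb]_(r in `]0%R, +oo[) ((r ^+ n.+1)%:E *
     \int[leb]_(t in `](-1)%R, 1%R[)
       (((1 - t ^+ 2) `^ ((n%:R - 1) / 2))%:E * f (r, r * t)%R)))%E.
Proof.
move=> [c0 hc] mf f0.
pose F (z : R * R) := ((`|z.2| ^+ n)%:E * f (Num.sqrt (z.1 ^+ 2 + z.2 ^+ 2), z.1))%E.
have mF : measurable_fun setT F by rewrite /F; meas.
have F0 z : (0 <= F z)%E by rewrite mule_ge0// lee_fin exprn_ge0.
rewrite integral_lebnS//; last by meas.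
transitivity (\int[leb]_t (c * \int[leb]_(r in `]0%R, +oo[) F (t, r)))%E.
  apply: eq_integral => t _.
  under eq_integral do rewrite enorm_cons cons_rV0.
  rewrite (hc (fun r => f (Num.sqrt (t ^+ 2 + r ^+ 2), t))); last 2 first.
  - by meas.
  - by move=> r; exact: f0.
  congr (_ * _)%E; apply: eq_integral => r; rewrite in_pos => r0.
  by rewrite /F/= gtr0_norm.
rewrite ge0_integralZl//; last 2 first.
- under eq_fun do rewrite integral_posE.
  apply: (@meas_integral2 _ _ R _ _ leb (fun t r => if (0 < r)%R then F (t, r) else 0%E)).
    by meas.
  by move=> x y; case: ifPn.
- by move=> t _; exact: integral_ge0.
congr (_ * _)%E; rewrite integral_polar2//.
apply: eq_integral => r; rewrite in_pos => r0.
rewrite -ge0_integralZl//; last 3 first.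
- by apply: measurable_funTS; meas.
- by move=> t _; rewrite mule_ge0// lee_fin powR_ge0.
- by rewrite lee_fin exprn_ge0// ltW.
apply: eq_integral => t; rewrite inE/= in_itv/= -ltr_norml => t1.
have w0 : 0 < 1 - t ^+ 2 by rewrite subr_gt0 -real_normK ?num_real// expr_lt1.
rewrite /F/= muleA -EFinM muleA -EFinM; congr ((_)%:E * f (_, _))%E.
  rewrite ger0_norm ?mulr_ge0 ?sqrtr_ge0 ?(ltW r0)//.
  rewrite exprMn -powR12_sqrt ?(ltW w0)// mulrAC mulrA -exprS -mulrA; congr (_ * _).
  rewrite -[(_ `^ 2^-1) ^+ n]powR_mulrn ?powR_ge0// -powRrM -powRN -powRD ?(gt_eqF w0) ?implybT//.
  by congr (_ `^ _); field.
rewrite exprMn exprMn sqr_sqrtr ?(ltW w0)// -mulrDr subrKC mulr1 sqrtr_sqr.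
by rewrite gtr0_norm.
Qed.

Lemma radial_const1 : radial_const 1 2%:E.
Proof.
split; first by rewrite lee_fin.
move=> g mg g0; rewrite integral_lebn1//; last by meas.
have e t : enorm (cons_rV (0 : 'rV[R]_0, t)) = `|t|.
  by rewrite enorm_cons enorm_rV0 expr0n/= addr0 sqrtr_sqr.
under eq_integral do rewrite e.
rewrite ge0_integral_halves//; last by meas.
rewrite -ge0_integralZl//; last 2 first.
- by apply: measurable_funTS; meas.
- move=> x; rewrite /= in_itv/= andbT => x0; rewrite mule_ge0// lee_fin exprn_ge0//; exact: ltW.
apply: eq_integral => r; rewrite in_pos => r0.
by rewrite normrN gtr0_norm// expr0 mul1e (EFinD 1 1) ge0_muleDl// !mul1e.
Qed.

Lemma radial_constS n c : radial_const n.+1 c ->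
  radial_const n.+2 (c * \int[leb]_(t in `](-1)%R, 1%R[) ((1 - t ^+ 2) `^ ((n%:R - 1) / 2))%:E)%E.
Proof.
move=> hc; split.
  by case: hc => c0 _; rewrite mule_ge0//; apply: integral_ge0 => t _; rewrite lee_fin powR_ge0.
move=> g mg g0.
have := @integral_polar_const n c (fun z => g z.1) hc.
move=> ->//; last by meas.
rewrite -muleA; congr (_ * _)%E.
rewrite -ge0_integralZl//; last 3 first.
- by apply: measurable_funTS; meas.
- by move=> x; rewrite /= in_itv/= andbT => x0; rewrite mule_ge0// lee_fin exprn_ge0// ltW.
- by apply: integral_ge0 => t _; rewrite lee_fin powR_ge0.
apply: eq_integral => r; rewrite in_pos => r0.
under eq_integral do rewrite muleC /=.
rewrite ge0_integralZl//; last 2 first.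
- by apply: measurable_funTS; meas.
- by move=> x _; rewrite lee_fin powR_ge0.
by rewrite muleA muleC.
Qed.

Lemma radial_const_ex n : exists c, radial_const n.+1 c.
Proof.
elim: n => [|n [c hc]]; first by exists 2%:E; exact: radial_const1.
by eexists; exact: radial_constS hc.
Qed.

Lemma integral_pow01 n :
  (\int[leb]_(r in `]0%R, +oo[) ((r ^+ n)%:E * (if (0 < r <= 1)%R then 1 else 0)) = (n.+1%:R^-1)%:E)%E.
Proof.
have d (x : R) : is_derive x 1 (fun x => x ^+ n.+1 / n.+1%:R) (x ^+ n).
  have -> : (fun x => x ^+ n.+1 / n.+1%:R) = (n.+1%:R^-1 : R) \*: ((id : R -> R) ^+ n.+1).
    by apply/funext => y; rewrite /= exprfctE mulrC.
  have := @is_deriveZ _ _ _ _ n.+1%:R^-1 x 1 _ (@is_deriveX _ _ id n.+1 x 1 1 (is_derive_id _ _)).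
  by rewrite /GRing.scale/= mulr1 mulrA mulVf ?mul1r.
have cn : continuous (fun x : R => x ^+ n.+1 / n.+1%:R).
  move=> x; apply: differentiable_continuous; apply/derivable1_diffP.
  by have := d x; case.
transitivity (\int[leb]_(r in `[0%R, 1%R]) (r ^+ n)%:E)%E; last first.
  rewrite (@continuous_FTC2 _ _ (fun x => x ^+ n.+1 / n.+1%:R))//.
  - by rewrite expr1n expr0n/= mul0r sube0 mul1r.
  - by apply: continuous_subspaceT; exact: exprn_continuous.
  - split.
    + by move=> x _; have := d x; case.
    + by apply: cvg_at_right_filter; exact: cn.
    + by apply: cvg_at_left_filter; exact: cn.
  - by move=> x _; rewrite derive1E; have := d x; case.
rewrite -[RHS]integral_itv_obnd_cbnd; last by apply: measurable_funTS; meas.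
rewrite integral_mkcond [RHS]integral_mkcond; apply: eq_integral => r _.
rewrite !patchE in_pos.
have -> : (r \in `]0, 1]%classic) = (0 < r <= 1).
  by apply/idP/idP; rewrite inE/= in_itv.
by case: (ltP 0 r) => //= r0; case: ifPn; rewrite ?mule1 ?mule0.
Qed.

Lemma enormZ n (a : R) (x : 'rV[R]_n) : 0 <= a -> enorm (a *: x) = a * enorm x.
Proof.
move=> a0; rewrite /enorm (eq_bigr (fun i => a ^+ 2 * x ord0 i ^+ 2)); last first.
  by move=> i _; rewrite mxE exprMn.
by rewrite -mulr_sumr sqrtrM ?sqr_ge0// sqrtr_sqr ger0_norm.
Qed.

Lemma le_enorm n (x : 'rV[R]_n) i : `|x ord0 i| <= enorm x.
Proof.
rewrite /enorm -sqrtr_sqr ler_wsqrtr// (bigD1 i)//= lerDl.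
by apply: sumr_ge0 => j _; exact: sqr_ge0.
Qed.

(** The cone over the sphere in [sphere_area] is the punctured unit ball, whose measure is c / (n +
    1) in polar coordinates. It lies in a cube, so c is finite; and c = 0 would make Lebesgue
    measure vanish. *)
Lemma sphere_area_radial n :
  0 < @sphere_area R n.+1 /\ radial_const n.+1 (@sphere_area R n.+1)%:E.
Proof.
have [c hc] := radial_const_ex n; have [c0 hc'] := hc.
pose B := [set x : 'rV[R]_n.+1 | 0 < enorm x <= 1].
have mB : measurable B.
  rewrite -[X in measurable X]setTI (_ : setT `&` B = setT `&` (fun x : 'rV[R]_n.+1 => 0 < enorm x <= 1) @^-1` [set true]).
    by apply: (_ : measurable_fun setT _) => //; meas.
  by apply/seteqP; split.
have cB : lebn n.+1 B = (c * (n.+1%:R^-1)%:E)%E.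
  have mg : measurable_fun [set: R] (fun r : R => if (0 < r <= 1)%R then 1%E else 0%E : \bar R).
    by meas.
  rewrite -integral_pow01 -(hc' _ mg); last by move=> r; case: ifPn.
  rewrite -(setIT B) -integral_indic//; apply: eq_integral => x _; rewrite indicE.
  have -> : (x \in B) = (0 < enorm x <= 1) by apply/idP/idP; rewrite inE.
  by case: ifPn.
have Bfin : (lebn n.+1 B < +oo)%E.
  apply: (@le_lt_trans _ _ (lebn n.+1 (cube 1))).
    apply: le_measure; rewrite ?inE//; first exact: measurable_cube.
    by move=> x /andP[_ x1] i; exact: le_trans (le_enorm _ _) x1.
  by rewrite lebn_cube// ltry.
have n0 : (0 < n.+1%:R^-1 :> R) by rewrite invr_gt0.
have cfin : c \is a fin_num.
  rewrite ge0_fin_numE//; move: Bfin; rewrite cB; case: (c) c0 => [r _ _|_|//]; first by rewrite ltry.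
  by rewrite gt0_mulye ?lte_fin// ltxx.
have cE : c = (@sphere_area R n.+1)%:E.
  rewrite /sphere_area (_ : [set r *: w | r in _ & w in _] = B); last first.
    apply/seteqP; split => [_ [r /= + [w /= w1 <-]]|x /= /andP[x0 x1]].
      rewrite in_itv/= => /andP[r0 r1].
      by rewrite /B/= enormZ ?(ltW r0)// w1 mulr1 r0.
    exists (enorm x); first by rewrite in_itv/= x0.
    exists ((enorm x)^-1 *: x); first by rewrite enormZ ?invr_ge0 ?enorm_ge0// mulVf ?gt_eqF.
    by rewrite scalerA divff ?gt_eqF// scale1r.
  rewrite -[lebesgue_measure_rV _ _]/(lebn n.+1 B) cB fineM// -{1}(fineK cfin).
  by congr (_%:E); rewrite /= mulrCA divff ?mulr1.
split; last by rewrite -cE.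
rewrite -lte_fin -cE lt_neqAle c0 andbT; apply/eqP => c00.
have := hc' (cst 1%E) (measurable_cst _) (fun=> lee01).
rewrite -c00 mul0e integral_cst// mul1e => h.
have mC : measurable (@cube R n.+1 1) by exact: measurable_cube.
have : lebn n.+1 (cube 1) = 0%E :> \bar R.
  by apply: (subset_measure0 (B := setT)).
by rewrite lebn_cube// => -[] /eqP; rewrite gt_eqF// exprn_gt0// mulr1.
Qed.

End radial.

Section positive_integral.
Context {R : realType}.
Local Notation leb := (@lebesgue_measure R).

Lemma integral_gt0 (D : set R) (f : R -> R) : measurable D ->
  measurable_fun D f -> (forall x, D x -> 0 < f x) -> (0 < leb D)%E ->
  (0 < \int[leb]_(x in D) (f x)%:E)%E.
Proof.
move=> mD mf f0 D0; rewrite lt_neqAle; apply/andP; split; last first.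
  by apply: integral_ge0 => x /f0 x0; rewrite lee_fin ltW.
apply/eqP => I0.
have mfE : measurable_fun D (EFin \o f) by exact/measurable_EFinP.
have [+ _] := ae_eq_integral_abs leb mD mfE.
have -> : (\int[leb]_(x in D) `|(EFin \o f) x| = \int[leb]_(x in D) (f x)%:E)%E.
  apply: eq_integral => x /set_mem /f0 x0.
  by rewrite /= gtr0_norm.
move=> /(_ (esym I0)) [N [mN N0 DN]].
have : (leb D <= leb N)%E.
  apply: le_measure; rewrite ?inE// => x Dx; apply: DN => /= /(_ Dx) [] fx0.
  by have := f0 x Dx; rewrite fx0 ltxx.
by move=> h; move: D0; rewrite ltNge (le_trans h)// N0.
Qed.

Lemma lebesgue_measure_pos : (0 < leb `]0%R, +oo[%classic)%E.
Proof. by rewrite lebesgue_measure_itv/= ltry sube0 ltry. Qed.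

End positive_integral.

(** * The Gamma function and Gaussian integrals *)

Section gamma.
Context {R : realType}.
Local Notation leb := (@lebesgue_measure R).
Local Notation pos := (`]0, +oo[%classic : set R).

Lemma ge0_integral_powR (g : R -> \bar R) (a : R) : 0 < a ->
  measurable_fun setT g -> (forall x, 0 <= g x)%E ->
  (\int[leb]_(s in `]0%R, +oo[) g s =
   \int[leb]_(r in `]0%R, +oo[) ((a * r `^ (a - 1))%:E * g (r `^ a)%R))%E.
Proof.
move=> a0 mg g0.
apply: (@ge0_integral_substitution _ (fun r => r `^ a) (fun s => s `^ a^-1) (fun r => a * r `^ (a - 1))) => //.
- by move=> x x0; rewrite powR_gt0.
- by move=> x x0; rewrite powR_gt0.
- by move=> x x0; rewrite powRVK ?gt_eqF// ltW.
- by move=> x y x0 xy; apply: gt0_ltr_powR; rewrite ?nnegrE ?(ltW x0)// (le_trans _ (ltW xy))// ltW.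
- move=> x x0; apply: continuousM; first exact: cvg_cst.
  apply: differentiable_continuous.
  by apply/derivable1_diffP; have := is_derive1_powR (a - 1) x0; case.
- by move=> x x0; rewrite mulr_ge0 ?powR_ge0// ltW.
Qed.

Lemma ge0_integral_scale (g : R -> \bar R) (c : R) : 0 < c ->
  measurable_fun setT g -> (forall x, 0 <= g x)%E ->
  (\int[leb]_(s in `]0%R, +oo[) g s =
   c%:E * \int[leb]_(r in `]0%R, +oo[) g (c * r)%R)%E.
Proof.
move=> c0 mg g0; rewrite !integral_posE (@ge0_integral_affine _ _ c 0) ?gt_eqF//; last 2 first.
- by meas.
- by move=> x; case: ifPn.
rewrite gtr0_norm//; congr (_ * _)%E; apply: eq_integral => x _.
by rewrite addr0 pmulr_rgt0.
Qed.

(** The majorant for [GammaE_lty]; the inversion s -> 1/s carries its tail to the unit interval. *)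
Lemma integral_tail (c : R) : 0 <= c ->
  (\int[leb]_(s in `]0%R, +oo[) ((if (s <= 1)%R then 1 else 0)%R%:E +
     c%:E * (if (1 < s)%R then s^-1 ^+ 2 else 0)%R%:E) < +oo)%E.
Proof.
move=> c0.
have unit : (\int[leb]_(s in `]0%R, +oo[) (if (s <= 1)%R then 1 else 0)%R%:E = 1)%E.
  have := @integral_pow01 R 0; rewrite invr1 => <-.
  apply: eq_integral => s; rewrite in_pos => s0.
  by rewrite s0 expr0 mul1e/=; case: ifPn.
have tail : (\int[leb]_(s in `]0%R, +oo[) (if (1 < s)%R then s^-1 ^+ 2 else 0)%R%:E <= 1)%E.
  rewrite -unit ge0_integral_inversion; [|by meas|]; last first.
    by move=> y; rewrite lee_fin; case: ifPn => // _; exact: sqr_ge0.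
  apply: ge0_le_integral => //.
  - by move=> x _; rewrite mule_ge0// lee_fin ?sqr_ge0//; case: ifPn => // _; exact: sqr_ge0.
  - by apply: measurable_funTS; meas.
  - by apply: measurable_funTS; meas.
  - move=> x; rewrite /= in_itv/= andbT => x0; rewrite -EFinM lee_fin.
    rewrite invf_gt1//; case: ltP => x1; last by rewrite mulr0; case: ifPn.
    by rewrite (ltW x1) invrK -exprMn mulVf ?expr1n// gt_eqF.
rewrite ge0_integralD//; last 4 first.
- by move=> x _; rewrite lee_fin; case: ifPn.
- by apply: measurable_funTS; meas.
- by move=> x _; rewrite mule_ge0// lee_fin//; case: ifPn => // _; exact: sqr_ge0.
- by apply: measurable_funTS; meas.
rewrite unit ge0_integralZl//; last 2 first.
- by apply: measurable_funTS; meas.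
- by move=> x _; rewrite lee_fin; case: ifPn => // _; exact: sqr_ge0.
apply: (@le_lt_trans _ _ (1 + c%:E * 1)%E); last by rewrite mule1 -EFinD ltry.
by rewrite leeD2l// lee_wpmul2l.
Qed.

(** The Gamma integral in the extended reals, where Tonelli's theorem applies; [GammaE_fin] leads
    back to [Gamma]. *)
Definition GammaE (a : R) : \bar R :=
  (\int[leb]_(t in `]0%R, +oo[) (t `^ (a - 1) * expR (- t))%:E)%E.

Lemma meas_Gamma (a : R) : measurable_fun setT (fun t : R => t `^ (a - 1) * expR (- t)).
Proof. by meas. Qed.

Lemma GammaE_gt0 (a : R) : (0 < GammaE a)%E.
Proof.
apply: integral_gt0 => //; first exact: measurable_funTS (meas_Gamma a).
  by move=> x; rewrite /= in_itv/= andbT => x0; rewrite mulr_gt0 ?powR_gt0 ?expR_gt0.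
exact: lebesgue_measure_pos.
Qed.

(** The substitution s = t^a removes the singularity at 0: a Gamma(a) is the integral of
    exp(-s^(1/a)). *)
Lemma GammaE_lty (a : R) : 0 < a -> (GammaE a < +oo)%E.
Proof.
move=> a0; have a00 : a != 0 by rewrite gt_eqF.
have E : (a%:E * GammaE a = \int[leb]_(s in `]0%R, +oo[) (expR (- s `^ a^-1))%:E)%E.
  rewrite (ge0_integral_powR a0)//; last by meas.
  rewrite -ge0_integralZl//; last 3 first.
  - exact: measurable_funTS (meas_EFin (meas_Gamma a)).
  - by move=> x _; rewrite lee_fin mulr_ge0 ?powR_ge0 ?expR_ge0.
  - by rewrite lee_fin ltW.
  apply: eq_integral => r; rewrite in_pos => r0.
  by rewrite -!EFinM powRK// ?(ltW r0)// mulrA.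
suff : (a%:E * GammaE a < +oo)%E.
  have := GammaE_gt0 a; move: (GammaE a) => [r _ _|_|//]; first by rewrite ltry.
  by rewrite gt0_muley ?lte_fin// ltxx.
(* Since n >= 2 a, the power s^((n+1)/a) is at least s^2 for s >= 1, so one term of the exponential
   series gives the decay (n+1)! / s^2. *)
rewrite E; pose n := Num.bound (2 * a).
have c0 : (0 : R) <= n.+1`!%:R by [].
apply: le_lt_trans (integral_tail c0); apply: ge0_le_integral => //.
- by apply: measurable_funTS; meas.
- by apply: measurable_funTS; meas.
move=> s; rewrite /= in_itv/= andbT => s0.
rewrite -EFinM -EFinD lee_fin; have [s1|s1] := leP s 1.
  by rewrite mulr0 addr0 expR_le1 oppr_le0 powR_ge0.
rewrite add0r expRN -[_ * _]invrK lef_pV2 ?posrE ?expR_gt0 ?invr_gt0//; last first.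
  by rewrite mulr_gt0 ?ltr0n ?fact_gt0// exprn_gt0// invr_gt0.
have h := @expR_ge1Dxn R _ n (powR_ge0 s a^-1).
apply: (@le_trans _ _ (s `^ a^-1 ^+ n.+1 / n.+1`!%:R)); last by lra.
rewrite invfM mulrC ler_pM2r ?invr_gt0 ?ltr0n ?fact_gt0//.
rewrite -exprVn invrK -[leRHS]powR_mulrn ?powR_ge0// -powRrM -powR_mulrn ?(ltW s0)//.
apply: ler_powR; first exact: ltW.
rewrite mulrC ler_pdivlMr//; apply: le_trans (ltW (archi_boundP _)) _; first by rewrite mulr_ge0// ltW.
by rewrite ler_nat.
Qed.

Lemma integral_gauss (t : R) : 0 < t ->
  (\int[leb]_x (expR (- (t * x ^+ 2)))%:E = ((pi / t) `^ 2^-1)%:E)%E.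
Proof.
move=> t0; have st0 : 0 < Num.sqrt t by rewrite sqrtr_gt0.
have mg : measurable_fun [set: R] (fun x : R => (gauss_fun x)%:E).
  by apply: meas_EFin; exact: measurable_gauss_fun.
have := @integralT_gauss R.
rewrite (@ge0_integral_affine R _ (Num.sqrt t) 0)//; last 2 first.
- by rewrite gt_eqF.
- by move=> x; rewrite lee_fin gauss_fun_ge0.
rewrite gtr0_norm//.
have -> : (\int[leb]_x (gauss_fun (Num.sqrt t * x + 0)%R)%:E = \int[leb]_x (expR (- (t * x ^+ 2)))%:E)%E.
  apply: eq_integral => x _; rewrite /gauss_fun addr0 exprMn sqr_sqrtr ?ltW//.
move=> h.
have {h} h : (((Num.sqrt t)^-1)%:E * ((Num.sqrt t)%:E * \int[leb]_x (expR (- (t * x ^+ 2)))%:E) =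
   ((Num.sqrt t)^-1)%:E * (Num.sqrt pi)%:E)%E by rewrite h.
rewrite muleA -EFinM mulVf ?gt_eqF// mul1e in h.
rewrite h -EFinM powR12_sqrt ?divr_ge0 ?pi_ge0 ?(ltW t0)//.
by rewrite sqrtrM ?pi_ge0// sqrtrV ?(ltW t0)// mulrC.
Qed.

Lemma integral_gauss_rV n (t : R) : 0 < t ->
  (\int[lebn n]_x (expR (- (t * enorm x ^+ 2)))%:E = ((pi / t) `^ (n%:R / 2))%:E)%E.
Proof.
move=> t0; elim: n => [|n IH].
  by rewrite integral_dirac// ?diracT ?mul1e; [rewrite enorm_rV0 expr0n/= mulr0 oppr0 expR0 mul0r powRr0|meas].
rewrite integral_lebnS; [|by meas|by move=> x; rewrite lee_fin expR_ge0].
have -> : (n.+1%:R / 2 = 2^-1 + n%:R / 2 :> R) by rewrite -natr1; field.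
rewrite powRD; last by apply/implyP => _; rewrite gt_eqF// divr_gt0// pi_gt0.
rewrite EFinM -IH -integral_gauss// muleC -ge0_integralZl//; last 2 first.
- by apply: measurable_funTS; meas.
- by apply: integral_ge0 => x _; rewrite lee_fin expR_ge0.
apply: eq_integral => s _; rewrite muleC -ge0_integralZl//; last by meas.
apply: eq_integral => x _; rewrite -EFinM -expRD enorm_cons sqr_sqrtr ?addr_ge0 ?sqr_ge0//.
by congr (expR _)%:E; ring.
Qed.

Lemma GammaE_scale (a B : R) : 0 < B ->
  (\int[leb]_(t in `]0%R, +oo[) (t `^ (a - 1) * expR (- (t * B)))%:E = (B `^ (- a))%:E * GammaE a)%E.
Proof.
move=> B0; rewrite /GammaE [in RHS](ge0_integral_scale B0)//; last 2 first.
- by meas.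
- by move=> x; rewrite lee_fin mulr_ge0 ?powR_ge0 ?expR_ge0.
rewrite muleA -EFinM -ge0_integralZl//; last 3 first.
- by apply: measurable_funTS; meas.
- by move=> x _; rewrite lee_fin mulr_ge0 ?powR_ge0 ?expR_ge0.
- by rewrite lee_fin mulr_ge0 ?powR_ge0// ltW.
apply: eq_integral => t; rewrite in_pos => t0.
rewrite -EFinM; congr (_%:E).
have e : B `^ (- a) * B * B `^ (a - 1) = 1.
  rewrite -{2}(powRr1 (ltW B0)) -!powRD ?(gt_eqF B0) ?implybT//.
  by rewrite (_ : - a + 1 + (a - 1) = 0) ?powRr0//; ring.
rewrite powRM ?(ltW B0) ?(ltW t0)// [t * B]mulrC.
transitivity (B `^ (- a) * B * B `^ (a - 1) * (t `^ (a - 1) * expR (- (B * t)))).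
  by rewrite e mul1r.
by ring.
Qed.

(* Integrate [t ^ (n / 2 + b - 1) exp (- t (B + |z| ^ 2))] over [t] and [z]. *)
Lemma GammaE_integral n (b B : R) : 0 < b -> 0 < B ->
  (GammaE (n%:R / 2 + b)%R * \int[lebn n]_z ((B + enorm z ^+ 2) `^ (- (n%:R / 2 + b)))%:E =
   (pi `^ (n%:R / 2))%:E * ((B `^ (- b))%:E * GammaE b))%E.
Proof.
move=> b0 B0.
pose a := n%:R / 2 + b.
pose h (z : 'rV[R]_n) (t : R) := ((if (0 < t)%R then t `^ (a - 1) * expR (- (t * (B + enorm z ^+ 2))) else 0)%:E : \bar R).
have mh : measurable_fun setT (fun z => h z.1 z.2) by rewrite /h; meas.
have h0 z t : (0 <= h z t)%E.
  by rewrite lee_fin; case: ifPn => // _; rewrite mulr_ge0 ?powR_ge0 ?expR_ge0.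
transitivity (\int[lebn n]_z \int[leb]_t h z t)%E.
  rewrite -ge0_integralZl//; last 3 first.
  - by meas.
  - by move=> z _; rewrite lee_fin powR_ge0.
  - by rewrite ltW// GammaE_gt0.
  apply: eq_integral => z _; rewrite muleC -GammaE_scale; last by rewrite ltr_wpDr ?sqr_ge0.
  by rewrite integral_posE; apply: eq_integral => t _; rewrite /h; case: ifPn.
rewrite (tonelli_swap (lebn n) leb mh h0) -GammaE_scale// integral_posE.
rewrite -ge0_integralZl//; last 3 first.
- by meas.
- by move=> t _; case: ifPn => // _; rewrite lee_fin mulr_ge0 ?powR_ge0 ?expR_ge0.
- by rewrite lee_fin powR_ge0.
apply: eq_integral => t _; rewrite /h; case: ifPn => [t0|_]; last by rewrite integral0 mule0.
transitivity (\int[lebn n]_x ((t `^ (a - 1) * expR (- (t * B)))%:E * (expR (- (t * enorm x ^+ 2)))%:E))%E.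
  apply: eq_integral => x _; rewrite -EFinM -mulrA -expRD.
  by congr (_ * expR _)%:E; ring.
rewrite ge0_integralZl//; last 2 first.
- by meas.
- by rewrite lee_fin mulr_ge0 ?powR_ge0 ?expR_ge0.
rewrite integral_gauss_rV// -!EFinM; congr (_%:E).
rewrite powRM ?pi_ge0 ?invr_ge0 ?(ltW t0)// -[t^-1]powR_inv1 ?(ltW t0)// -powRrM mulN1r.
rewrite mulrCA; congr (_ * _); rewrite mulrAC -powRD ?(gt_eqF t0) ?implybT//.
by congr (_ `^ _ * _); rewrite /a; ring.
Qed.

End gamma.

(** * The inner integral and the Hardy constant *)

Section inner_integral.
Context {R : realType}.
Local Notation leb := (@lebesgue_measure R).

(** The part beyond 1 is folded onto (0, 1) by r -> 1/r; h 1 = 0 makes the splitting exact at every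
    point. *)
Lemma integral_split1 (h : R -> \bar R) : measurable_fun setT h ->
  (forall x, 0 <= h x)%E -> h 1 = 0%E ->
  (\int[leb]_(r in `]0%R, +oo[) h r =
   \int[leb]_(r in `]0%R, 1%R[) (h r + (r^-1 ^+ 2)%:E * h (r^-1)%R))%E.
Proof.
move=> mh h0 h1.
have hl r : (0 <= if (r < 1)%R then h r else 0)%E by case: ifPn.
have hg r : (0 <= if (1 < r)%R then h r else 0)%E by case: ifPn.
have ml : measurable_fun setT (fun r : R => if r < 1 then h r else 0%E) by meas.
have mg : measurable_fun setT (fun r : R => if 1 < r then h r else 0%E) by meas.
transitivity (\int[leb]_(r in `]0%R, +oo[) ((if (r < 1)%R then h r else 0) + (if (1 < r)%R then h r else 0)))%E.
  apply: eq_integral => r _; case: ltgtP => [_|_|->]; rewrite ?adde0 ?add0e//.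
rewrite ge0_integralD//; [|exact: measurable_funTS|exact: measurable_funTS].
rewrite [X in (_ + X)%E = _]ge0_integral_inversion//.
rewrite -ge0_integralD//; last 3 first.
- exact: measurable_funTS.
- by move=> r _; rewrite mule_ge0// lee_fin sqr_ge0.
- by apply: measurable_funTS; meas.
rewrite integral_mkcond [RHS]integral_mkcond; apply: eq_integral => r _; rewrite !patchE in_pos.
have -> : (r \in `]0, 1[%classic) = (0 < r < 1) by apply/idP/idP; rewrite inE/= in_itv.
have [r0|//] := ltP 0 r; rewrite invf_gt1//=.
by case: ifPn => // _; rewrite mule0 adde0.
Qed.

Lemma pnorm_row_mx k m (a : 'rV[R]_k) (b : 'rV[R]_m) : pnorm k (row_mx a b) = enorm a.
Proof.
rewrite /pnorm /enorm big_split_ord/=.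
rewrite [X in _ + X]big1 ?addr0; last first.
  by move=> i; rewrite /= ltnNge leq_addr.
congr (Num.sqrt _); apply: eq_big => i; first by rewrite ltn_ord.
by rewrite row_mxEl.
Qed.

Lemma enorm_sqr n (x : 'rV[R]_n) : enorm x ^+ 2 = \sum_i x ord0 i ^+ 2.
Proof. by rewrite sqr_sqrtr// sumr_ge0// => i _; exact: sqr_ge0. Qed.

Lemma enorm_row_mx k m (a : 'rV[R]_k) (b : 'rV[R]_m) :
  enorm (row_mx a b) ^+ 2 = enorm a ^+ 2 + enorm b ^+ 2.
Proof.
rewrite !enorm_sqr big_split_ord/=; congr (_ + _); apply: eq_bigr => i _.
  by rewrite row_mxEl.
by rewrite row_mxEr.
Qed.

Lemma enormN n (x : 'rV[R]_n) : enorm (- x) = enorm x.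
Proof. by rewrite /enorm; congr Num.sqrt; apply: eq_bigr => i _; rewrite mxE sqrrN. Qed.

Lemma enorm_sub_sqr n (x y : 'rV[R]_n) :
  enorm (x - y) ^+ 2 = enorm x ^+ 2 - 2 * dot x y + enorm y ^+ 2.
Proof.
rewrite !enorm_sqr /dot mulr_sumr -sumrN -!big_split/=.
by apply: eq_bigr => i _; rewrite !mxE; ring.
Qed.

Lemma enorm_eq0 n (x : 'rV[R]_n) : enorm x = 0 -> x = 0.
Proof.
move=> x0; apply/rowP => i; have := le_enorm x i; rewrite x0 mxE normr_le0.
by move/eqP.
Qed.

Lemma powR_enorm n (x : 'rV[R]_n) e : enorm x `^ e = (enorm x ^+ 2) `^ (e / 2).
Proof. by rewrite -powR_mulrn ?enorm_ge0// -powRrM mulrCA divff ?mulr1 ?pnatr_eq0. Qed.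

Lemma GammaE_fin (a : R) : 0 < a -> GammaE a = (Gamma a)%:E.
Proof.
move=> a0; rewrite [RHS]fineK// ge0_fin_numE ?GammaE_lty// ltW//; exact: GammaE_gt0.
Qed.

Lemma Gamma_gt0 (a : R) : 0 < a -> 0 < Gamma a.
Proof. by move=> a0; rewrite -lte_fin -GammaE_fin// GammaE_gt0. Qed.

(** The integral of (1 + |z|^2)^(-(k+m+sg)/2) over R^m: the case B = 1 of [integral_fiber]. *)
Definition dim_const (k m : nat) (sg : R) : R :=
  pi `^ (m%:R / 2) * Gamma ((k%:R + sg) / 2) / Gamma (((k + m)%:R + sg) / 2).

Lemma dim_const_gt0 k m sg : 0 < k%:R + sg -> 0 < dim_const k m sg.
Proof.
move=> h; rewrite /dim_const divr_gt0 ?mulr_gt0 ?powR_gt0 ?pi_gt0 ?Gamma_gt0 ?divr_gt0//.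
by rewrite natrD addrAC ltr_wpDr.
Qed.

Lemma integral_fiber k m sg (B : R) : 0 < k%:R + sg -> 0 < B ->
  (\int[lebn m]_z ((B + enorm z ^+ 2) `^ (- (((k + m)%:R + sg) / 2)))%:E =
   (dim_const k m sg * B `^ (- ((k%:R + sg) / 2)))%:E)%E.
Proof.
move=> ks B0; have b0 : 0 < (k%:R + sg) / 2 by rewrite divr_gt0.
have e : ((k + m)%:R + sg) / 2 = m%:R / 2 + (k%:R + sg) / 2.
  by rewrite natrD; field.
have a0 : 0 < ((k + m)%:R + sg) / 2 by rewrite e ltr_wpDl// divr_ge0.
have := @GammaE_integral R m _ B b0 B0; rewrite -e !GammaE_fin// => h.
have G0 := Gamma_gt0 a0.
have := congr1 (fun z => ((Gamma (((k + m)%:R + sg) / 2))^-1)%:E * z)%E h.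
rewrite muleA -EFinM mulVf ?gt_eqF// mul1e => ->.
rewrite -!EFinM; apply: (congr1 EFin); rewrite /dim_const.
move: (B `^ _) (Gamma ((k%:R + sg) / 2)) (Gamma _)^-1 (pi `^ _) => w x y z.
by ring.
Qed.

(** Each fibre is integrated by [integral_fiber] with B = |x_k - a|^2. B = 0 occurs only at a = x_k,
    where the condition g (pnorm k x) = 0 makes the integrand vanish. *)
Lemma integral_drop_coords k m sg (x : 'rV[R]_(k + m)) (g : R -> R) :
  0 < k%:R + sg -> measurable_fun setT g -> (forall r, 0 <= g r) ->
  g (pnorm k x) = 0 ->
  (\int[lebn (k + m)]_y (g (pnorm k y) / enorm (x - y) `^ ((k + m)%:R + sg))%:E =
   (dim_const k m sg)%:E *
   \int[lebn k]_a (g (enorm a) / enorm (lsubmx x - a) `^ (k%:R + sg))%:E)%E.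
Proof.
move=> ks mg g0; set x1 := lsubmx x; set x2 := rsubmx x.
have xE : x = row_mx x1 x2 by rewrite hsubmxK.
rewrite {1}xE pnorm_row_mx => gx.
rewrite ge0_integral_lebn_split//; last 2 first.
- by meas.
- by move=> y; rewrite lee_fin divr_ge0 ?powR_ge0.
rewrite -ge0_integralZl//; last 3 first.
- by meas.
- by move=> y _; rewrite lee_fin divr_ge0 ?powR_ge0.
- by rewrite lee_fin ltW// dim_const_gt0.
apply: eq_integral => a _; rewrite -EFinM.
under eq_integral do rewrite pnorm_row_mx.
have [->|ga] := eqVneq (g (enorm a)) 0.
  by rewrite mul0r mulr0 integral0_eq// => b _; rewrite mul0r.
have B0 : 0 < enorm (x1 - a) ^+ 2.
  rewrite exprn_gt0// lt_neqAle enorm_ge0 andbT; apply/eqP => /esym/enorm_eq0/eqP.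
  rewrite subr_eq0 => /eqP xa; move: ga; rewrite -xa gx eqxx.
  by [].
rewrite (@ge0_integral_lebn_shift _ _ _ x2)//; last 2 first.
- by meas.
- by move=> y; rewrite lee_fin divr_ge0 ?powR_ge0.
transitivity ((g (enorm a))%:E * \int[lebn m]_z ((enorm (x1 - a) ^+ 2 + enorm z ^+ 2) `^ (- (((k + m)%:R + sg) / 2)))%:E)%E.
  rewrite -ge0_integralZl//; last 3 first.
  - by meas.
  - by move=> y _; rewrite lee_fin powR_ge0.
  - by rewrite lee_fin.
  apply: eq_integral => b _; rewrite -EFinM; congr (_ * _)%:E.
  rewrite xE opp_row_mx add_row_mx powR_enorm enorm_row_mx opprD addrCA subrr addr0.
  by rewrite enormN powRN.
by rewrite integral_fiber// -EFinM powR_enorm powRN; congr (_%:E); ring.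
Qed.

End inner_integral.

(** * Integration of the kernel over spheres of R^k *)

Section sphere_kernel.
Context {R : realType}.
Local Notation leb := (@lebesgue_measure R).

(* The integral over the sphere |y| = r of R^k of |x - y|^(-(k+sg)), |x| = r0,
   divided by r^(k-1). *)
Definition sphere_kernel (k : nat) (sg r0 r : R) : \bar R :=
  if k == 1%N then (`|r0 - r| `^ (- (1 + sg)) + `|r0 + r| `^ (- (1 + sg)))%:E
  else ((@sphere_area R k.-1)%:E *
    \int[leb]_(t in `](-1)%R, 1%R[)
      ((1 - t ^+ 2) `^ ((k%:R - 3) / 2) /
       (r0 ^+ 2 - 2 * t * (r0 * r) + r ^+ 2) `^ ((k%:R + sg) / 2))%:E)%E.

Lemma sphere_area_ge0 k : (1 < k)%N -> 0 <= @sphere_area R k.-1.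
Proof.
by case: k => [|[|k]]// _; have [+ _] := @sphere_area_radial R k; exact: ltW.
Qed.

Lemma sphere_kernel_ge0 k sg r0 r : (0 < k)%N -> (0 <= sphere_kernel k sg r0 r)%E.
Proof.
move=> k0; rewrite /sphere_kernel; case: eqP => [_|k1].
  by rewrite lee_fin addr_ge0 ?powR_ge0.
rewrite mule_ge0 ?lee_fin ?sphere_area_ge0//; first by case: k k0 k1 => [|[|]].
by apply: integral_ge0 => t _; rewrite lee_fin divr_ge0 ?powR_ge0.
Qed.

Lemma meas_sphere_kernel k sg r0 : measurable_fun setT (sphere_kernel k sg r0).
Proof.
rewrite /sphere_kernel; case: eqP => _; first by meas.
apply: emeasurable_funM => //.
under eq_fun do rewrite integral_sym1E.
apply: (@meas_integral2 _ _ R _ _ leb (fun r t => if `|t| < 1 then ((1 - t ^+ 2) `^ ((k%:R - 3) / 2) /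
       (r0 ^+ 2 - 2 * t * (r0 * r) + r ^+ 2) `^ ((k%:R + sg) / 2))%:E else 0%E)).
  by meas.
by move=> x y; case: ifPn => // _; rewrite lee_fin divr_ge0 ?powR_ge0.
Qed.

Lemma sphere_kernelC k sg r0 r : sphere_kernel k sg r0 r = sphere_kernel k sg r r0.
Proof.
rewrite /sphere_kernel; case: eqP => _; first by rewrite distrC [r0 + r]addrC.
apply: (congr1 (mule _)); apply: eq_integral => t _.
suff -> : r0 ^+ 2 - 2 * t * (r0 * r) + r ^+ 2 = r ^+ 2 - 2 * t * (r * r0) + r0 ^+ 2 by [].
by rewrite [r0 * r]mulrC addrAC [RHS]addrAC [r0 ^+ 2 + _]addrC.
Qed.

Lemma sphere_kernel_scale k sg r0 r : 0 < r0 ->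
  sphere_kernel k sg r0 (r0 * r) = ((r0 `^ (- (k%:R + sg)))%:E * sphere_kernel k sg 1 r)%E.
Proof.
move=> r00; rewrite /sphere_kernel; case: eqP => [->|_].
  have -> : r0 - r0 * r = r0 * (1 - r) by ring.
  have -> : r0 + r0 * r = r0 * (1 + r) by ring.
  by rewrite !normrM !powRM// gtr0_norm// -mulrDr EFinM.
rewrite muleCA; congr (_ * _)%E; rewrite -ge0_integralZl//; last 3 first.
- by apply: measurable_funTS; meas.
- by move=> t _; rewrite lee_fin divr_ge0 ?powR_ge0.
- by rewrite lee_fin powR_ge0.
apply: eq_integral => t; rewrite inE/= in_itv/= => /andP[t1 t2].
rewrite -EFinM; congr (_%:E).
have -> : r0 ^+ 2 - 2 * t * (r0 * (r0 * r)) + (r0 * r) ^+ 2 =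
  r0 ^+ 2 * (1 ^+ 2 - 2 * t * (1 * r) + r ^+ 2) by ring.
rewrite powRM ?sqr_ge0//; last by have := sqr_ge0 (r - t); nra.
have -> : (r0 ^+ 2) `^ ((k%:R + sg) / 2) = r0 `^ (k%:R + sg).
  rewrite -powR_mulrn ?(ltW r00)// -powRrM.
  by rewrite mulrCA divff ?mulr1 ?pnatr_eq0.
by rewrite powRN invfM; ring.
Qed.

Lemma sphere_kernel_inv k sg r : 0 < r ->
  sphere_kernel k sg 1 r^-1 = ((r `^ (k%:R + sg))%:E * sphere_kernel k sg 1 r)%E.
Proof.
move=> r0; rewrite sphere_kernelC.
have -> : sphere_kernel k sg r^-1 1 = sphere_kernel k sg r^-1 (r^-1 * r).
  by rewrite mulVf ?gt_eqF.
rewrite sphere_kernel_scale ?invr_gt0//; congr (_%:E * _)%E.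
by rewrite -[r^-1]powR_inv1 ?(ltW r0)// -powRrM mulN1r opprK.
Qed.

End sphere_kernel.

Section sphere_integral.
Context {R : realType}.
Local Notation leb := (@lebesgue_measure R).

Lemma integral_sphere1 sg (x : 'rV[R]_1) (g : R -> R) :
  measurable_fun setT g -> (forall r, 0 <= g r) ->
  (\int[lebn 1]_a (g (enorm a) / enorm (x - a) `^ (1 + sg))%:E =
   \int[leb]_(r in `]0%R, +oo[) (g r * (`|enorm x - r| `^ (- (1 + sg)) + `|enorm x + r| `^ (- (1 + sg))))%:E)%E.
Proof.
move=> mg g0.
have ex (y : 'rV[R]_1) : enorm y = `|y ord0 ord0|.
  by rewrite enorm_row enorm_rV0 expr0n/= addr0 sqrtr_sqr.
have exB (a b : 'rV[R]_1) : (a - b) ord0 ord0 = a ord0 ord0 - b ord0 ord0 by rewrite !mxE.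
have e t : (cons_rV (0 : 'rV[R]_0, t)) ord0 ord0 = t by rewrite cons_rV0.
rewrite integral_lebn1; [|by meas|by move=> a; rewrite lee_fin divr_ge0 ?powR_ge0].
transitivity (\int[leb]_t (g `|t| / `|x ord0 ord0 - t| `^ (1 + sg))%:E)%E.
  by apply: eq_integral => t _; rewrite !ex exB e.
rewrite ex; move: (x ord0 ord0) => X {x ex e}.
rewrite ge0_integral_halves; [|by meas|by move=> a; rewrite lee_fin divr_ge0 ?powR_ge0].
apply: eq_integral => r; rewrite in_pos => r0.
rewrite normrN gtr0_norm// opprK -!powRN -EFinD mulrDr.
have [x0|x0] := leP 0 X; first by rewrite (ger0_norm x0).
by rewrite (ltr0_norm x0) addrC -opprD normrN [- X + r]addrC distrC.
Qed.

Lemma meas_angular (v : R -> R) (F : R * R -> \bar R) (X : R) :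
  measurable_fun setT v -> measurable_fun setT F ->
  measurable_fun setT (fun z : R * R =>
    (if (`|z.2| < 1)%R then (v z.2)%:E * F (z.1, X * (z.1 * z.2))%R else 0)%E).
Proof. by move=> mv mF; meas. Qed.

Lemma integral_sphere_ge2 n sg (x : 'rV[R]_n.+2) (g : R -> R) (A : R) :
  0 <= A -> radial_const n.+1 A%:E ->
  measurable_fun setT g -> (forall r, 0 <= g r) ->
  (\int[lebn n.+2]_a (g (enorm a) / enorm (x - a) `^ (n.+2%:R + sg))%:E =
   \int[leb]_(r in `]0%R, +oo[) ((g r * r ^+ n.+1)%:E * (A%:E *
    \int[leb]_(t in `](-1)%R, 1%R[)
      ((1 - t ^+ 2) `^ ((n.+2%:R - 3) / 2) /
       (enorm x ^+ 2 - 2 * t * (enorm x * r) + r ^+ 2) `^ ((n.+2%:R + sg) / 2))%:E)))%E.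
Proof.
move=> a0 hc mg g0.
pose f (X : R) (z : R * R) := (g z.1 / Num.sqrt (X ^+ 2 - 2 * z.2 + z.1 ^+ 2) `^ (n.+2%:R + sg))%:E : \bar R.
have mf X : measurable_fun setT (f X) by rewrite /f; meas.
have f0 X z : (0 <= f X z)%E by rewrite lee_fin divr_ge0 ?powR_ge0.
transitivity (\int[lebn n.+2]_a f (enorm x) (enorm a, dot x a))%E.
  apply: eq_integral => a _; rewrite /f/= -enorm_sub_sqr sqrtr_sqr.
  by rewrite (ger0_norm (enorm_ge0 _)).
rewrite integral_rotation//; move: (enorm x) => X {x}.
have mf' : measurable_fun setT (fun z : R * R => f X (z.1, X * z.2)).
  have mX : measurable_fun setT (fun z : R * R => (z.1, X * z.2)) by meas.
  exact: (measurableT_comp (mf X) mX).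
have := integral_polar_const hc mf' (fun z => f0 X _) => /= ->.
have a0' : (0 <= A%:E :> \bar R)%E by rewrite lee_fin.
pose w (t : R) := (1 - t ^+ 2) `^ ((n%:R - 1) / 2).
have mw : measurable_fun setT w by rewrite /w; meas.
have w0 t : 0 <= w t by rewrite powR_ge0.
rewrite -[LHS]ge0_integralZl; last 4 first.
- exact: measurable_itv.
- apply: measurable_funTS; apply: meas_emul; first by meas.
  under eq_fun do rewrite integral_sym1E.
  apply: (@meas_integral2 _ _ R _ _ leb (fun r t => (if (`|t| < 1)%R then (w t)%:E * f X (r, X * (r * t))%R else 0)%E)).
    exact: meas_angular mw (mf X).
  by move=> u v; case: ifPn => // _; rewrite mule_ge0// lee_fin.
- move=> r; rewrite /= in_itv/= andbT => r0; rewrite mule_ge0 ?lee_fin ?exprn_ge0 ?(ltW r0)//.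
  by apply: integral_ge0 => t _; rewrite mule_ge0// lee_fin powR_ge0.
- exact: a0'.
apply: eq_integral => r; rewrite in_pos => r0.
rewrite muleCA.
have -> : (g r * r ^+ n.+1)%:E = ((r ^+ n.+1)%:E * (g r)%:E)%E by rewrite -EFinM mulrC.
rewrite -[RHS]muleA; congr (_ * _)%E.
rewrite [RHS]muleCA; congr (_ * _)%E.
rewrite -[RHS]ge0_integralZl; last 4 first.
- exact: measurable_itv.
- apply: measurable_funTS.
  by meas.
- by move=> t _; rewrite lee_fin divr_ge0 ?powR_ge0.
- by rewrite lee_fin.
apply: eq_integral => t; rewrite inE/= in_itv/= => /andP[t1 t2].
rewrite /f/= -!EFinM; congr (_%:E).
have v0 : 0 <= X ^+ 2 - 2 * (X * (r * t)) + r ^+ 2.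
  have t3 : 0 <= (1 + t) * (1 - t) by rewrite mulr_ge0//; lra.
  have := mulr_ge0 (sqr_ge0 X) t3; have := sqr_ge0 (r - X * t).
  by rewrite (_ : X ^+ 2 - 2 * (X * (r * t)) + r ^+ 2 = (r - X * t) ^+ 2 + X ^+ 2 * ((1 + t) * (1 - t))); [exact: addr_ge0|ring].
rewrite -powR12_sqrt// -powRrM [2^-1 * _]mulrC.
have -> : n.+2%:R - 3 = n%:R - 1 :> R by rewrite -natr1 -natr1; ring.
have -> : 2 * t * (X * r) = 2 * (X * (r * t)) by ring.
by rewrite [RHS]mulrCA.
Qed.

Lemma integral_sphere k sg (x : 'rV[R]_k) (g : R -> R) : (0 < k)%N ->
  measurable_fun setT g -> (forall r, 0 <= g r) ->
  (\int[lebn k]_a (g (enorm a) / enorm (x - a) `^ (k%:R + sg))%:E =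
   \int[leb]_(r in `]0%R, +oo[) ((g r * r ^+ k.-1)%:E * sphere_kernel k sg (enorm x) r))%E.
Proof.
case: k => [//|[|n]] in x * => _ mg g0.
  rewrite integral_sphere1//; apply: eq_integral => r _.
  by rewrite expr0 mulr1 /sphere_kernel/= -EFinM.
have [A0 hc] := @sphere_area_radial R n.
rewrite (integral_sphere_ge2 sg x (ltW A0) hc mg g0).
by apply: eq_integral => r _.
Qed.

End sphere_integral.

Section sphere_kernel_unit.
Context {R : realType}.
Local Notation leb := (@lebesgue_measure R).

(** The polar constant of dimension n + 2 is the finite number B and also A > 0 times this integral.
    This stands in for an estimate of the singularities at t = 1 and t = -1. *)
Lemma radial_weight_lty n (A B : R) : 0 < A -> 0 < B ->
  radial_const n.+1 A%:E -> radial_const n.+2 B%:E ->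
  (\int[leb]_(t in `](-1)%R, 1%R[) ((1 - t ^+ 2) `^ ((n%:R - 1) / 2))%:E < +oo)%E.
Proof.
move=> A0 B0 hc [_ hc2].
have [_ hS] := radial_constS hc.
have m1 : measurable_fun [set: R] (fun r : R => if (0 < r <= 1)%R then 1%E else 0%E : \bar R) by meas.
have p1 (u : R) : (0 <= (if (0 < u <= 1)%R then 1 else 0 : \bar R))%E by case: ifPn.
have := hS _ m1 p1; rewrite (hc2 _ m1 p1) /= integral_pow01.
set I := (\int[leb]_(t in _) _)%E => h.
have I0 : (0 <= I)%E by apply: integral_ge0 => t _; rewrite lee_fin powR_ge0.
move: (I) h I0 => {I}; case => [u _ _|h _|]//; first by rewrite ltry.
by move: h; rewrite gt0_muley ?lte_fin// gt0_mulye ?lte_fin ?invr_gt0// -EFinM.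
Qed.

Lemma angular_integral_lty (a e r : R) : 0 < r < 1 -> 0 <= e ->
  (\int[leb]_(t in `](-1)%R, 1%R[) ((1 - t ^+ 2) `^ a)%:E < +oo)%E ->
  (\int[leb]_(t in `](-1)%R, 1%R[)
    ((1 - t ^+ 2) `^ a / (1 ^+ 2 - 2 * t * (1 * r) + r ^+ 2) `^ e)%:E < +oo)%E.
Proof.
move=> /andP[r0 r1] e0 h; pose c : R := (((1 - r) ^+ 2) `^ e)^-1.
have c0 : 0 <= c by rewrite invr_ge0 powR_ge0.
apply: le_lt_trans (lte_mul_pinfty (_ : (0 <= c%:E)%E) _ h); last 2 first.
- by clear h; rewrite lee_fin.
- by clear h.
clear h; rewrite -ge0_integralZl; last 4 first.
- exact: measurable_itv.
- by apply: measurable_funTS; meas.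
- by move=> t _; rewrite lee_fin powR_ge0.
- by rewrite lee_fin.
apply: ge0_le_integral; first exact: measurable_itv.
- by move=> t _; rewrite lee_fin divr_ge0 ?powR_ge0.
- by apply: measurable_funTS; meas.
- by apply: measurable_funTS; meas.
move=> t; rewrite /= in_itv/= => /andP[t1 t2]; rewrite -EFinM lee_fin.
rewrite mulrC; apply: ler_wpM2r; first exact: powR_ge0.
have h0 : 0 < (1 - r) ^+ 2 by rewrite exprn_gt0// subr_gt0.
have h1 : (1 - r) ^+ 2 <= 1 ^+ 2 - 2 * t * (1 * r) + r ^+ 2 by nra.
rewrite lef_pV2 ?posrE ?powR_gt0//; last exact: lt_le_trans h1.
by apply: ler_powR2r => //; exact: ltW.
Qed.

(** [Phi] takes the real part of its integral, so the identity rests on finiteness: for r < 1 the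
    denominator stays away from 0. *)
Lemma sphere_kernel_Phi k (s p r : R) : (0 < k)%N -> 0 <= k%:R + s * p -> 0 < r < 1 ->
  sphere_kernel k (s * p) 1 r = (Phi k s p r)%:E.
Proof.
move=> k0 ks r01; rewrite /sphere_kernel /Phi; case: eqP => [_|k1].
  have /andP[r0 r1] := r01.
  rewrite !ger0_norm ?subr_ge0 ?(ltW r1) ?addr_ge0 ?(ltW r0)//.
  by rewrite opprD.
case: k k0 k1 ks => [|[|n]]// _ _ ks.
pose w (t : R) := (1 - t ^+ 2) `^ ((n.+2%:R - 3) / 2) /
       (1 ^+ 2 - 2 * t * (1 * r) + r ^+ 2) `^ ((n.+2%:R + s * p) / 2).
have wE : (\int[leb]_(t in `](-1)%R, 1%R[) (w t)%:E = \int[leb]_(t in `[(-1)%R, 1%R])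
      ((1 - t ^+ 2) `^ ((n.+2%:R - 3) / 2) /
       (1 - 2 * t * r + r ^+ 2) `^ ((n.+2%:R + s * p) / 2))%:E)%E.
  rewrite [RHS]integral_itv_bndoo; last by apply: measurable_funTS; meas.
  by apply: eq_integral => t _; rewrite /w expr1n mul1r.
have wfin : (\int[leb]_(t in `](-1)%R, 1%R[) (w t)%:E < +oo)%E.
  apply: (angular_integral_lty r01); first by rewrite divr_ge0.
  have -> : n.+2%:R - 3 = n%:R - 1 :> R by rewrite -natr1 -natr1; ring.
  have [a10 hc] := @sphere_area_radial R n.
  have [a20 hc2] := @sphere_area_radial R n.+1.
  exact: radial_weight_lty a10 a20 hc hc2.
rewrite [RHS]EFinM; congr (_ * _)%E.
rewrite -[LHS]/(\int[leb]_(t in `](-1)%R, 1%R[) (w t)%:E)%E.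
rewrite [RHS]fineK; [exact: wE|rewrite -wE].
apply/fin_numPlt; rewrite wfin andbT.
apply: (@lt_le_trans _ _ 0%E); first by clear wE wfin; rewrite ltNyr.
by clear wE wfin; apply: integral_ge0 => t _; rewrite lee_fin divr_ge0 ?powR_ge0.
Qed.

End sphere_kernel_unit.

Section inner_formula.
Context {R : realType}.
Local Notation leb := (@lebesgue_measure R).

Lemma inner_integral k m s p (x : 'rV[R]_(k + m)) (g : R -> R) :
  (0 < k)%N -> 0 < k%:R + s * p -> measurable_fun setT g ->
  (forall r, 0 <= g r) -> 0 < pnorm k x -> g (pnorm k x) = 0 ->
  (\int[lebn (k + m)]_y (g (pnorm k y) / enorm (x - y) `^ ((k + m)%:R + s * p))%:E =
   (dim_const k m (s * p) * pnorm k x `^ (- (s * p)))%:E *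
   \int[leb]_(r in `]0%R, 1%R[)
     ((g (pnorm k x * r) * r ^+ k.-1 + g (pnorm k x / r) * r `^ (s * p - 1)) * Phi k s p r)%:E)%E.
Proof.
move=> k0 ks mg g0 x0 gx; rewrite integral_drop_coords//.
have ex : enorm (lsubmx x) = pnorm k x by rewrite -{2}(hsubmxK x) pnorm_row_mx.
rewrite integral_sphere// ex; set r0 := pnorm k x in x0 gx *.
have ks0 : 0 <= k%:R + s * p by exact: ltW.
have mK r1 := @meas_sphere_kernel R k (s * p) r1.
rewrite [in RHS]EFinM -[RHS]muleA; apply: (congr1 (mule _)).
pose h (r : R) := ((g r * `|r| ^+ k.-1)%:E * sphere_kernel k (s * p) r0 r)%E.
have mh : measurable_fun setT h by apply: meas_emul; [meas|exact: mK].
have h0 r : (0 <= h r)%E.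
  by rewrite mule_ge0 ?sphere_kernel_ge0// lee_fin mulr_ge0// exprn_ge0.
transitivity (\int[leb]_(r in `]0%R, +oo[) h r)%E.
  by apply: eq_integral => r; rewrite in_pos => rp; rewrite /h gtr0_norm.
rewrite (ge0_integral_scale x0 mh h0).
pose q (r : R) := ((g (r0 * r) * `|r| ^+ k.-1)%:E * sphere_kernel k (s * p) 1 r)%E.
have mq : measurable_fun setT q by apply: meas_emul; [meas|exact: mK].
have q0 r : (0 <= q r)%E.
  by rewrite mule_ge0 ?sphere_kernel_ge0// lee_fin mulr_ge0// exprn_ge0.
have hq r : h (r0 * r) = ((r0 ^+ k.-1 * r0 `^ (- (k%:R + s * p)))%:E * q r)%E.
  rewrite /h /q sphere_kernel_scale// normrM (gtr0_norm x0) exprMn !muleA -!EFinM.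
  by apply: (congr1 (fun z => z%:E * _)%E); ring.
under eq_integral do rewrite hq.
rewrite ge0_integralZl; last 4 first.
- exact: measurable_itv.
- exact: measurable_funTS.
- by move=> r _; exact: q0.
- by rewrite lee_fin mulr_ge0 ?powR_ge0 ?exprn_ge0 ?(ltW x0).
rewrite muleA -EFinM (_ : r0 * _ = r0 `^ (- (s * p))); last first.
  rewrite mulrA -exprS prednK// -powR_mulrn ?(ltW x0)// -powRD ?(gt_eqF x0) ?implybT//.
  by congr (_ `^ _); ring.
apply: (congr1 (mule _)); rewrite (integral_split1 mq q0); last by rewrite /q mulr1 gx mul0r mul0e.
apply: eq_integral => r; rewrite inE/= in_itv/= => r01; have /andP[rp r1] := r01.
rewrite /q sphere_kernel_inv// sphere_kernel_Phi// -!EFinM -EFinD.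
apply: (congr1 EFin); rewrite (gtr0_norm rp) gtr0_norm ?invr_gt0//.
rewrite [RHS]mulrDl; congr (_ + _).
(* The three factors come from the inversion, from the surface element at 1/r and from
   [sphere_kernel_inv]. *)
have <- : r^-1 ^+ 2 * r^-1 ^+ k.-1 * r `^ (k%:R + s * p) = r `^ (s * p - 1).
  rewrite -exprD exprVn -powR_mulrn ?(ltW rp)// -powRN.
  rewrite -powRD ?(gt_eqF rp) ?implybT//; congr (_ `^ _).
  by rewrite natrD -{2}(prednK k0) -natr1; ring.
move: (g _) (r^-1 ^+ 2) (r^-1 ^+ k.-1) (r `^ _) (Phi _ _ _ _) => a b c e f.
by ring.
Qed.

End inner_formula.

(** * Integrability of powers; finiteness and positivity of the Hardy constant *)

Section power_integrals.
Context {R : realType}.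
Local Notation leb := (@lebesgue_measure R).

(** In polar coordinates the substitution s = r^(k - tau) makes the integrand constant on a bounded
    interval. *)
Lemma integral_power_ball k (tau M : R) : (0 < k)%N -> tau < k%:R -> 0 < M ->
  (\int[lebn k]_y (if (enorm y < M)%R then enorm y `^ (- tau) else 0)%:E < +oo)%E.
Proof.
case: k => // k _ tk M0; have [A0 [_ hc]] := @sphere_area_radial R k.
pose g (r : R) := (if r < M then r `^ (- tau) else 0)%:E : \bar R.
have mg : measurable_fun setT g by rewrite /g; meas.
have g0 r : (0 <= g r)%E by rewrite lee_fin; case: ifPn => // _; exact: powR_ge0.
rewrite -[ltLHS]/(\int[lebn k.+1]_y g (enorm y))%E (hc g mg g0); clear hc.
apply: lte_mul_pinfty; [by rewrite lee_fin ltW|by []|clear A0].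
pose a := k.+1%:R - tau; have a0 : 0 < a by rewrite subr_gt0.
have aN : a^-1 != 0 by rewrite invr_eq0 gt_eqF.
pose h (s : R) := (if s < M `^ a then a^-1 else 0)%:E : \bar R.
have mh : measurable_fun setT h by rewrite /h; meas.
have h0 r : (0 <= h r)%E by rewrite lee_fin; case: ifPn => // _; rewrite invr_ge0 ltW.
have -> : (\int[leb]_(r in `]0%R, +oo[) ((r ^+ k.+1.-1)%:E * g r) =
    \int[leb]_(s in `]0%R, +oo[) h s)%E.
  rewrite (ge0_integral_powR a0 mh h0); apply: eq_integral => r; rewrite in_pos => r0.
  rewrite /g /h -!EFinM; apply: (congr1 EFin).
  rewrite (_ : (r `^ a < M `^ a) = (r < M)); last first.
    apply/idP/idP => [|h']; last by apply: gt0_ltr_powR; rewrite ?nnegrE ?(ltW r0) ?(ltW M0).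
    by apply: contraTT; rewrite -!leNgt => Mr; apply: ler_powR2r => //; exact: ltW.
  case: ifPn => _; last by rewrite !mulr0.
  rewrite mulrAC divff ?gt_eqF// mul1r -powR_mulrn ?(ltW r0)//.
  rewrite -powRD ?(gt_eqF r0) ?implybT//; congr (_ `^ _).
  by rewrite /a -natr1/=; ring.
have Ma0 : 0 < M `^ a by rewrite powR_gt0.
apply: (@le_lt_trans _ _ (\int[leb]_(s in `]0%R, (M `^ a)%R[) (a^-1)%:E)%E).
  rewrite integral_mkcond [leRHS]integral_mkcond; apply: ge0_le_integral => //.
  - by move=> x _; rewrite patchE; case: ifPn.
  - apply/(measurable_restrictT h (measurable_itv _)); exact: measurable_funTS.
  - by apply/(measurable_restrictT (fun=> a^-1%:E : \bar R) (measurable_itv _)); exact: measurable_cst.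
  move=> x _; rewrite !patchE; case: ifPn; rewrite in_pos; last first.
    by move=> _; case: ifPn => // _; rewrite lee_fin invr_ge0 ltW.
  rewrite /h => x0; case: ltP => xM; last by case: ifPn => // _; rewrite lee_fin invr_ge0 ltW.
  by rewrite mem_set//= in_itv/= x0.
rewrite integral_cst; last exact: measurable_itv.
apply: lte_mul_pinfty; rewrite ?lee_fin ?invr_ge0 ?(ltW a0)//.
have := @lebesgue_measure_itv R `]0, (M `^ a)[; rewrite /= lte_fin Ma0 -EFinB => h'.
by apply: le_lt_trans (ltry (M `^ a - 0)); rewrite -h'.
Qed.

Lemma exists_unit k : (0 < k)%N -> exists x : 'rV[R]_k, enorm x = 1.
Proof.
case: k => // k _; exists (cons_rV (0, 1)).
by rewrite enorm_cons (_ : enorm 0 = 0) ?expr0n/= ?addr0 ?expr1n ?sqrtr1//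
  /enorm big1 ?sqrtr0// => i _; rewrite mxE expr0n.
Qed.

Lemma dot_le n (x y : 'rV[R]_n) : dot x y <= enorm x * enorm y.
Proof.
have [x0|xN] := eqVneq (enorm x) 0.
  rewrite x0 mul0r (enorm_eq0 x0) /dot big1// => i _; by rewrite mxE mul0r.
have [y0|yN] := eqVneq (enorm y) 0.
  rewrite y0 mulr0 (enorm_eq0 y0) /dot big1// => i _; by rewrite mxE mulr0.
have x0 : 0 < enorm x by rewrite lt_neqAle eq_sym xN enorm_ge0.
have y0 : 0 < enorm y by rewrite lt_neqAle eq_sym yN enorm_ge0.
have := sqr_ge0 (enorm (enorm y *: x - enorm x *: y)).
rewrite enorm_sub_sqr !enormZ ?enorm_ge0//.
have -> : dot (enorm y *: x) (enorm x *: y) = enorm x * enorm y * dot x y.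
  by rewrite /dot mulr_sumr; apply: eq_bigr => i _; rewrite !mxE; ring.
move: (enorm x) (enorm y) (dot x y) x0 y0 => X Y d x0 y0 h.
rewrite -subr_ge0 -(pmulr_rge0 _ (mulr_gt0 x0 y0)).
by rewrite -(pmulr_rge0 _ (@ltr0n R 2)); apply: le_trans h _; rewrite le_eqVlt; apply/orP; left; apply/eqP; ring.
Qed.

Lemma enorm_triangle n (x y : 'rV[R]_n) : enorm x <= enorm (x - y) + enorm y.
Proof.
rewrite -(@ler_pXn2r _ 2)// ?nnegrE ?addr_ge0 ?enorm_ge0//.
have := enorm_sub_sqr (x - y) (- y); rewrite opprK subrK enormN => ->.
have -> : dot (x - y) (- y) = - dot (x - y) y.
  by rewrite /dot -sumrN; apply: eq_bigr => i _; rewrite [X in _ * X]mxE mulrN.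
have := dot_le (x - y) y.
by move: (dot _ _) (enorm _) (enorm y) => d a b h; nra.
Qed.

Lemma powR_band (e r c : R) : 1 <= c -> c^-1 <= r <= c -> r `^ e <= c `^ `|e|.
Proof.
move=> c1 /andP[r1 r2]; have c0 : 0 < c by exact: lt_le_trans c1.
have r0 : 0 < r by apply: lt_le_trans r1; rewrite invr_gt0.
have [e0|e0] := leP 0 e.
  by rewrite ger0_norm//; apply: ler_powR2r => //; exact: ltW.
have -> : r `^ e = r^-1 `^ (- e).
  by rewrite -[r^-1]powR_inv1 ?(ltW r0)// -powRrM mulN1r opprK.
rewrite ltr0_norm//; apply: ler_powR2r; first by rewrite oppr_ge0 ltW.
  by rewrite invr_ge0 ltW.
by rewrite -[leRHS]invrK lef_pV2 ?posrE ?invr_gt0.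
Qed.

(** The singularities 0 and x are a unit apart. If |y| < 1/2 then |x - y| lies in [1/2, 2],
    otherwise |y| does; so one power is bounded by a constant and the other is integrable on a ball
    around its singularity. *)
Lemma integral_two_powers k (tau kap : R) (x : 'rV[R]_k) : (0 < k)%N ->
  tau < k%:R -> kap < k%:R -> enorm x = 1 ->
  (\int[lebn k]_y (if (enorm y < 1)%R then enorm y `^ (- tau) * enorm (x - y) `^ (- kap) else 0)%:E < +oo)%E.
Proof.
move=> k0 tk kk x1.
pose F (r q : R) := (2 `^ `|- kap| * (if r < 1 then r `^ (- tau) else 0) +
  2 `^ `|- tau| * (if q < 2 then q `^ (- kap) else 0)).
apply: (@le_lt_trans _ _ (\int[lebn k]_y (F (enorm y) (enorm (x - y)))%:E)%E).
  apply: ge0_le_integral => //.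
  - by move=> y _; rewrite lee_fin; case: ifPn => // _; rewrite mulr_ge0 ?powR_ge0.
  - by meas.
  - by rewrite /F; meas.
  move=> y _; rewrite lee_fin /F; have := enorm_ge0 y; have := enorm_ge0 (x - y).
  have h1 := enorm_triangle x y; rewrite x1 in h1.
  have h2 : enorm (x - y) <= 1 + enorm y.
    by rewrite -x1; have := enorm_triangle (x - y) (- y); rewrite opprK subrK enormN.
  move: (enorm y) (enorm (x - y)) h1 h2 => r q h1 h2 q0 r0.
  case: ifPn => r1; last first.
    by rewrite mulr0 add0r mulr_ge0 ?powR_ge0//; case: ifPn => // _; exact: powR_ge0.
  have -> : q < 2 by lra.
  have p1 : 0 <= 2 `^ `|- tau| * q `^ (- kap) by rewrite mulr_ge0 ?powR_ge0.
  have p2 : 0 <= 2 `^ `|- kap| * r `^ (- tau) by rewrite mulr_ge0 ?powR_ge0.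
  have [rh|rh] := leP 2^-1 r.
    apply: (@le_trans _ _ (2 `^ `|- tau| * q `^ (- kap))); last by rewrite lerDr.
    by rewrite ler_wpM2r ?powR_ge0// powR_band//; lra.
  apply: (@le_trans _ _ (2 `^ `|- kap| * r `^ (- tau))); last by rewrite lerDl.
  by rewrite mulrC ler_wpM2r ?powR_ge0// powR_band//; lra.
have t0 : (0 : R) <= 2 `^ `|- tau| by exact: powR_ge0.
have c0 : (0 : R) <= 2 `^ `|- kap| by exact: powR_ge0.
under eq_integral do rewrite EFinD 2!EFinM.
rewrite ge0_integralD; last 5 first.
- exact: measurableT.
- by move=> y _; rewrite mule_ge0// lee_fin; case: ifPn => // _; exact: powR_ge0.
- by meas.
- by move=> y _; rewrite mule_ge0// lee_fin; case: ifPn => // _; exact: powR_ge0.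
- by meas.
apply: lte_add_pinfty.
- rewrite ge0_integralZl; last 4 first.
  + exact: measurableT.
  + by meas.
  + by move=> y _; rewrite lee_fin; case: ifPn => // _; exact: powR_ge0.
  + by rewrite lee_fin.
  apply: lte_mul_pinfty; [by rewrite lee_fin|by []|].
  exact: integral_power_ball.
- rewrite ge0_integralZl; last 4 first.
  + exact: measurableT.
  + by meas.
  + by move=> y _; rewrite lee_fin; case: ifPn => // _; exact: powR_ge0.
  + by rewrite lee_fin.
  apply: lte_mul_pinfty; [by rewrite lee_fin|by []|].
  rewrite (@ge0_integral_lebn_shift _ _ _ x); last 2 first.
  + by meas.
  + by move=> y; rewrite lee_fin; case: ifPn => // _; exact: powR_ge0.
  under eq_integral do rewrite opprD addrCA subrr addr0 enormN.
  exact: integral_power_ball.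
Qed.

End power_integrals.

Section integral_lty.
Context d (T : measurableType d) {R : realType}.
Variable m : {measure set T -> \bar R}.
Implicit Types f g : T -> R.

Lemma integral_addr_lty f g :
  measurable_fun setT f -> measurable_fun setT g ->
  (forall x, 0 <= f x) -> (forall x, 0 <= g x) ->
  (\int[m]_x (f x)%:E < +oo)%E -> (\int[m]_x (g x)%:E < +oo)%E ->
  (\int[m]_x (f x + g x)%:E < +oo)%E.
Proof.
move=> mf mg f0 g0 hf hg; under eq_integral do rewrite EFinD.
rewrite ge0_integralD; last 5 first.
- exact: measurableT.
- by move=> x _; rewrite lee_fin.
- exact: meas_EFin.
- by move=> x _; rewrite lee_fin.
- exact: meas_EFin.
exact: lte_add_pinfty.
Qed.

Lemma integral_mulr_lty (c : R) f : 0 <= c ->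
  measurable_fun setT f -> (forall x, 0 <= f x) ->
  (\int[m]_x (f x)%:E < +oo)%E -> (\int[m]_x (c * f x)%:E < +oo)%E.
Proof.
move=> c0 mf f0 hf; under eq_integral do rewrite EFinM.
rewrite ge0_integralZl; last 4 first.
- exact: measurableT.
- exact: meas_EFin.
- by move=> x _; rewrite lee_fin.
- by rewrite lee_fin.
by apply: lte_mul_pinfty => //; rewrite lee_fin.
Qed.

Lemma integral_le_lty f g :
  measurable_fun setT f -> measurable_fun setT g ->
  (forall x, 0 <= f x) -> (forall x, f x <= g x) ->
  (\int[m]_x (g x)%:E < +oo)%E -> (\int[m]_x (f x)%:E < +oo)%E.
Proof.
move=> mf mg f0 fg; apply: le_lt_trans; apply: ge0_le_integral.
- exact: measurableT.
- by move=> x _; rewrite lee_fin.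
- exact: meas_EFin.
- exact: meas_EFin.
- by move=> x _; rewrite lee_fin.
Qed.

End integral_lty.

Section hardy_const_bounds.
Context {R : realType}.
Local Notation leb := (@lebesgue_measure R).

Lemma one_sub_powR_le (e r : R) : 0 <= e -> 0 < r < 1 ->
  0 <= 1 - r `^ e <= Num.max 1 e * (1 - r).
Proof.
move=> e0 /andP[r0 r1].
have r01 : 0 <= r <= 1 by rewrite !ltW.
rewrite subr_ge0 powR_le1_le1//=.
have s0 : 0 <= 1 - r by rewrite subr_ge0 ltW.
have [e1|e1] := leP 1 e.
  have := powR_bernoulli_ge e1 (ltW r0).
  by lra.
have : r <= r `^ e.
  by rewrite -{1}[r]powRr1 ?(ltW r0)//; apply: ger_powR; rewrite ?r0 ltW.
by lra.
Qed.

(** For gam < 0 the factor r^gam is taken out of the absolute value, which leaves the exponent -gam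
    > 0; the summand r^(gam p) accounts for that case. *)
Lemma norm_one_sub_powR (gam p r : R) : 0 <= p -> 0 < r < 1 ->
  `|1 - r `^ gam| `^ p <=
  Num.max 1 `|gam| `^ p * ((1 - r) `^ p * (1 + r `^ (gam * p))).
Proof.
move=> p0 r01; have /andP[r0 r1] := r01.
have M0 : 0 <= Num.max 1 `|gam| by rewrite le_max ler01.
have s0 : 0 <= 1 - r by rewrite subr_ge0 ltW.
have [g0|g0] := leP 0 gam.
  have /andP[h1 h2] := one_sub_powR_le g0 r01.
  rewrite (ger0_norm h1) (ger0_norm g0) mulrA -powRM//; last first.
    by move: M0; rewrite (ger0_norm g0).
  apply: le_trans (ler_powR2r p0 h1 h2) _.
  by rewrite ler_peMr ?powR_ge0// lerDl powR_ge0.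
have g0' : 0 <= - gam by rewrite oppr_ge0 ltW.
have /andP[h1 h2] := one_sub_powR_le g0' r01.
have e : `|1 - r `^ gam| = r `^ gam * (1 - r `^ (- gam)).
  rewrite mulrBr mulr1 -powRD ?(gt_eqF r0) ?implybT// subrr powRr0 -normrN opprB.
  by rewrite ger0_norm// subr_ge0 powR_le1_ge1 ?r0 ?(ltW r1)// ltW.
rewrite e (ltr0_norm g0) powRM ?powR_ge0// -powRrM mulrA -powRM//; last first.
  by move: M0; rewrite (ltr0_norm g0).
rewrite mulrC; apply: ler_pM; rewrite ?powR_ge0//; first exact: ler_powR2r.
by rewrite lerDr.
Qed.

Definition hardy_integral (k : nat) (s p alpha beta : R) : \bar R :=
  (\int[leb]_(r in `]0%R, 1%R[)
    (r `^ (s * p - 1) * (r `^ (- alpha) + r `^ (- beta)) *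
     `|1 - r `^ ((k%:R + alpha + beta - s * p) / p)| `^ p * Phi k s p r)%:E)%E.

Lemma Phi_ge0 k (s p r : R) : (0 < k)%N -> 0 <= k%:R + s * p -> 0 < r < 1 -> 0 <= Phi k s p r.
Proof.
by move=> k0 ks r01; rewrite -lee_fin -sphere_kernel_Phi// sphere_kernel_ge0.
Qed.

Lemma meas_Phi k (s p : R) : (0 < k)%N -> 0 <= k%:R + s * p ->
  measurable_fun (`]0, 1[%classic : set R) (Phi k s p).
Proof.
move=> k0 ks; apply: (@eq_measurable_fun _ _ _ _ _ (fun r => fine (sphere_kernel k (s * p) 1 r))).
  by move=> r; rewrite inE/= in_itv/= => r01; rewrite sphere_kernel_Phi.
apply: measurable_funTS; apply: (measurableT_comp (f := fine)) => //.
exact: meas_sphere_kernel.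
Qed.

(** Instead of estimating [Phi] near r = 1, [integral_sphere] is read backwards: the integral is one
    over the unit ball of R^k against |x - y|^(-(k + s p)) with |x| = 1. There 1 - |y| <= |x - y|,
    so the factor |1 - |y|^gam|^p absorbs p powers of the singularity, and the exponent left, kap =
    k + s p - p, is below k because s < 1. *)
Lemma hardy_integral_lty k (s p alpha beta : R) : (0 < k)%N -> 1 < p -> 0 < s < 1 ->
  - k%:R < alpha < s * p -> - k%:R < beta < s * p ->
  (hardy_integral k s p alpha beta < +oo)%E.
Proof.
move=> k0 p1 /andP[s0 s1] /andP[a1 a2] /andP[b1 b2].
have p0 : 0 < p by exact: lt_trans p1.
have k1 : 1 <= k%:R :> R by rewrite ler1n.
have sp : s * p < p by rewrite gtr_pMl.
have sp0 : 0 < s * p by rewrite mulr_gt0.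
have ks : 0 <= k%:R + s * p by lra.
set sg := s * p in a2 b2 sp sp0 ks.
have [x x1] := @exists_unit R _ k0.
pose gam := (k%:R + alpha + beta - sg) / p.
pose w (r : R) := r `^ (sg - k%:R) * (r `^ (- alpha) + r `^ (- beta)) * `|1 - r `^ gam| `^ p.
have w0 r : 0 <= w r by rewrite !mulr_ge0 ?addr_ge0 ?powR_ge0.
pose g (r : R) := if 0 < r < 1 then w r else 0.
have mg : measurable_fun setT g by rewrite /g /w; meas.
have g0 r : 0 <= g r by rewrite /g; case: ifPn.
have -> : hardy_integral k s p alpha beta =
    (\int[lebn k]_y (g (enorm y) / enorm (x - y) `^ (k%:R + sg))%:E)%E.
  rewrite integral_sphere// x1 /hardy_integral integral_mkcond [RHS]integral_mkcond.
  apply: eq_integral => r _; rewrite !patchE in_pos.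
  have -> : (r \in `]0, 1[%classic) = (0 < r < 1) by apply/idP/idP; rewrite inE/= in_itv.
  rewrite /g; case: (ltP 0 r) => r0 //=; case: (ltP r 1) => r1; last by rewrite mul0r mul0e.
  rewrite sphere_kernel_Phi ?r0// -EFinM; apply: (congr1 EFin).
  rewrite /w -/sg -/gam; have -> : r `^ (sg - 1) = r `^ (sg - k%:R) * r ^+ k.-1.
    rewrite -powR_mulrn ?(ltW r0)// -powRD ?(gt_eqF r0) ?implybT//; congr (_ `^ _).
    have -> : k%:R = k.-1%:R + 1 :> R by rewrite natr1 prednK.
    by ring.
  by move: (_ ^+ _) (Phi _ _ _ _) (`|_| `^ _) (r `^ _) (_ + _) => A1 A2 A3 A4 A5; ring.
pose kap := k%:R + sg - p.
pose t (tau : R) (y : 'rV[R]_k) := if enorm y < 1 then enorm y `^ (- tau) * enorm (x - y) `^ (- kap) else 0.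
have mt tau : measurable_fun setT (t tau) by rewrite /t; meas.
have t0 tau y : 0 <= t tau y by rewrite /t; case: ifPn => // _; rewrite mulr_ge0 ?powR_ge0.
have tl tau : tau < k%:R -> (\int[lebn k]_y (t tau y)%:E < +oo)%E.
  by move=> h; apply: integral_two_powers => //; rewrite /kap; lra.
pose M := Num.max 1 `|gam| `^ p.
have M0 : 0 <= M by exact: powR_ge0.
(* Expanding r^(s p - k) (r^(-alpha) + r^(-beta)) (1 + r^(gam p)) gives the powers -t1, -t2, beta
   and alpha of r. They are integrable at 0 by the upper and lower bounds on alpha and beta. *)
pose t1 := k%:R + alpha - sg; pose t2 := k%:R + beta - sg.
apply: (integral_le_lty (g := fun y => M * ((t t1 y + t t2 y) + (t (- beta) y + t (- alpha) y)))); last first.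
- apply: integral_mulr_lty => //.
  + by apply: meas_add; apply: meas_add.
  + by move=> y; rewrite !addr_ge0.
  apply: integral_addr_lty => //; try by [apply: meas_add | move=> y; rewrite addr_ge0].
  + by apply: integral_addr_lty => //; apply: tl; rewrite /t1 /t2; lra.
  + by apply: integral_addr_lty => //; apply: tl; lra.
- move=> y; rewrite /t /g.
  have := enorm_triangle x y; have := enorm_ge0 y; rewrite x1.
  move: (enorm y) (enorm (x - y)) => r q r0 hq.
  case: (ltP r 1) => r1; last by rewrite andbF mul0r !addr0 mulr0.
  case: (ltP 0 r) => r0'/=; last first.
    by rewrite mul0r mulr_ge0// !addr_ge0// mulr_ge0 ?powR_ge0.
  have r01 : 0 < r < 1 by rewrite r0'.
  have q0 : 0 < q by lra.
  have h := norm_one_sub_powR gam (ltW p0) r01.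
  have hq' : (1 - r) `^ p <= q `^ p by apply: ler_powR2r; lra.
  have e1 : gam * p = k%:R + alpha + beta - sg by rewrite /gam mulfVK// gt_eqF.
  rewrite e1 -/M in h.
  have -> : M * (r `^ (- t1) * q `^ (- kap) + r `^ (- t2) * q `^ (- kap) +
    (r `^ (- - beta) * q `^ (- kap) + r `^ (- - alpha) * q `^ (- kap))) =
    r `^ (sg - k%:R) * (r `^ (- alpha) + r `^ (- beta)) *
    (M * (q `^ p * (1 + r `^ (k%:R + alpha + beta - sg)))) / q `^ (k%:R + sg).
    have P a b : r `^ (a + b) = r `^ a * r `^ b by rewrite powRD// (gt_eqF r0') implybT.
    have -> : q `^ (- kap) = q `^ p / q `^ (k%:R + sg).
      by rewrite -powRN -powRD ?(gt_eqF q0) ?implybT//; congr (_ `^ _); rewrite /kap; ring.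
    have -> : - t1 = sg - k%:R - alpha by rewrite /t1; ring.
    have -> : - t2 = sg - k%:R - beta by rewrite /t2; ring.
    have -> : - - beta = (sg - k%:R) - alpha + (k%:R + alpha + beta - sg) by ring.
    have -> : - - alpha = (sg - k%:R) - beta + (k%:R + alpha + beta - sg) by ring.
    rewrite !(P (sg - k%:R - _)) !(P (sg - k%:R)).
    move: (r `^ (sg - k%:R)) (r `^ (- alpha)) (r `^ (- beta)) (r `^ (k%:R + alpha + beta - sg)) (q `^ p) ((q `^ (k%:R + sg))^-1) => a b c e f g'.
    by ring.
  rewrite ler_wpM2r ?invr_ge0 ?powR_ge0// /w; apply: ler_wpM2l.
    by rewrite mulr_ge0 ?addr_ge0 ?powR_ge0.
  apply: le_trans h _; apply: ler_wpM2l => //; apply: ler_wpM2r => //.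
  by rewrite addr_ge0 ?powR_ge0.
- by move=> y; rewrite divr_ge0 ?powR_ge0.
- by apply: meas_mul => //; apply: meas_add; apply: meas_add.
- apply: meas_mul; first by apply: (measurableT_comp mg); clear; meas.
  by clear; meas.
Qed.

Lemma Phi_gt0 k (s p r : R) : (0 < k)%N -> 0 <= k%:R + s * p -> 0 < r < 1 -> 0 < Phi k s p r.
Proof.
move=> k0 ks r01; rewrite -lte_fin -sphere_kernel_Phi//; have /andP[r0 r1] := r01.
rewrite /sphere_kernel; case: eqP => [_|k1].
  by rewrite lte_fin ltr_pwDl ?powR_ge0// powR_gt0// normr_gt0 subr_eq0 gt_eqF.
case: k k0 k1 ks => [|[|n]]// _ _ ks.
have [A0 _] := @sphere_area_radial R n.
apply: mule_gt0; [by rewrite lte_fin|clear A0].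
apply: integral_gt0.
- exact: measurable_itv.
- by apply: measurable_funTS; meas.
- move=> t; rewrite /= in_itv/= => /andP[t1 t2].
  have h1 : 0 < 1 - t ^+ 2 by nra.
  have h2 : 0 < 1 ^+ 2 - 2 * t * (1 * r) + r ^+ 2 by nra.
  by rewrite divr_gt0 ?powR_gt0.
- by rewrite lebesgue_measure_itv/= lte_fin ifT; [rewrite -EFinB lte_fin; lra|lra].
Qed.

Lemma hardy_integral_gt0 k (s p alpha beta : R) : (0 < k)%N -> 1 < p -> 0 < s < 1 ->
  s * p != k%:R + alpha + beta ->
  (0 < hardy_integral k s p alpha beta)%E.
Proof.
move=> k0 p1 /andP[s0 s1] ne; have p0 : 0 < p by exact: lt_trans p1.
have ks : 0 <= k%:R + s * p by rewrite addr_ge0// ltW// mulr_gt0.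
apply: integral_gt0.
- exact: measurable_itv.
- by apply: measurable_funM; [apply: measurable_funTS; meas|exact: meas_Phi].
- move=> r; rewrite /= in_itv/= => r01; have /andP[r0 r1] := r01.
  rewrite !mulr_gt0 ?Phi_gt0// ?powR_gt0 ?addr_gt0 ?powR_gt0// normr_gt0 subr_eq0.
  apply/eqP => h; have gN : (k%:R + alpha + beta - s * p) / p != 0.
    by apply: mulf_neq0; [rewrite subr_eq0 eq_sym|rewrite invr_eq0 gt_eqF].
  have := powRK gN (ltW r0); rewrite -h powR1 => e1.
  by move: r1; rewrite -e1 ltxx.
- by rewrite lebesgue_measure_itv/= lte_fin ltr01 sube0 lte_fin.
Qed.

Lemma hardy_const1_integral k (s p alpha beta : R) : (0 < k)%N -> 1 < p -> 0 < s < 1 ->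
  - k%:R < alpha < s * p -> - k%:R < beta < s * p ->
  (hardy_const1 k s p alpha beta)%:E = hardy_integral k s p alpha beta.
Proof.
move=> k0 p1 s01 ha hb; have := hardy_integral_lty k0 p1 s01 ha hb => h.
rewrite /hardy_const1 fineK// ge0_fin_numE//.
clear h; have p0 : 0 < p by exact: lt_trans p1.
have /andP[s0 _] := s01.
apply: integral_ge0 => r; rewrite /= in_itv/= => r01; rewrite lee_fin.
by rewrite !mulr_ge0 ?Phi_ge0 ?addr_ge0 ?powR_ge0// ltW// mulr_gt0.
Qed.

Lemma hardy_constE k m (s p alpha beta : R) :
  hardy_const (k + m) s p k alpha beta = dim_const k m (s * p) * hardy_const1 k s p alpha beta.
Proof. by rewrite /hardy_const /dim_const (_ : (k + m)%:R - k%:R = m%:R)// natrD addrC addKr. Qed.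

End hardy_const_bounds.

(** * Finiteness of the Hardy term *)

Section hardy_term_finite.
Context {R : realType}.

Lemma continuous_pnorm k n : continuous (@pnorm R k n).
Proof.
move=> x; apply: (@continuous_comp _ _ _ (fun x : 'rV[R]_n => \sum_(i < n | (i < k)%N) x ord0 i ^+ 2) Num.sqrt); last exact: sqrt_continuous.
apply: (@cvg_big _ _ _ _ _ _ _ (nbhs x) _ _ _ (nbhs_filter x)) => [|i _]; first exact: add_continuous.
apply: (@continuous_comp _ _ _ (fun x : 'rV[R]_n => x ord0 i) (fun t => t ^+ 2)); last exact: exprn_continuous.
exact: coord_continuous.
Qed.

Lemma continuous_enorm n : continuous (@enorm R n).
Proof.
move=> x; apply: (@continuous_comp _ _ _ (fun x : 'rV[R]_n => \sum_(i < n) x ord0 i ^+ 2) Num.sqrt); last exact: sqrt_continuous.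
apply: (@cvg_big _ _ _ _ _ _ _ (nbhs x) _ _ _ (nbhs_filter x)) => [|i _]; first exact: add_continuous.
apply: (@continuous_comp _ _ _ (fun x : 'rV[R]_n => x ord0 i) (fun t => t ^+ 2)); last exact: exprn_continuous.
exact: coord_continuous.
Qed.

Lemma compact_continuous_bounded (T : topologicalType) (A : set T) (f : T -> R) :
  compact A -> continuous f -> exists2 M, 0 < M & forall x, A x -> f x < M.
Proof.
move=> cA cf; have [->|/set0P A0] := eqVneq A set0; first by exists 1.
have [c _ hc] := compact_EVT_max A0 cA (continuous_subspaceT cf).
exists (`|f c| + 1) => [|x Ax]; first by rewrite ltr_wpDl.
by have := hc x (mem_set Ax); have := ler_norm (f c); lra.
Qed.

Lemma compact_continuous_lower (T : topologicalType) (A : set T) (f : T -> R) :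
  compact A -> continuous f -> (forall x, A x -> 0 < f x) ->
  exists2 c, 0 < c & forall x, A x -> c <= f x.
Proof.
move=> cA cf f0; have [->|/set0P A0] := eqVneq A set0; first by exists 1.
have [c Ac hc] := compact_EVT_min A0 cA (continuous_subspaceT cf).
exists (f c); first exact/f0/set_mem.
by move=> x /mem_set/hc.
Qed.

Lemma pnorm_gt0 k n (x : 'rV[R]_n) : ~ singular_set k n x -> 0 < pnorm k x.
Proof.
move=> hx; rewrite lt_neqAle sqrtr_ge0 andbT; apply/eqP => x0; apply: hx => i ik.
have s0 : \sum_(i < n | (i < k)%N) x ord0 i ^+ 2 = 0.
  apply/eqP; rewrite eq_le sumr_ge0 ?andbT; last by move=> j _; exact: sqr_ge0.
  by move/esym/eqP: x0; rewrite sqrtr_eq0.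
by have /eqP := psumr_eq0P (fun j _ => sqr_ge0 (x ord0 j)) s0 ik; rewrite sqrf_eq0 => /eqP.
Qed.

Lemma integral_cylinder_lty k m (tau M : R) : (0 < k)%N -> tau < k%:R -> 0 < M ->
  (\int[lebn k]_a \int[lebn m]_b
    ((if (enorm a < M)%R then enorm a `^ (- tau) else 0) * \1_(cube M) b)%:E < +oo)%E.
Proof.
move=> k0 tk M0.
have icube : (\int[lebn m]_b (\1_(@cube R m M) b)%:E = ((2 * M) ^+ m)%:E)%E.
  rewrite integral_indic; [|exact: measurableT|exact: measurable_cube].
  by rewrite setIT; apply: lebn_cube; exact: ltW.
under eq_integral => a _.
  under eq_integral do rewrite EFinM.
  rewrite ge0_integralZl; last 4 first.
  - exact: measurableT.
  - apply: meas_EFin; apply: measurable_indic; exact: measurable_cube.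
  - by move=> b _; rewrite lee_fin.
  - by rewrite lee_fin; case: ifPn => // _; exact: powR_ge0.
  rewrite icube -EFinM mulrC.
  over.
apply: integral_mulr_lty.
- by rewrite exprn_ge0// mulr_ge0// ltW.
- by meas.
- by move=> a; case: ifPn => // _; exact: powR_ge0.
- exact: integral_power_ball.
Qed.

Lemma hardy_term_lty k m (s p alpha beta : R) (u : 'rV[R]_(k + m) -> R) :
  (0 < k)%N -> 0 < p -> continuous u -> compact (closure [set x | u x != 0]) ->
  s * p - alpha - beta < k%:R \/ closure [set x | u x != 0] `<=` ~` singular_set k (k + m) ->
  (hardy_term k s p alpha beta u < +oo)%E.
Proof.
move=> k0 p0 cu cA hA; set tau := s * p - alpha - beta in hA *.
have [B B0 hB] := compact_continuous_bounded cA (fun x => continuous_comp (cu x) (@norm_continuous _ _ (u x))).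
have [M M0 hM] := compact_continuous_bounded cA (@continuous_enorm (k + m)).
have supp x : u x != 0 -> closure [set x | u x != 0] x.
  by move=> ux; apply: subset_closure.
(* Both cases reduce to an integrable power on a cylinder. If tau < k the power itself is integrable
   and tau' = tau; if the support avoids the singular set, |x_k| is bounded above and below on it,
   and tau' = 0. *)
have [tau' tk [C C0 hC]] : exists2 tau', tau' < k%:R & exists2 C, 0 <= C & forall x,
    u x != 0 -> `|u x| `^ p / pnorm k x `^ tau <= C * pnorm k x `^ (- tau').
  case: hA => [h|h].
    exists tau => //; exists (B `^ p) => [|x ux]; first exact: powR_ge0.
    by rewrite -powRN ler_wpM2r ?powR_ge0// ler_powR2r ?(ltW p0)// ltW// hB//; exact: supp.
  have [c c0 hc] := compact_continuous_lower cA (@continuous_pnorm k (k + m)) (fun x Ax => pnorm_gt0 (h x Ax)).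
  have [D D0 hD] := compact_continuous_bounded cA (@continuous_pnorm k (k + m)).
  pose b := Num.max 1 (Num.max D c^-1).
  exists 0; first by rewrite ltr0n.
  exists (B `^ p * b `^ `|- tau|) => [|x ux]; first by rewrite mulr_ge0 ?powR_ge0.
  have Ax := supp x ux.
  rewrite oppr0 powRr0 mulr1 -powRN; apply: ler_pM; rewrite ?powR_ge0//.
    by rewrite ler_powR2r ?(ltW p0)// ltW// hB.
  have b1 : 1 <= b by rewrite le_max lexx.
  apply: powR_band => //; rewrite invf_ple ?posrE ?(lt_le_trans ltr01 b1)//; last exact: lt_le_trans (hc x Ax).
  apply/andP; split; last by rewrite !le_max (ltW (hD x Ax)) orbT.
  rewrite !le_max; apply/orP; right; apply/orP; right.
  rewrite lef_pV2 ?posrE//; first exact: hc.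
  exact: lt_le_trans (hc x Ax).
have mu := continuous_measurable_rV cu.
rewrite /hardy_term -/tau -[X in (X < _)%E]/(\int[lebn (k + m)]_x (`|u x| `^ p / pnorm k x `^ tau)%:E)%E.
rewrite ge0_integral_lebn_split; last 2 first.
- by meas.
- by move=> x; rewrite lee_fin divr_ge0 ?powR_ge0.
pose G (a : 'rV[R]_k) (b : 'rV[R]_m) : R :=
  (if enorm a < M then enorm a `^ (- tau') else 0) * \1_(cube M) b.
have G0 a b : 0 <= G a b.
  by rewrite /G mulr_ge0//; case: ifPn => // _; exact: powR_ge0.
have mG : measurable_fun setT (fun z : 'rV[R]_k * 'rV[R]_m => (G z.1 z.2)%:E).
  apply: meas_EFin; apply: meas_mul; first by meas.
  have mI : measurable_fun setT (\1_(@cube R m M) : 'rV[R]_m -> R).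
    by apply: measurable_indic; exact: measurable_cube.
  exact: (measurableT_comp mI measurable_snd).
have mGa a : measurable_fun setT (fun b => (G a b)%:E).
  have mp : measurable_fun setT (fun b : 'rV[R]_m => (a, b)) by meas.
  exact: (measurableT_comp mG mp).
have mur : measurable_fun setT (fun z : 'rV[R]_k * 'rV[R]_m => u (row_mx z.1 z.2)).
  have mp : measurable_fun setT (fun z : 'rV[R]_k * 'rV[R]_m => row_mx z.1 z.2) by meas.
  exact: (measurableT_comp mu mp).
apply: (@le_lt_trans _ _ (\int[lebn k]_a (C%:E * \int[lebn m]_b (G a b)%:E))%E); last first.
  rewrite ge0_integralZl; last 4 first.
  - exact: measurableT.
  - by apply: (@meas_integral2 _ _ _ _ R (lebn m) (fun a b => (G a b)%:E)) => // a b; rewrite lee_fin.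
  - by move=> a _; apply: integral_ge0 => b _; rewrite lee_fin.
  - by rewrite lee_fin.
  apply: lte_mul_pinfty; [by rewrite lee_fin|by []|].
  exact: integral_cylinder_lty.
apply: ge0_le_integral.
- exact: measurableT.
- by move=> a _; apply: integral_ge0 => b _; rewrite lee_fin divr_ge0 ?powR_ge0.
- apply: (@meas_integral2 _ _ _ _ R (lebn m) (fun a b => (`|u (row_mx a b)| `^ p / pnorm k (row_mx a b) `^ tau)%:E)).
    by clear -mur; meas.
  by move=> a b; rewrite lee_fin divr_ge0 ?powR_ge0.
- apply: meas_emul => //.
  by apply: (@meas_integral2 _ _ _ _ R (lebn m) (fun a b => (G a b)%:E)) => // a b; rewrite lee_fin.
move=> a _; rewrite -ge0_integralZl; last 4 first.
- exact: measurableT.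
- exact: mGa.
- by move=> b _; rewrite lee_fin.
- by rewrite lee_fin.
apply: ge0_le_integral.
- exact: measurableT.
- by move=> b _; rewrite lee_fin divr_ge0 ?powR_ge0.
- have mua : measurable_fun setT (fun b => u (row_mx a b)).
    by apply: (measurableT_comp mu); apply: (@measurable_row_mx _ _ _ _ _ (fun=> a) id).
  by clear -mua; meas.
- by apply: meas_emul.
move=> b _; rewrite -EFinM lee_fin /G; have [u0|un] := eqVneq (u (row_mx a b)) 0.
  rewrite u0 normr0 powR0 ?gt_eqF// mul0r mulr_ge0// mulr_ge0//.
  by case: ifPn => // _; exact: powR_ge0.
have hx := hM _ (supp _ un); apply: le_trans (hC _ un) _.
rewrite pnorm_row_mx; have ab := enorm_row_mx a b.
have ea : enorm a < M.
  apply: le_lt_trans hx; rewrite -(@ler_pXn2r _ 2)// ?nnegrE ?enorm_ge0// ab.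
  by rewrite lerDl sqr_ge0.
have eb : enorm b < M.
  apply: le_lt_trans hx; rewrite -(@ler_pXn2r _ 2)// ?nnegrE ?enorm_ge0// ab.
  by rewrite lerDr sqr_ge0.
rewrite ea indicE mem_set ?mulr1// => i.
by apply: le_trans (le_enorm b i) _; exact: ltW.
Qed.

End hardy_term_finite.

(** * The ground state representation *)

Section ground_state_picone.
Context {R : realType}.
Variables (p gam : R).

Definition profile (r : R) : R := `|1 - r `^ gam| `^ (p - 1).

Lemma profile_ge0 r : 0 <= profile r.
Proof. exact: powR_ge0. Qed.

Lemma powR_div (X Y e : R) : 0 <= X -> 0 <= Y -> (X / Y) `^ e = X `^ e * Y `^ (- e).
Proof.
move=> X0 Y0; rewrite powRM ?invr_ge0//; congr (_ * _).
by rewrite -[Y^-1]powR_inv1// -powRrM mulN1r.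
Qed.

(** With X = |x_k|, Y = |y_k| and a = u(x), this is the first term of Picone's inequality. It is
    homogeneous of degree p in the weights, so once |u|^p = w^p |v|^p is extracted only the ratio X
    / Y is left. *)
Lemma profile_weight (X Y a : R) : 1 < p -> 0 < X -> 0 < Y ->
  `|X `^ (- gam) - Y `^ (- gam)| `^ (p - 1) * (X `^ (- gam) * `|X `^ gam * a| `^ p) =
  profile (X / Y) * `|a| `^ p.
Proof.
move=> p1 X0 Y0; have X1 := powR_gt0 (- gam) X0; have X2 := powR_gt0 gam X0.
have e : X `^ gam * X `^ (- gam) = 1 by rewrite powRN mulfV// gt_eqF.
have -> : X `^ (- gam) - Y `^ (- gam) = X `^ (- gam) * (1 - (X / Y) `^ gam).
  by rewrite powR_div ?ltW// mulrBr mulr1 mulrA [X `^ (- gam) * _]mulrC e mul1r.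
rewrite /profile; set Q := 1 - (X / Y) `^ gam.
rewrite !normrM (gtr0_norm X1) (gtr0_norm X2) !powRM ?powR_ge0//.
have -> : (X `^ gam) `^ p = X `^ gam * (X `^ gam) `^ (p - 1).
  by rewrite mulr_powRB1 ?powR_ge0//; lra.
have e2 : (X `^ (- gam)) `^ (p - 1) * (X `^ gam) `^ (p - 1) = 1.
  by rewrite -powRM ?powR_ge0// [X in X `^ _]mulrC e powR1.
transitivity (((X `^ (- gam)) `^ (p - 1) * (X `^ gam) `^ (p - 1)) * (X `^ gam * X `^ (- gam)) *
  (`|Q| `^ (p - 1) * `|a| `^ p)); last by rewrite e e2 !mul1r.
move: (X `^ _) (_ `^ (p - 1)) (_ `^ (p - 1)) (X `^ _) (_ `^ (p - 1)) (_ `^ p) => ? ? ? ? ? ?; ring.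
Qed.

Lemma picone_ground (c : R) (P : R -> bool) (X Y a b : R) : 1 < p -> picone_const p c P ->
  0 < X -> 0 < Y -> Y `^ (- gam) <= X `^ (- gam) -> P (X `^ gam * a) -> P (Y `^ gam * b) ->
  profile (X / Y) * `|a| `^ p +
  c * ((spow (X `^ gam * a) (p / 2) - spow (Y `^ gam * b) (p / 2)) ^+ 2 *
    (Num.min (X `^ (- gam)) (Y `^ (- gam)) * Num.max (X `^ (- gam)) (Y `^ (- gam)) `^ (p - 1))) <=
  `|a - b| `^ p + profile (Y / X) * `|b| `^ p.
Proof.
move=> p1 pc X0 Y0 XY Pa Pb.
have w2 : 0 < Y `^ (- gam) <= X `^ (- gam) by rewrite powR_gt0.
have := picone_weighted p1 pc w2 Pa Pb.
have cancel Z t : 0 < Z -> Z `^ (- gam) * (Z `^ gam * t) = t.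
  by move=> Z0; rewrite mulrA powRN mulVf ?mul1r// gt_eqF// powR_gt0.
rewrite !cancel// mulrBr.
have h1 := profile_weight a p1 X0 Y0; have h2 := profile_weight b p1 Y0 X0.
rewrite distrC in h2; rewrite ger0_norm in h1; last by rewrite subr_ge0.
rewrite ger0_norm in h2; last by rewrite subr_ge0.
rewrite h1 h2 min_r// max_l// [(_ - _) ^+ 2 * _]mulrC.
by move=> h; rewrite -lerBlDr addrAC.
Qed.

Definition cone (c : bool) (delta X Y : R) : bool :=
  if c then X < delta * Y else Y < delta * X.

Definition cone_part (c : bool) (delta X Y A : R) : R :=
  if [&& cone c delta X Y, 0 < X & 0 < Y] then profile (X / Y) * A else 0.

(** X = Y is kept in spite of the truncation: there both terms with [profile] vanish, so Picone's
    inequality needs no cone. The truncated remainders then increase to the full one at every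
    point. *)
Definition off_diagonal (delta X Y : R) : bool :=
  [&& 0 < X, 0 < Y & [|| X == Y, X < delta * Y | Y < delta * X]].

(* Exactly one of the two cones contains (X, Y) off the diagonal, so that the
   sign of gam decides on which side of Picone's inequality each part stands. *)
Lemma picone_cone (c delta : R) (P : R -> bool) (X Y a b : R) :
  1 < p -> picone_const p c P -> gam != 0 -> 0 < delta < 1 ->
  P (X `^ gam * a) -> P (Y `^ gam * b) ->
  cone_part (0 < gam) delta X Y (`|a| `^ p) + cone_part (0 < gam) delta Y X (`|b| `^ p) +
  c * (if off_diagonal delta X Y then
    (spow (X `^ gam * a) (p / 2) - spow (Y `^ gam * b) (p / 2)) ^+ 2 *
    (Num.min (X `^ (- gam)) (Y `^ (- gam)) * Num.max (X `^ (- gam)) (Y `^ (- gam)) `^ (p - 1))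
    else 0) <=
  `|a - b| `^ p +
  (cone_part (gam <= 0) delta X Y (`|a| `^ p) + cone_part (gam <= 0) delta Y X (`|b| `^ p)).
Proof.
move=> p1 pc g0 /andP[d0 d1]; wlog XY : X Y a b / X <= Y.
  move=> wl Pa Pb; have [XY|/ltW XY] := leP X Y; first exact: wl.
  have := wl Y X b a XY Pb Pa.
  rewrite [cone_part _ _ Y X _ + _]addrC distrC -sqrrN opprB minC maxC.
  rewrite [X in _ <= _ + X]addrC.
  have -> : off_diagonal delta Y X = off_diagonal delta X Y; last by [].
  by rewrite /off_diagonal andbCA eq_sym [(Y < _) || _]orbC.
move=> Pa Pb; rewrite /cone_part /off_diagonal.
have n0 : 0 <= `|a - b| `^ p by exact: powR_ge0.
case: (ltP 0 X) => [X0|_]; last by rewrite !andbF/= !add0r mulr0 !addr0.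
case: (ltP 0 Y) => [Y0|_]; last by rewrite !andbF/= !add0r mulr0 !addr0.
have hN : (Y < delta * X) = false.
  by apply/negbTE; rewrite -leNgt; apply: le_trans XY; rewrite ger_pMl// ltW.
rewrite /= !andbT /cone hN orbF.
have [XYe|XYn] := eqVneq X Y.
  subst Y; rewrite hN !if_same !add0r addr0.
  have := picone_ground (a := a) (b := b) p1 pc X0 X0 (lexx _) Pa Pb.
  have -> : profile (X / X) = 0.
    by rewrite /profile divff ?gt_eqF// powR1 subrr normr0 powR0// subr_eq0 gt_eqF.
  by rewrite !mul0r add0r addr0.
have [hX|hX] /= := boolP (X < delta * Y); last first.
  by rewrite !if_same !add0r mulr0 addr0.
have [gp|gn] := ltP 0 gam.
  rewrite !addr0 add0r; apply: (picone_ground p1 pc X0 Y0 _ Pa Pb).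
  rewrite !powRN lef_pV2 ?posrE ?powR_gt0//.
  by apply: ler_powR2r => //; exact: ltW.
rewrite !addr0 add0r [X in c * X](_ : _ = (spow (Y `^ gam * b) (p / 2) - spow (X `^ gam * a) (p / 2)) ^+ 2 *
    (Num.min (Y `^ (- gam)) (X `^ (- gam)) * Num.max (Y `^ (- gam)) (X `^ (- gam)) `^ (p - 1))); last first.
  by rewrite -sqrrN opprB minC maxC.
rewrite distrC; apply: (picone_ground p1 pc Y0 X0 _ Pb Pa).
by apply: ler_powR2r => //; [rewrite oppr_ge0|exact: ltW].
Qed.

End ground_state_picone.

(** * Iterated integrals of nonnegative functions and exhaustion by monotone convergence *)

Section iterated_integral.
Context d1 d2 (T1 : measurableType d1) (T2 : measurableType d2) {R : realType}.
Variable m1 : {sigma_finite_measure set T1 -> \bar R}.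
Variable m2 : {sigma_finite_measure set T2 -> \bar R}.
Implicit Types F H : T1 -> T2 -> R.

Lemma measurable_section F x : measurable_fun setT (fun z : T1 * T2 => F z.1 z.2) ->
  measurable_fun setT (F x).
Proof.
move=> mF; have mp : measurable_fun setT (fun y : T2 => (x, y)).
  by apply: meas_pair => //; exact: measurable_id.
exact: (measurableT_comp mF mp).
Qed.

Lemma measurable_inner F : measurable_fun setT (fun z : T1 * T2 => F z.1 z.2) ->
  (forall x y, 0 <= F x y) -> measurable_fun setT (fun x => \int[m2]_y (F x y)%:E)%E.
Proof.
move=> mF F0; apply: (@meas_integral2 _ _ _ _ R m2 (fun x y => (F x y)%:E)).
  exact: meas_EFin.
by move=> x y; rewrite lee_fin.
Qed.

Lemma iterated_integralD F H :
  measurable_fun setT (fun z : T1 * T2 => F z.1 z.2) ->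
  measurable_fun setT (fun z : T1 * T2 => H z.1 z.2) ->
  (forall x y, 0 <= F x y) -> (forall x y, 0 <= H x y) ->
  (\int[m1]_x \int[m2]_y (F x y + H x y)%:E =
   \int[m1]_x \int[m2]_y (F x y)%:E + \int[m1]_x \int[m2]_y (H x y)%:E)%E.
Proof.
move=> mF mH F0 H0.
rewrite -ge0_integralD; last 5 first.
- exact: measurableT.
- by move=> x _; apply: integral_ge0 => y _; rewrite lee_fin.
- exact: measurable_inner.
- by move=> x _; apply: integral_ge0 => y _; rewrite lee_fin.
- exact: measurable_inner.
apply: eq_integral => x _; under eq_integral do rewrite EFinD.
rewrite ge0_integralD; [by []|exact: measurableT|by move=> y _; rewrite lee_fin| |by move=> y _; rewrite lee_fin|].
- by apply: meas_EFin; exact: (measurable_section _ mF).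
- by apply: meas_EFin; exact: (measurable_section _ mH).
Qed.

Lemma iterated_integralZl (c : R) F : 0 <= c ->
  measurable_fun setT (fun z : T1 * T2 => F z.1 z.2) -> (forall x y, 0 <= F x y) ->
  (\int[m1]_x \int[m2]_y (c * F x y)%:E = c%:E * \int[m1]_x \int[m2]_y (F x y)%:E)%E.
Proof.
move=> c0 mF F0; rewrite -ge0_integralZl; last 4 first.
- exact: measurableT.
- exact: measurable_inner.
- by move=> x _; apply: integral_ge0 => y _; rewrite lee_fin.
- by rewrite lee_fin.
apply: eq_integral => x _; under eq_integral do rewrite EFinM.
rewrite ge0_integralZl; [by []|exact: measurableT| |by move=> y _; rewrite lee_fin|by rewrite lee_fin].
by apply: meas_EFin; exact: (measurable_section _ mF).
Qed.

Lemma le_iterated_integral F H :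
  measurable_fun setT (fun z : T1 * T2 => F z.1 z.2) ->
  measurable_fun setT (fun z : T1 * T2 => H z.1 z.2) ->
  (forall x y, 0 <= F x y) -> (forall x y, F x y <= H x y) ->
  (\int[m1]_x \int[m2]_y (F x y)%:E <= \int[m1]_x \int[m2]_y (H x y)%:E)%E.
Proof.
move=> mF mH F0 FH.
have H0 x y : 0 <= H x y by exact: le_trans (FH x y).
apply: ge0_le_integral.
- exact: measurableT.
- by move=> x _; apply: integral_ge0 => y _; rewrite lee_fin.
- exact: measurable_inner.
- exact: measurable_inner.
move=> x _; apply: ge0_le_integral.
- exact: measurableT.
- by move=> y _; rewrite lee_fin.
- by apply: meas_EFin; exact: (measurable_section _ mF).
- by apply: meas_EFin; exact: (measurable_section _ mH).
- by move=> y _; rewrite lee_fin.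
Qed.

Lemma monotone_integral_cvg (F : nat -> T1 -> \bar R) (G : T1 -> \bar R) :
  (forall n, measurable_fun setT (F n)) -> (forall n x, 0 <= F n x)%E ->
  (forall x, {homo F^~ x : n n' / (n <= n')%N >-> (n <= n')%E}) ->
  (forall x, F n x @[n --> \oo] --> G x) ->
  (\int[m1]_x F n x)%E @[n --> \oo] --> (\int[m1]_x G x)%E.
Proof.
move=> mF F0 ndF FG.
have := @cvg_monotone_convergence _ _ _ m1 _ measurableT _ mF (fun n x _ => F0 n x) (fun x _ => ndF x).
have -> // : (\int[m1]_x (fun x0 => limn (F^~ x0)) x = \int[m1]_x G x)%E.
by apply: eq_integral => x _; apply: cvg_lim => //; exact: FG.
Qed.

End iterated_integral.

Section exhaustion.
Context d1 d2 (T1 : measurableType d1) (T2 : measurableType d2) {R : realType}.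
Variable m1 : {sigma_finite_measure set T1 -> \bar R}.
Variable m2 : {sigma_finite_measure set T2 -> \bar R}.

Lemma cut_cvg (b : nat -> bool) (a : R) :
  (forall n n', (n <= n')%N -> b n -> b n') -> (a != 0 -> exists n, b n) ->
  (if b n then a else 0)%:E @[n --> \oo] --> a%:E.
Proof.
move=> bm ba; apply: cvg_near_cst; have [->|/ba[N bN]] := eqVneq a 0.
  by near=> n; rewrite if_same.
by exists N => // n /= Nn; rewrite (bm _ _ Nn bN).
Unshelve. all: by end_near. Qed.

Lemma cut_homo (b : nat -> bool) (a : R) : 0 <= a ->
  (forall n n', (n <= n')%N -> b n -> b n') ->
  {homo (fun n => (if b n then a else 0)%:E) : n n' / (n <= n')%N >-> (n <= n')%E}.
Proof.
move=> a0 bm n n' nn'; rewrite lee_fin; case: ifPn => [/(bm _ _ nn') -> //|_].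
by case: ifPn.
Qed.

Lemma exhaust_integral (b : nat -> T1 -> bool) (F : T1 -> R) :
  (forall n, measurable_fun setT (fun x => if b n x then F x else 0)) ->
  (forall x, 0 <= F x) ->
  (forall n n' x, (n <= n')%N -> b n x -> b n' x) ->
  (forall x, F x != 0 -> exists n, b n x) ->
  (\int[m1]_x (if b n x then F x else 0)%:E)%E @[n --> \oo] --> (\int[m1]_x (F x)%:E)%E.
Proof.
move=> mF F0 bm bF; apply: monotone_integral_cvg.
- by move=> n; exact: meas_EFin.
- by move=> n x; rewrite lee_fin; case: ifPn.
- by move=> x; apply: cut_homo => // n n'; exact: bm.
- by move=> x; apply: cut_cvg => [n n'|]; [exact: bm|exact: bF].
Qed.

Lemma exhaust_iterated_integral (b : nat -> T1 -> T2 -> bool) (F : T1 -> T2 -> R) :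
  (forall n, measurable_fun setT (fun z : T1 * T2 => if b n z.1 z.2 then F z.1 z.2 else 0)) ->
  (forall x y, 0 <= F x y) ->
  (forall n n' x y, (n <= n')%N -> b n x y -> b n' x y) ->
  (forall x y, F x y != 0 -> exists n, b n x y) ->
  (\int[m1]_x \int[m2]_y (if b n x y then F x y else 0)%:E)%E @[n --> \oo] -->
  (\int[m1]_x \int[m2]_y (F x y)%:E)%E.
Proof.
move=> mF F0 bm bF.
have c0 n x y : 0 <= if b n x y then F x y else 0 by case: ifPn.
apply: monotone_integral_cvg.
- by move=> n; apply: (measurable_inner m2 (F := fun x y => if b n x y then F x y else 0)).
- by move=> n x; apply: integral_ge0 => y _; rewrite lee_fin.
- move=> x n n' nn'; apply: ge0_le_integral.
  + exact: measurableT.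
  + by move=> y _; rewrite lee_fin.
  + apply: meas_EFin; exact: (measurable_section (F := fun x y => if b n x y then F x y else 0)).
  + apply: meas_EFin; exact: (measurable_section (F := fun x y => if b n' x y then F x y else 0)).
  + by move=> y _; apply: (@cut_homo (fun n => b n x y)) => // i j; exact: bm.
- move=> x; apply: monotone_integral_cvg.
  + move=> n; apply: meas_EFin.
    exact: (measurable_section (F := fun x y => if b n x y then F x y else 0)).
  + by move=> n y; rewrite lee_fin.
  + by move=> y; apply: (@cut_homo (fun n => b n x y)) => // n n'; exact: bm.
  + by move=> y; apply: cut_cvg => [n n'|]; [exact: bm|exact: bF].
Qed.

End exhaustion.

(** * The two halves of the Picone term over truncated cones *)

Section cone_energy.
Context {R : realType}.
Local Notation leb := (@lebesgue_measure R).

Lemma meas_cone_part d (T : measurableType d) (p gam : R) c (delta : R) (f g h : T -> R) :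
  measurable_fun setT f -> measurable_fun setT g -> measurable_fun setT h ->
  measurable_fun setT (fun z => cone_part p gam c delta (f z) (g z) (h z)).
Proof.
by move=> mf mg mh; rewrite /cone_part /cone /profile; case: c; meas.
Qed.

Lemma cone_part_ge0 p gam c (delta X Y A : R) : 0 <= A -> 0 <= cone_part p gam c delta X Y A.
Proof. by move=> A0; rewrite /cone_part; case: ifPn => // _; rewrite mulr_ge0 ?profile_ge0. Qed.

Lemma cone_partM p gam c (delta X Y A : R) :
  cone_part p gam c delta X Y A = A * cone_part p gam c delta X Y 1.
Proof. by rewrite /cone_part; case: ifPn => _; rewrite ?mulr0// mulr1 mulrC. Qed.

Context (k m : nat) (s p alpha beta : R).
Local Notation sg := (s * p).
Local Notation gam := ((k%:R + alpha + beta - sg) / p).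
Local Notation mu := (lebn (k + m)).

(** The density in r, the ratio of the smaller of |x_k|, |y_k| to the larger, after the kernel is
    folded onto (0, 1); [c] tells whether x has the smaller one. The two choices differ only by the
    factor r^gam. *)
Definition cone_weight (c : bool) (delta r : R) : R :=
  if r < delta then (if c then 1 else r `^ gam) * profile p gam r * r `^ (sg - 1) *
    (r `^ (- alpha) + r `^ (- beta)) else 0.

Lemma cone_weight_ge0 c delta r : 0 <= cone_weight c delta r.
Proof.
rewrite /cone_weight; case: ifPn => // _.
by case: c; rewrite !mulr_ge0 ?addr_ge0 ?profile_ge0 ?powR_ge0.
Qed.

Lemma meas_cone_weight c delta : measurable_fun setT (cone_weight c delta).
Proof. by rewrite /cone_weight /profile; case: c; meas. Qed.

Definition kern (x y : 'rV[R]_(k + m)) : R :=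
  pnorm k x `^ alpha * pnorm k y `^ beta / enorm (x - y) `^ ((k + m)%:R + sg).

Lemma kern_ge0 x y : 0 <= kern x y.
Proof. by rewrite !mulr_ge0 ?invr_ge0 ?powR_ge0. Qed.

Lemma meas_kern d (T : measurableType d) (f g : T -> 'rV[R]_(k + m)) :
  measurable_fun setT f -> measurable_fun setT g ->
  measurable_fun setT (fun z => kern (f z) (g z)).
Proof. by move=> mf mg; rewrite /kern; meas. Qed.

(** Of the points X r and X / r brought together by the fold, each cone contains at most one, and
    only for r < delta. So the two halves become integrals over the same interval and can be
    compared pointwise. *)
Lemma cone_weight_scale c (delta X r : R) : p != 0 -> 0 < delta < 1 -> 0 < X -> 0 < r < 1 -> (0 < k)%N ->
  let g rho := cone_part p gam c delta X rho 1 * (X `^ alpha * rho `^ beta + X `^ beta * rho `^ alpha) in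
  g (X * r) * r ^+ k.-1 + g (X / r) * r `^ (sg - 1) = X `^ (alpha + beta) * cone_weight c delta r.
Proof.
move=> p0 /andP[d0 d1] X0 /andP[r0 r1] k0 /=.
have X1 : X != 0 by rewrite gt_eqF.
have r1' : r != 0 by rewrite gt_eqF.
have Xr0 : 0 < X * r by rewrite mulr_gt0.
have Xr1 : 0 < X / r by rewrite divr_gt0.
have dr : delta * r < 1.
  by apply: le_lt_trans (ler_wpM2r (ltW r0) (ltW d1)) _; rewrite mul1r.
rewrite /cone_part /cone /cone_weight X0 Xr0 Xr1 /= !andbT.
have -> : (X < delta * (X * r)) = false.
  by apply/negbTE; rewrite -leNgt mulrCA ger_pMr// ltW.
have -> : (X / r < delta * X) = false.
  apply/negbTE; rewrite -leNgt ler_pdivlMr// mulrAC ger_pMl//; exact: ltW.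
have -> : (X < delta * (X / r)) = (r < delta).
  by rewrite mulrA ltr_pdivlMr// [delta * X]mulrC ltr_pM2l.
have -> : (X * r < delta * X) = (r < delta) by rewrite [delta * X]mulrC ltr_pM2l.
have -> : X / (X / r) = r by rewrite invf_div mulrCA divff ?mulr1.
have -> : X / (X * r) = r^-1 by rewrite invfM mulrA divff ?mul1r.
have PX a b : X `^ (a + b) = X `^ a * X `^ b by rewrite powRD ?X1 ?implybT.
have Pr a b : r `^ (a + b) = r `^ a * r `^ b by rewrite powRD ?r1' ?implybT.
case: c => /=.
  case: ifPn => _; last by rewrite !mul0r add0r mulr0.
  rewrite !mul0r add0r mul1r mulr1 !powR_div ?ltW// PX.
  move: (profile _ _ _) (X `^ _) (X `^ _) (r `^ _) (r `^ _) (r `^ _) => a b e f g h.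
  by ring.
case: ifPn => _; last by rewrite !mul0r addr0 mulr0.
rewrite !mul0r addr0 mulr1 !powRM ?(ltW X0) ?(ltW r0)// PX.
(* The second cone evaluates [profile] at 1/r, and |1 - r^(-gam)| = r^(-gam) |1 - r^gam|. *)
have -> : profile p gam r^-1 = r `^ (- (gam * (p - 1))) * profile p gam r.
  rewrite /profile -[r^-1]mul1r powR_div ?ler01 ?(ltW r0)// powR1 mul1r.
  have -> : 1 - r `^ (- gam) = r `^ (- gam) * (r `^ gam - 1).
    by rewrite mulrBr mulr1 -Pr addNr powRr0.
  by rewrite normrM powRM// distrC ger0_norm ?powR_ge0// -powRrM mulNr.
(* The exponents agree because gam p = k + alpha + beta - s p: it is this choice of gam that gives
   both cones the same powers of r up to r^gam. [E1] and [E2] exchange alpha and beta. *)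
have E1 : r `^ (- (gam * (p - 1))) * r ^+ k.-1 * r `^ beta = r `^ gam * r `^ (sg - 1) * r `^ (- alpha).
  rewrite -powR_mulrn ?(ltW r0)// -!Pr; congr (_ `^ _).
  have -> : k.-1%:R = k%:R - 1 :> R by rewrite -[in RHS](prednK k0) -natr1 addrK.
  by field.
have E2 : r `^ (- (gam * (p - 1))) * r ^+ k.-1 * r `^ alpha = r `^ gam * r `^ (sg - 1) * r `^ (- beta).
  rewrite -powR_mulrn ?(ltW r0)// -!Pr; congr (_ `^ _).
  have -> : k.-1%:R = k%:R - 1 :> R by rewrite -[in RHS](prednK k0) -natr1 addrK.
  by field.
have E3 : r `^ (- (gam * (p - 1))) * r ^+ k.-1 * (r `^ beta + r `^ alpha) =
    r `^ gam * r `^ (sg - 1) * (r `^ (- alpha) + r `^ (- beta)).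
  by rewrite mulrDr E1 E2 mulrDr.
move: (profile _ _ _) E3 => Q E3.
transitivity (X `^ alpha * X `^ beta * Q * (r `^ (- (gam * (p - 1))) * r ^+ k.-1 * (r `^ beta + r `^ alpha))).
  clear E1 E2 E3; move: (_ ^+ _) (X `^ _) (X `^ _) (r `^ _) (r `^ _) (r `^ _) => a b e f g h.
  by ring.
rewrite E3; clear E1 E2 E3; move: (r `^ gam) (r `^ (sg - 1)) (r `^ _ + _) => a b e.
by ring.
Qed.

Variable u : 'rV[R]_(k + m) -> R.
Hypothesis measurable_u : measurable_fun setT u.
Local Notation G x := (`|u x| `^ p).

Definition cone_energy (c : bool) (delta : R) : \bar R :=
  (\int[mu]_y \int[mu]_x
    ((cone_part p gam c delta (pnorm k x) (pnorm k y) (G x) +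
      cone_part p gam c delta (pnorm k y) (pnorm k x) (G y)) * kern x y)%:E)%E.

Lemma meas_cone_part2 c delta : measurable_fun setT
  (fun z : 'rV[R]_(k + m) * 'rV[R]_(k + m) =>
    cone_part p gam c delta (pnorm k z.1) (pnorm k z.2) (G z.1)).
Proof.
apply: meas_cone_part; [by clear; meas|by clear; meas|].
by apply: meas_powR; apply: meas_norm; exact: (measurableT_comp measurable_u measurable_fst).
Qed.

Lemma meas_swap (F : 'rV[R]_(k + m) * 'rV[R]_(k + m) -> R) :
  measurable_fun setT F -> measurable_fun setT (fun z => F (z.2, z.1)).
Proof.
move=> mF; apply: (measurableT_comp mF).
by apply: meas_pair; [exact: measurable_snd|exact: measurable_fst].
Qed.

(** Exchanging x and y in the second summand leaves one cone part against the symmetrized kernel,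
    with |u x|^p outside the inner integral. *)
Lemma cone_energyE c delta : cone_energy c delta =
  (\int[mu]_x \int[mu]_y (cone_part p gam c delta (pnorm k x) (pnorm k y) (G x) *
     (kern x y + kern y x))%:E)%E.
Proof.
pose a (x y : 'rV[R]_(k + m)) := cone_part p gam c delta (pnorm k x) (pnorm k y) (G x).
have a0 x y : 0 <= a x y by apply: cone_part_ge0; exact: powR_ge0.
have ma : measurable_fun setT (fun z : 'rV[R]_(k + m) * 'rV[R]_(k + m) => a z.1 z.2).
  exact: meas_cone_part2.
have mK : measurable_fun setT (fun z : 'rV[R]_(k + m) * 'rV[R]_(k + m) => kern z.1 z.2).
  by apply: meas_kern; [exact: measurable_fst|exact: measurable_snd].
rewrite /cone_energy -[LHS]/(\int[mu]_y \int[mu]_x ((a x y + a y x) * kern x y)%:E)%E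
  -[RHS]/(\int[mu]_x \int[mu]_y (a x y * (kern x y + kern y x))%:E)%E.
clearbody a.
have ma' := meas_swap ma; have mK' := meas_swap mK; rewrite /= in ma' mK'.
have K0 := kern_ge0.
transitivity (\int[mu]_y \int[mu]_x (a x y * kern x y)%:E + \int[mu]_y \int[mu]_x (a y x * kern x y)%:E)%E.
  under eq_integral do under eq_integral do rewrite mulrDl.
  apply: (iterated_integralD mu mu (F := fun y x => a x y * kern x y) (H := fun y x => a y x * kern x y)).
  - exact: (meas_mul ma' mK').
  - exact: (meas_mul ma mK').
  - by move=> y x; rewrite mulr_ge0.
  - by move=> y x; rewrite mulr_ge0.
under [RHS]eq_integral do under eq_integral do rewrite mulrDr.
rewrite (iterated_integralD mu mu (F := fun x y => a x y * kern x y) (H := fun x y => a x y * kern y x)); last 4 first.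
- exact: (meas_mul ma mK).
- exact: (meas_mul ma mK').
- by move=> y x; rewrite mulr_ge0.
- by move=> y x; rewrite mulr_ge0.
apply: (congr1 (fun z => z + _)%E).
apply: (@tonelli_swap _ _ _ _ R mu mu (fun y x => (a x y * kern x y)%:E)).
- exact: (meas_EFin (meas_mul ma' mK')).
- by move=> x y; rewrite lee_fin mulr_ge0.
Qed.

End cone_energy.

Section cone_energy_value.
Context {R : realType}.
Local Notation leb := (@lebesgue_measure R).
Context (k m : nat) (s p alpha beta : R).
Local Notation sg := (s * p).
Local Notation gam := ((k%:R + alpha + beta - sg) / p).
Local Notation mu := (@lebn R (k + m)).
Hypotheses (k0 : (0 < k)%N) (p0 : p != 0) (ks : 0 < k%:R + sg).

Definition cone_mass (c : bool) (delta : R) : \bar R :=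
  (\int[leb]_(r in `]0%R, 1%R[) (cone_weight k s p alpha beta c delta r * Phi k s p r)%:E)%E.

Lemma cone_mass_ge0 c delta : (0 <= cone_mass c delta)%E.
Proof.
apply: integral_ge0 => r; rewrite /= in_itv/= => r01.
by rewrite lee_fin mulr_ge0 ?cone_weight_ge0// Phi_ge0// ltW.
Qed.

Lemma inner_cone (c : bool) (delta : R) (x : 'rV[R]_(k + m)) (A : R) :
  0 < delta < 1 -> 0 <= A -> 0 < pnorm k x ->
  (\int[mu]_y (cone_part p gam c delta (pnorm k x) (pnorm k y) A *
     (kern s p alpha beta x y + kern s p alpha beta y x))%:E =
   (dim_const k m sg * (A * pnorm k x `^ (alpha + beta - sg)))%:E * cone_mass c delta)%E.
Proof.
move=> d01 A0 x0.
pose g X rho := cone_part p gam c delta X rho 1 * (X `^ alpha * rho `^ beta + X `^ beta * rho `^ alpha).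
have g0 X r : 0 <= g X r by rewrite mulr_ge0 ?cone_part_ge0 ?addr_ge0 ?mulr_ge0 ?powR_ge0.
have mg X : measurable_fun setT (g X).
  apply: meas_mul; last by clear; meas.
  by apply: (@meas_cone_part _ _ _ _ _ _ _ (fun=> X) (fun r => r) (fun=> 1)); clear; meas.
(* delta < 1 keeps |y_k| = |x_k| out of both cones, as [inner_integral] requires. *)
have gx : g (pnorm k x) (pnorm k x) = 0.
  have /andP[_ d1] := d01.
  have h : (pnorm k x < delta * pnorm k x) = false.
    by apply/negbTE; rewrite -leNgt ger_pMl// ltW.
  by rewrite /g /cone_part /cone h if_same mul0r.
have E y : cone_part p gam c delta (pnorm k x) (pnorm k y) A * (kern s p alpha beta x y + kern s p alpha beta y x) =
    A * (g (pnorm k x) (pnorm k y) / enorm (x - y) `^ ((k + m)%:R + sg)).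
  rewrite cone_partM /kern /g -[y - x]opprB enormN -mulrDl.
  by rewrite [pnorm k y `^ alpha * _]mulrC !mulrA.
have ggE r : 0 < r < 1 -> g (pnorm k x) (pnorm k x * r) * r ^+ k.-1 + g (pnorm k x) (pnorm k x / r) * r `^ (sg - 1) =
    pnorm k x `^ (alpha + beta) * cone_weight k s p alpha beta c delta r.
  by move=> r01; exact: cone_weight_scale.
transitivity (A%:E * \int[mu]_y (g (pnorm k x) (pnorm k y) / enorm (x - y) `^ ((k + m)%:R + sg))%:E)%E.
  rewrite -[RHS]ge0_integralZl; last 4 first.
  - exact: measurableT.
  - apply: meas_EFin; apply: meas_mul; last by clear; meas.
    by apply: (measurableT_comp (mg _)); clear; meas.
  - by move=> y _; rewrite lee_fin divr_ge0 ?powR_ge0.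
  - by rewrite lee_fin.
  by apply: eq_integral => y _; rewrite E EFinM.
clear E; rewrite (inner_integral k0 ks (mg _) (g0 _) x0 gx).
rewrite /cone_mass; clearbody g.
transitivity (A%:E * ((dim_const k m sg * pnorm k x `^ (- sg))%:E * ((pnorm k x `^ (alpha + beta))%:E *
  \int[leb]_(r in `]0%R, 1%R[) (cone_weight k s p alpha beta c delta r * Phi k s p r)%:E)))%E.
  apply: (congr1 (fun z => _ * (_ * z))%E).
  rewrite -[RHS]ge0_integralZl; last 4 first.
  - exact: measurable_itv.
  - apply/measurable_EFinP; apply: measurable_funM; last by apply: meas_Phi => //; exact: ltW.
    by apply: measurable_funTS; exact: meas_cone_weight.
  - move=> r; rewrite /= in_itv/= => r01; rewrite lee_fin mulr_ge0 ?cone_weight_ge0//.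
    by rewrite Phi_ge0// ltW.
  - by rewrite lee_fin powR_ge0.
  apply: eq_integral => r; rewrite inE/= in_itv/= => r01.
  by rewrite ggE// -EFinM mulrA.
rewrite !muleA -!EFinM; apply: (congr1 (fun z => z%:E * _)%E).
have -> : pnorm k x `^ (alpha + beta - sg) = pnorm k x `^ (- sg) * pnorm k x `^ (alpha + beta).
  by rewrite -powRD ?(gt_eqF x0) ?implybT//; congr (_ `^ _); rewrite addrC.
by rewrite mulrCA !mulrA.
Qed.

Variable u : 'rV[R]_(k + m) -> R.
Hypothesis measurable_u : measurable_fun setT u.

Lemma cone_energy_hardy (c : bool) (delta : R) : 0 < delta < 1 -> sg - alpha - beta != 0 ->
  (cone_energy s p alpha beta u c delta =
   (dim_const k m sg)%:E * cone_mass c delta * hardy_term k s p alpha beta u)%E.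
Proof.
move=> d01 t0; rewrite cone_energyE// /hardy_term.
rewrite -[RHS]/((dim_const k m sg)%:E * cone_mass c delta *
   \int[mu]_x (`|u x| `^ p / pnorm k x `^ (sg - alpha - beta))%:E)%E.
rewrite -[RHS]ge0_integralZl; last 4 first.
- exact: measurableT.
- by apply: meas_EFin; clear -measurable_u; meas.
- by move=> x _; rewrite lee_fin divr_ge0 ?powR_ge0.
- by rewrite mule_ge0 ?cone_mass_ge0// lee_fin ltW// dim_const_gt0.
apply: eq_integral => x _.
have [X0|X0] := ltP 0 (pnorm k x).
  rewrite inner_cone ?powR_ge0// [in RHS]muleAC -EFinM.
  apply: (congr1 (fun z => (_ * (_ * z))%:E * _)%E).
  by rewrite -powRN; congr (_ `^ _); ring.
have -> : pnorm k x = 0 by apply/eqP; rewrite eq_le X0 sqrtr_ge0.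
(* On x_k = 0 the Hardy integrand is the junk value |u(x)|^p / 0 = 0. *)
rewrite powR0// invr0 mulr0 mule0; apply: integral0_eq => y _.
by rewrite /cone_part ltxx andbF mul0r.
Qed.

End cone_energy_value.

(** * The difference of the two halves is the truncated Hardy integral *)

Section truncated_inequality.
Context {R : realType}.
Local Notation leb := (@lebesgue_measure R).
Context (k m : nat) (s p alpha beta : R).
Local Notation sg := (s * p).
Local Notation gam := ((k%:R + alpha + beta - sg) / p).
Local Notation mu := (@lebn R (k + m)).
Hypotheses (k0 : (0 < k)%N) (p1 : 1 < p) (sg0 : 0 < sg) (g0 : gam != 0).

Lemma profile_powR r : `|1 - r `^ gam| `^ p = `|1 - r `^ gam| * profile p gam r.
Proof. by rewrite /profile mulr_powRB1//; exact: lt_trans p1. Qed.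

Definition hardy_cut (delta r : R) : R :=
  if r < delta then r `^ (sg - 1) * (r `^ (- alpha) + r `^ (- beta)) * `|1 - r `^ gam| `^ p else 0.

Lemma hardy_cut_ge0 delta r : 0 <= hardy_cut delta r.
Proof. by rewrite /hardy_cut; case: ifPn => // _; rewrite !mulr_ge0 ?addr_ge0 ?powR_ge0. Qed.

(** The two weights differ by the factor 1 - r^gam, which completes [profile] to |1 - r^gam|^p;
    choosing the cones by the sign of gam makes the difference nonnegative. *)
Lemma cone_weightB delta r : 0 < r < 1 ->
  cone_weight k s p alpha beta (0 < gam) delta r =
  cone_weight k s p alpha beta (gam <= 0) delta r + hardy_cut delta r.
Proof.
move=> r01; have /andP[r0 r1] := r01; rewrite /cone_weight /hardy_cut.
case: ifPn => _; last by rewrite addr0.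
rewrite profile_powR; have [gp|gn] := ltP 0 gam.
  rewrite ger0_norm; last by rewrite subr_ge0 powR_le1_le1 ?(ltW r0) ?(ltW r1)// ltW.
  move: (profile _ _ _) (r `^ gam) (r `^ (sg - 1)) (r `^ _ + _) => a b c e.
  by ring.
rewrite ler0_norm; last by rewrite subr_le0 powR_le1_ge1// r0 ltW.
move: (profile _ _ _) (r `^ gam) (r `^ (sg - 1)) (r `^ _ + _) => a b c e.
by ring.
Qed.

(** This is the gain of the truncation: for r < delta the factor |1 - r^gam| missing from the weight
    is bounded below, by |1 - delta^gam| if gam < 0 and by r^gam times that if gam > 0. So the
    subtracted half has finite mass. *)
Lemma cone_weight_le delta r : 0 < delta < 1 -> 0 < r < 1 ->
  cone_weight k s p alpha beta (gam <= 0) delta r <=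
  `|1 - delta `^ gam|^-1 * hardy_cut delta r.
Proof.
move=> /andP[d0 d1] /andP[r0 r1]; rewrite /cone_weight /hardy_cut.
have e0 : 0 < `|1 - delta `^ gam|.
  rewrite normr_gt0 subr_eq0; apply/eqP => h.
  by have := powRK g0 (ltW d0); rewrite -h powR1 => e1; move: d1; rewrite -e1 ltxx.
case: ifPn => rd; last by rewrite mulr0.
rewrite profile_powR.
have w0 : 0 <= profile p gam r * (r `^ (sg - 1) * (r `^ (- alpha) + r `^ (- beta))).
  by rewrite !mulr_ge0 ?profile_ge0 ?addr_ge0 ?powR_ge0.
have -> t : t * profile p gam r * r `^ (sg - 1) * (r `^ (- alpha) + r `^ (- beta)) =
  t * (profile p gam r * (r `^ (sg - 1) * (r `^ (- alpha) + r `^ (- beta)))) by rewrite !mulrA.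
have -> : r `^ (sg - 1) * (r `^ (- alpha) + r `^ (- beta)) * (`|1 - r `^ gam| * profile p gam r) =
  `|1 - r `^ gam| * (profile p gam r * (r `^ (sg - 1) * (r `^ (- alpha) + r `^ (- beta)))).
  by rewrite mulrC -!mulrA.
rewrite [leRHS]mulrA; apply: ler_wpM2r => //; rewrite ler_pdivlMl//.
have [gp|gn] := ltP 0 gam.
  have h1 : r `^ gam <= 1 by rewrite powR_le1_le1 ?(ltW r0) ?(ltW r1)// ltW.
  have h2 : delta `^ gam <= 1 by rewrite powR_le1_le1 ?(ltW d0) ?(ltW d1)// ltW.
  have h3 : r `^ gam <= delta `^ gam by apply: ler_powR2r; apply: ltW.
  have h4 := powR_ge0 r gam.
  rewrite !ger0_norm ?subr_ge0//.
  have : (1 - delta `^ gam) * r `^ gam <= 1 - delta `^ gam by rewrite ler_piMr// subr_ge0.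
  by lra.
have h1 : 1 <= r `^ gam by rewrite powR_le1_ge1// r0 ltW.
have h2 : 1 <= delta `^ gam by rewrite powR_le1_ge1// d0 ltW.
have h3 : delta `^ gam <= r `^ gam.
  rewrite -[gam]opprK !(powRN _ (- gam)) lef_pV2 ?posrE ?powR_gt0//.
  by apply: ler_powR2r; rewrite ?oppr_ge0 ?(ltW r0)// ltW.
by rewrite mulr1 !ler0_norm ?subr_le0//; lra.
Qed.

Definition cut_integral (delta : R) : \bar R :=
  (\int[leb]_(r in `]0%R, 1%R[) (hardy_cut delta r * Phi k s p r)%:E)%E.

Let Phi0 (r : R) : 0 < r < 1 -> 0 <= Phi k s p r.
Proof. by move=> r01; apply: Phi_ge0 => //; rewrite addr_ge0// ltW. Qed.

Let mPhi : measurable_fun (`]0, 1[%classic : set R) (Phi k s p).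
Proof. by apply: meas_Phi => //; rewrite addr_ge0// ltW. Qed.

Lemma meas_hardy_cut delta : measurable_fun setT (hardy_cut delta).
Proof. by rewrite /hardy_cut; meas. Qed.

Let mcut delta : measurable_fun (`]0, 1[%classic : set R) (fun r => (hardy_cut delta r * Phi k s p r)%:E).
Proof. by apply/measurable_EFinP; apply: measurable_funM => //; apply: measurable_funTS; exact: meas_hardy_cut. Qed.

Let mcone c delta : measurable_fun (`]0, 1[%classic : set R) (fun r => (cone_weight k s p alpha beta c delta r * Phi k s p r)%:E).
Proof. by apply/measurable_EFinP; apply: measurable_funM => //; apply: measurable_funTS; exact: meas_cone_weight. Qed.

Lemma cone_massB delta :
  cone_mass k s p alpha beta (0 < gam) delta =
  (cone_mass k s p alpha beta (gam <= 0)%R delta + cut_integral delta)%E.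
Proof.
rewrite /cone_mass /cut_integral -[RHS]ge0_integralD; last 5 first.
- exact: measurable_itv.
- by move=> r; rewrite /= in_itv/= => r01; rewrite lee_fin mulr_ge0 ?cone_weight_ge0 ?Phi0.
- exact: mcone.
- by move=> r; rewrite /= in_itv/= => r01; rewrite lee_fin mulr_ge0 ?hardy_cut_ge0 ?Phi0.
- exact: mcut.
apply: eq_integral => r; rewrite inE/= in_itv/= => r01.
by rewrite cone_weightB// mulrDl EFinD.
Qed.

Lemma cut_integral_le delta : (cut_integral delta <= hardy_integral k s p alpha beta)%E.
Proof.
apply: ge0_le_integral.
- exact: measurable_itv.
- by move=> r; rewrite /= in_itv/= => r01; rewrite lee_fin mulr_ge0 ?hardy_cut_ge0 ?Phi0.
- exact: mcut.
- apply/measurable_EFinP; apply: measurable_funM => //; apply: measurable_funTS.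
  by clear; meas.
move=> r; rewrite /= in_itv/= => r01; rewrite lee_fin ler_wpM2r ?Phi0//.
by rewrite /hardy_cut; case: ifPn => // _; rewrite !mulr_ge0 ?addr_ge0 ?powR_ge0.
Qed.

Lemma cone_mass_fin delta : 0 < delta < 1 -> (hardy_integral k s p alpha beta < +oo)%E ->
  cone_mass k s p alpha beta (gam <= 0) delta \is a fin_num.
Proof.
move=> d01 hfin; rewrite ge0_fin_numE; last first.
  by apply: cone_mass_ge0 => //; rewrite ltr_wpDl.
apply: (@le_lt_trans _ _ (`|1 - delta `^ gam|^-1%:E * cut_integral delta)%E); last first.
  apply: lte_mul_pinfty; [by rewrite lee_fin|by []|].
  by apply: le_lt_trans hfin; exact: cut_integral_le.
clear hfin; rewrite -ge0_integralZl; last 4 first.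
- exact: measurable_itv.
- exact: mcut.
- by move=> r; rewrite /= in_itv/= => r01; rewrite lee_fin mulr_ge0 ?hardy_cut_ge0 ?Phi0.
- by rewrite lee_fin.
apply: ge0_le_integral.
- exact: measurable_itv.
- by move=> r; rewrite /= in_itv/= => r01; rewrite lee_fin mulr_ge0 ?cone_weight_ge0 ?Phi0.
- exact: mcone.
- by apply: emeasurable_funM => //; exact: mcut.
move=> r; rewrite /= in_itv/= => r01; rewrite -EFinM lee_fin mulrA.
by rewrite ler_wpM2r ?Phi0// cone_weight_le.
Qed.

End truncated_inequality.

Section limit.
Context {R : realType}.
Local Notation leb := (@lebesgue_measure R).

(** n + 2 rather than n + 1 makes the first cutoff positive. *)
Definition cutoff (n : nat) : R := 1 - n.+2%:R^-1.

Lemma cutoff01 n : 0 < cutoff n < 1.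
Proof.
rewrite /cutoff subr_gt0 invf_lt1 ?ltr0n// ltr1n/=.
by rewrite gtrDl oppr_lt0 invr_gt0 ltr0n.
Qed.

Lemma le_cutoff n n' : (n <= n')%N -> cutoff n <= cutoff n'.
Proof. by move=> nn'; rewrite lerD2l lerN2 lef_pV2 ?posrE ?ltr0n// ler_nat !ltnS. Qed.

Lemma lt_cutoff r : r < 1 -> exists n, r < cutoff n.
Proof.
rewrite -subr_gt0 => r1; have i0 : 0 < (1 - r)^-1 by rewrite invr_gt0.
exists (Num.bound (1 - r)^-1).
have := archi_boundP (ltW i0); set N := Num.bound _ => h.
rewrite /cutoff ltrBrDr -ltrBrDl -[ltRHS]invrK ltf_pV2 ?posrE ?ltr0n//.
by apply: lt_le_trans h _; rewrite ler_nat -addn2 leq_addr.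
Qed.

End limit.

Lemma le_mul_kernel (R : realType) (A c Z B D K rho e : R) :
  A + c * Z <= B + D -> 0 <= K -> Z * K = rho -> B * K = e ->
  A * K + c * rho <= e + D * K.
Proof.
by move=> h K0 <- <-; rewrite mulrA -!mulrDl; exact: ler_wpM2r.
Qed.

(** * Picone's inequality integrated over the truncated region *)

Section truncated_picone.
Context {R : realType}.
Local Notation leb := (@lebesgue_measure R).
Context (k m : nat) (s p alpha beta : R).
Local Notation sg := (s * p).
Local Notation gam := ((k%:R + alpha + beta - sg) / p).
Local Notation mu := (@lebn R (k + m)).
Variable u : 'rV[R]_(k + m) -> R.
Hypothesis measurable_u : measurable_fun setT u.

Definition energy_density (x y : 'rV[R]_(k + m)) : R :=
  `|u x - u y| `^ p / enorm (x - y) `^ ((k + m)%:R + sg) *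
  pnorm k x `^ alpha * pnorm k y `^ beta.

Definition remainder_density (x y : 'rV[R]_(k + m)) : R :=
  let v := ground_state k s p alpha beta u in
  (spow (v x) (p / 2) - spow (v y) (p / 2)) ^+ 2 /
  enorm (x - y) `^ ((k + m)%:R + sg) * W k s p alpha beta x y *
  pnorm k x `^ alpha * pnorm k y `^ beta.

Definition cut_remainder (delta : R) : \bar R :=
  (\int[mu]_y \int[mu]_x
    (if off_diagonal delta (pnorm k x) (pnorm k y) then remainder_density x y else 0)%:E)%E.

Lemma W_ge0 x y : 0 <= @W R (k + m) k s p alpha beta x y.
Proof. by rewrite mulr_ge0 ?powR_ge0// le_min !powR_ge0. Qed.

Lemma remainder_density_ge0 x y : 0 <= remainder_density x y.
Proof.
apply: mulr_ge0; last exact: powR_ge0.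
apply: mulr_ge0; last exact: powR_ge0.
apply: mulr_ge0; last exact: W_ge0.
by apply: divr_ge0; [exact: sqr_ge0|exact: powR_ge0].
Qed.

Lemma energy_density_ge0 x y : 0 <= energy_density x y.
Proof. by rewrite !mulr_ge0 ?invr_ge0 ?powR_ge0. Qed.

Let mux : measurable_fun setT (fun z : 'rV[R]_(k + m) * 'rV[R]_(k + m) => u z.1).
Proof. exact: (measurableT_comp measurable_u measurable_fst). Qed.

Let muy : measurable_fun setT (fun z : 'rV[R]_(k + m) * 'rV[R]_(k + m) => u z.2).
Proof. exact: (measurableT_comp measurable_u measurable_snd). Qed.

Lemma meas_W : measurable_fun setT
  (fun z : 'rV[R]_(k + m) * 'rV[R]_(k + m) => W k s p alpha beta z.1 z.2).
Proof. by clear; rewrite /W; meas. Qed.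

Lemma meas_energy_density : measurable_fun setT
  (fun z : 'rV[R]_(k + m) * 'rV[R]_(k + m) => energy_density z.1 z.2).
Proof. by clear -mux muy; rewrite /energy_density; meas. Qed.

Lemma meas_remainder_density : measurable_fun setT
  (fun z : 'rV[R]_(k + m) * 'rV[R]_(k + m) => remainder_density z.1 z.2).
Proof.
have mW := meas_W; clear -mux muy mW; rewrite /remainder_density /ground_state.
by meas.
Qed.

Lemma meas_off_diagonal delta : measurable_fun setT
  (fun z : 'rV[R]_(k + m) * 'rV[R]_(k + m) => off_diagonal delta (pnorm k z.1) (pnorm k z.2)).
Proof. by clear; rewrite /off_diagonal; meas. Qed.

Lemma meas_cut_remainder delta : measurable_fun setT
  (fun z : 'rV[R]_(k + m) * 'rV[R]_(k + m) =>
    if off_diagonal delta (pnorm k z.1) (pnorm k z.2) then remainder_density z.1 z.2 else 0).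
Proof.
apply: meas_if; [exact: meas_off_diagonal|exact: meas_remainder_density|exact: measurable_cst].
Qed.

Lemma meas_cone_sum c delta : measurable_fun setT
  (fun z : 'rV[R]_(k + m) * 'rV[R]_(k + m) =>
    (cone_part p gam c delta (pnorm k z.1) (pnorm k z.2) (`|u z.1| `^ p) +
     cone_part p gam c delta (pnorm k z.2) (pnorm k z.1) (`|u z.2| `^ p)) *
    kern s p alpha beta z.1 z.2).
Proof.
apply: meas_mul; last by apply: meas_kern; [exact: measurable_fst|exact: measurable_snd].
apply: meas_add; first exact: meas_cone_part2.
exact: (meas_swap (meas_cone_part2 s p alpha beta measurable_u c delta)).
Qed.

(** The negative half stands on the right, so that all integrands are nonnegative and the pointwise
    inequality can be integrated before any finiteness is known. *)
Lemma truncated_picone (c delta : R) (P : R -> bool) : 0 <= c -> 1 < p ->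
  picone_const p c P -> gam != 0 -> 0 < delta < 1 ->
  (forall x, P (ground_state k s p alpha beta u x)) ->
  (cone_energy s p alpha beta u (0 < gam)%R delta + c%:E * cut_remainder delta <=
   energy k s p alpha beta u + cone_energy s p alpha beta u (gam <= 0)%R delta)%E.
Proof.
move=> c0 p1 pc g0 d01 Pu.
have cone0 b (x y : 'rV[R]_(k + m)) : 0 <= (cone_part p gam b delta (pnorm k x) (pnorm k y) (`|u x| `^ p) +
     cone_part p gam b delta (pnorm k y) (pnorm k x) (`|u y| `^ p)) * kern s p alpha beta x y.
  by rewrite mulr_ge0 ?kern_ge0// addr_ge0// cone_part_ge0// powR_ge0.
have rem0 x y : 0 <= if off_diagonal delta (pnorm k x) (pnorm k y) then remainder_density x y else 0.
  by case: ifPn => // _; exact: remainder_density_ge0.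
have mcone b := meas_swap (meas_cone_sum b delta).
have mrem := meas_swap (meas_cut_remainder delta).
rewrite -[energy _ _ _ _ _ _]/(\int[mu]_y \int[mu]_x (energy_density x y)%:E)%E.
rewrite /cut_remainder /cone_energy.
rewrite -(iterated_integralZl mu mu (F := fun y x => if off_diagonal delta (pnorm k x) (pnorm k y) then remainder_density x y else 0)); last 3 first.
- exact: c0.
- exact: mrem.
- by move=> y x; exact: rem0.
rewrite -(iterated_integralD mu mu (F := fun y x => (cone_part p gam (0 < gam)%R delta (pnorm k x) (pnorm k y) (`|u x| `^ p) +
     cone_part p gam (0 < gam)%R delta (pnorm k y) (pnorm k x) (`|u y| `^ p)) * kern s p alpha beta x y)
  (H := fun y x => c * (if off_diagonal delta (pnorm k x) (pnorm k y) then remainder_density x y else 0))); last 4 first.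
- exact: mcone.
- exact: (meas_mul (measurable_cst c) mrem).
- by move=> y x; exact: cone0.
- by move=> y x; exact: mulr_ge0.
rewrite -(iterated_integralD mu mu (F := fun y x => energy_density x y)
  (H := fun y x => (cone_part p gam (gam <= 0)%R delta (pnorm k x) (pnorm k y) (`|u x| `^ p) +
     cone_part p gam (gam <= 0)%R delta (pnorm k y) (pnorm k x) (`|u y| `^ p)) * kern s p alpha beta x y)); last 4 first.
- exact: (meas_swap meas_energy_density).
- exact: mcone.
- by move=> y x; exact: energy_density_ge0.
- by move=> y x; exact: cone0.
apply: le_iterated_integral.
- exact: (meas_add (mcone _) (meas_mul (measurable_cst c) mrem)).
- exact: (meas_add (meas_swap meas_energy_density) (mcone _)).
- by move=> y x; rewrite addr_ge0 ?cone0// mulr_ge0.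
move=> y x; apply: (@le_mul_kernel R _ _ _ _ _ _ _ _ (picone_cone p1 pc g0 d01 (Pu x) (Pu y)) (kern_ge0 s p alpha beta x y)).
- case: ifPn => _; last by rewrite mul0r.
  rewrite /remainder_density /ground_state /kern -[X in _ * X * _ = _]/(W k s p alpha beta x y).
  move: (W k s p alpha beta x y) (spow _ _ - spow _ _) (enorm (x - y) `^ _)^-1 (pnorm k x `^ alpha) (pnorm k y `^ beta) => a b e f g.
  by ring.
- rewrite /energy_density /kern.
  move: (`|u x - u y| `^ p) (enorm (x - y) `^ _)^-1 (pnorm k x `^ alpha) (pnorm k y `^ beta) => a b e f.
  by ring.
Qed.

End truncated_picone.

(** * Cancellation of the finite half and passage to the limit *)

Section hardy_remainder.
Context {R : realType}.
Local Notation leb := (@lebesgue_measure R).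
Context (k m : nat) (s p alpha beta : R).
Local Notation sg := (s * p).
Local Notation gam := ((k%:R + alpha + beta - sg) / p).
Local Notation mu := (@lebn R (k + m)).
Hypotheses (k0 : (0 < k)%N) (p1 : 1 < p) (s01 : 0 < s < 1).
Hypotheses (ha : - k%:R < alpha < sg) (hb : - k%:R < beta < sg).
Hypotheses (hab : alpha + beta < sg) (g0 : gam != 0).

Let p0 : 0 < p. Proof. exact: lt_trans p1. Qed.
Let sg0 : 0 < sg. Proof. by have /andP[? _] := s01; rewrite mulr_gt0. Qed.

Lemma cut_integral_cvg :
  cut_integral k s p alpha beta (cutoff n) @[n --> \oo] --> hardy_integral k s p alpha beta.
Proof.
(* [Phi] is known to be measurable on (0, 1) only; the sphere kernel is measurable on the whole line
   and agrees with it there. *)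
pose F (r : R) := if 0 < r < 1 then
  r `^ (sg - 1) * (r `^ (- alpha) + r `^ (- beta)) * `|1 - r `^ gam| `^ p *
  fine (sphere_kernel k sg 1 r) else 0.
have ks : 0 <= k%:R + sg by rewrite addr_ge0// ltW.
have mF : measurable_fun setT F.
  apply: meas_if; [by clear; meas| |exact: measurable_cst].
  apply: meas_mul; first by clear; meas.
  by apply: (measurableT_comp (f := fine)) => //; exact: meas_sphere_kernel.
have F0 r : 0 <= F r.
  rewrite /F; case: ifPn => // _; rewrite !mulr_ge0 ?addr_ge0 ?powR_ge0//.
  by rewrite fine_ge0// sphere_kernel_ge0.
have in01 (r : R) : (r \in `]0, 1[%classic) = (0 < r < 1).
  by apply/idP/idP; rewrite inE/= in_itv.
have -> : hardy_integral k s p alpha beta = (\int[leb]_r (F r)%:E)%E.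
  rewrite /hardy_integral integral_mkcond; apply: eq_integral => r _.
  rewrite patchE in01 /F; case: ifPn => // r01.
  by rewrite sphere_kernel_Phi.
have -> : (fun n => cut_integral k s p alpha beta (cutoff n)) =
    (fun n => \int[leb]_r (if (r < cutoff n)%R then F r else 0)%:E)%E.
  apply/funext => n; rewrite /cut_integral integral_mkcond; apply: eq_integral => r _.
  rewrite patchE in01 /F /hardy_cut; case: ifPn => r01; last by rewrite if_same.
  by rewrite sphere_kernel_Phi//; case: ifPn => _; rewrite ?mul0r.
apply: (@exhaust_integral _ _ R leb (fun n r => r < cutoff n)).
- move=> n; apply: meas_if; [by clear; meas|exact: mF|exact: measurable_cst].
- exact: F0.
- by move=> n n' r nn' h; apply: lt_le_trans h _; exact: le_cutoff.
- by move=> r; rewrite /F; case: ifPn => [/andP[_ r1] _|]; [exact: lt_cutoff|rewrite eqxx].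
Qed.

Variable u : 'rV[R]_(k + m) -> R.
Hypothesis measurable_u : measurable_fun setT u.

Lemma cut_remainder_cvg :
  cut_remainder s p alpha beta u (cutoff n) @[n --> \oo] --> remainder k s p alpha beta u.
Proof.
apply: (@exhaust_iterated_integral _ _ _ _ R mu mu
  (fun n y x => off_diagonal (cutoff n) (pnorm k x) (pnorm k y))
  (fun y x => remainder_density s p alpha beta u x y)).
- move=> n; exact: (meas_swap (meas_cut_remainder s p alpha beta measurable_u (cutoff n))).
- by move=> y x; exact: remainder_density_ge0.
- move=> n n' y x /le_cutoff nn' /and3P[X0 Y0 h]; rewrite /off_diagonal X0 Y0 /=.
  case/or3P: h => [->//|h|h]; apply/or3P; [apply: Or32|apply: Or33]; apply: lt_le_trans h _.
    exact: (ler_wpM2r (ltW Y0) (nn' R)).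
  exact: (ler_wpM2r (ltW X0) (nn' R)).
move=> y x rN.
have gN : - gam != 0 by rewrite oppr_eq0.
(* 0 to a nonzero power is 0 by convention, so [W] vanishes when |x_k| or |y_k| is 0. A pair with
   nonzero density therefore lies on the diagonal or, for n large, in one of the cones. *)
have X0 : 0 < pnorm k x.
  rewrite lt_neqAle sqrtr_ge0 andbT eq_sym; apply: contraNneq rN => X0.
  by rewrite /remainder_density /W X0 powR0// min_l ?powR_ge0// !(mul0r, mulr0).
have Y0 : 0 < pnorm k y.
  rewrite lt_neqAle sqrtr_ge0 andbT eq_sym; apply: contraNneq rN => Y0.
  by rewrite /remainder_density /W Y0 powR0// min_r ?powR_ge0// !(mul0r, mulr0).
rewrite /off_diagonal X0 Y0 /=.
have [XY|XY|XY] := ltgtP (pnorm k x) (pnorm k y).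
- have [n hn] : exists n, pnorm k x / pnorm k y < cutoff n.
    by apply: lt_cutoff; rewrite ltr_pdivrMr// mul1r.
  by exists n; rewrite -ltr_pdivrMr// hn orbT.
- have [n hn] : exists n, pnorm k y / pnorm k x < cutoff n.
    by apply: lt_cutoff; rewrite ltr_pdivrMr// mul1r.
  by exists n; apply/orP; right; apply/orP; right; rewrite -ltr_pdivrMr.
- by exists 0%N.
Qed.

Hypothesis hardy_fin : (hardy_term k s p alpha beta u < +oo)%E.

Lemma hardy_term_ge0 : (0 <= hardy_term k s p alpha beta u)%E.
Proof. by apply: integral_ge0 => x _; rewrite lee_fin divr_ge0 ?powR_ge0. Qed.

Lemma cut_inequality (c delta : R) (P : R -> bool) : 0 <= c ->
  picone_const p c P -> 0 < delta < 1 ->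
  (forall x, P (ground_state k s p alpha beta u x)) ->
  ((dim_const k m sg)%:E * hardy_term k s p alpha beta u * cut_integral k s p alpha beta delta +
   c%:E * cut_remainder s p alpha beta u delta <= energy k s p alpha beta u)%E.
Proof.
move=> c0 pc d01 Pu.
have ks : 0 < k%:R + sg by rewrite ltr_wpDl.
have t0 : sg - alpha - beta != 0 by rewrite gt_eqF//; move: hab; lra.
have := truncated_picone measurable_u c0 p1 pc g0 d01 Pu.
have pN : p != 0 by rewrite gt_eqF.
rewrite (cone_energy_hardy k0 pN ks measurable_u _ d01 t0) (cone_energy_hardy k0 pN ks measurable_u _ d01 t0).
rewrite (cone_massB alpha beta k0 p1 sg0).
have Mfin := cone_mass_fin k0 p1 sg0 g0 d01 (hardy_integral_lty k0 p1 s01 ha hb).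
have hfin : hardy_term k s p alpha beta u \is a fin_num.
  by rewrite ge0_fin_numE// hardy_term_ge0.
have C0 : (0 <= cut_integral k s p alpha beta delta)%E.
  apply: integral_ge0 => r; rewrite /= in_itv/= => r01.
  by rewrite lee_fin mulr_ge0 ?hardy_cut_ge0 ?Phi_ge0// ltW.
move: (cone_mass _ _ _ _ _ _ _) Mfin => M Mfin.
move: (hardy_term _ _ _ _ _ _) hfin => h hfin.
move: (cut_integral _ _ _ _ _ _) C0 => C C0.
move: (energy _ _ _ _ _ _) (c%:E * _)%E => E S.
have Dfin : (dim_const k m sg)%:E \is a fin_num by [].
move: (dim_const _ _ _)%:E Dfin => D Dfin le.
have zfin : (D * M * h)%E \is a fin_num by rewrite !fin_numM.
(* D M h is the half common to both sides, the energy of the cone with the smaller weight; its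
   finiteness is what permits cancelling it. *)
rewrite -(leeD2lE _ _ zfin) addeA [leRHS]addeC; apply: le_trans le.
rewrite muleDr//; last first.
  by rewrite fin_num_adde_defr.
rewrite muleDl//; last first.
  by rewrite fin_num_adde_defr// fin_numM.
by rewrite [(D * C * h)%E]muleAC.
Qed.

Lemma hardy_remainder_picone (c : R) (P : R -> bool) : 0 <= c ->
  picone_const p c P ->
  (forall x, P (ground_state k s p alpha beta u x)) ->
  hardy_remainder_ineq k s p alpha beta c u.
Proof.
move=> c0 pc Pu.
have hfin : hardy_term k s p alpha beta u \is a fin_num.
  by rewrite ge0_fin_numE// hardy_term_ge0.
have HE := hardy_const1_integral k0 p1 s01 ha hb.
have H0 : (0 <= hardy_integral k s p alpha beta)%E.
  apply: integral_ge0 => r; rewrite /= in_itv/= => r01.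
  by rewrite lee_fin !mulr_ge0 ?addr_ge0 ?powR_ge0// Phi_ge0// addr_ge0// ltW.
have R0 : (0 <= remainder k s p alpha beta u)%E.
  by apply: integral_ge0 => y _; apply: integral_ge0 => x _; rewrite lee_fin remainder_density_ge0.
have Kfin : ((dim_const k m sg)%:E * hardy_term k s p alpha beta u)%E \is a fin_num.
  by rewrite fin_numM.
have cvC := cvgeZl Kfin cut_integral_cvg.
have cvR := cvgeZl (isT : c%:E \is a fin_num) cut_remainder_cvg.
have K0 : (0 <= (dim_const k m sg)%:E * hardy_term k s p alpha beta u)%E.
  by rewrite mule_ge0 ?hardy_term_ge0// lee_fin ltW// dim_const_gt0// ltr_wpDl.
have ad : ((dim_const k m sg)%:E * hardy_term k s p alpha beta u * hardy_integral k s p alpha beta +?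
  c%:E * remainder k s p alpha beta u)%E.
  by apply: ge0_adde_def; rewrite inE mule_ge0// lee_fin.
have cv := cvgeD (FF := eventually_filter) ad cvC cvR.
have le n := @cut_inequality c (cutoff n) P c0 pc (cutoff01 n) Pu.
have lim_le : ((dim_const k m sg)%:E * hardy_term k s p alpha beta u * hardy_integral k s p alpha beta +
  c%:E * remainder k s p alpha beta u <= energy k s p alpha beta u)%E.
  have <- := cvg_lim (@ereal_hausdorff R) cv.
  apply: lime_le; first by apply/cvg_ex; eexists; exact: cv.
  by apply: nearW => n; exact: le.
rewrite /hardy_remainder_ineq hardy_constE EFinM HE leeBrDr; last first.
  by rewrite !fin_numM// -HE.
by rewrite addeC [X in (X + _ <= _)%E]muleAC.
Qed.

End hardy_remainder.

Theorem theorem1p3 (R : realType) (d k : nat) (s p alpha beta : R)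
    (hd : (1 <= d)%N) (hp : 1 < p < 2) (hs : 0 < s < 1)
    (hk : (1 <= k <= d)%N)
    (ha : - k%:R < alpha < s * p)
    (hb : - k%:R < beta < s * p)
    (hab : - k%:R < alpha + beta < s * p) :
  (s * p != k%:R + alpha + beta -> 0 < hardy_const d s p k alpha beta) /\
  forall u : 'rV[R]_d -> R,
    (s * p < k%:R + alpha + beta /\ C1c setT u) \/
    (s * p > k%:R + alpha + beta /\ C1c (~` singular_set k d) u) ->
    hardy_remainder_ineq k s p alpha beta
      (Num.max ((p - 1) / p) (p * (p - 1) / 2)) u /\
    ((forall x, 0 <= u x) ->
     hardy_remainder_ineq k s p alpha beta (p - 1) u).
Proof.
have /andP[p1 p2] := hp; have p0 : 0 < p by exact: lt_trans p1.
have /andP[s0 _] := hs; have sg0 : 0 < s * p by rewrite mulr_gt0.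
have /andP[k0 kd] := hk; have /andP[_ hab2] := hab.
have ks : 0 < k%:R + s * p by rewrite ltr_wpDl.
(* From here d is k + m, so that vectors split as [row_mx] of their first k and last m
   coordinates. *)
rewrite -(subnKC kd) in hd *; move: (d - k)%N => m in hd *.
split=> [ne|u hu].
  rewrite hardy_constE mulr_gt0 ?dim_const_gt0// -lte_fin hardy_const1_integral//.
  exact: hardy_integral_gt0.
have g0 : (k%:R + alpha + beta - s * p) / p != 0.
  apply: mulf_neq0; last by rewrite invr_eq0 gt_eqF.
  by rewrite subr_eq0; case: hu => [[h _]|[h _]]; [rewrite gt_eqF|rewrite lt_eqF].
have cu : continuous u.
  move=> x; apply: differentiable_continuous.
  by case: hu => [[_ [[du _] _ _]]|[_ [[du _] _ _]]]; exact: du.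
have mu := continuous_measurable_rV cu.
have hfin : (hardy_term k s p alpha beta u < +oo)%E.
  apply: hardy_term_lty => //.
    by case: hu => [[_ [_ ? _]]|[_ [_ ? _]]].
  case: hu => [[h _]|[_ [_ _ ?]]]; [left|by right].
  by move: h; clear; lra.
have /andP[c0 c1] := max_const_le hp.
split=> [|u0].
  by apply: (hardy_remainder_picone k0 p1 hs ha hb hab2 g0 mu hfin c0 (picone_const_all hp)).
apply: (hardy_remainder_picone k0 p1 hs ha hb hab2 g0 mu hfin _ (picone_const_nneg hp)).
  by rewrite subr_ge0 ltW.
by move=> x; rewrite /ground_state mulr_ge0 ?powR_ge0.
Qed.
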